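(* Let $1\le p,q\le\infty$, $r\in\mathbb{N}$, $r\le 2\ell$ and $r_{\lambda,p,q}>0$. For $n\in\mathbb{N}$ let $m(n)$ be the largest integer $m$ such that $2(m+\ell+j_0)-1\le n$. Let $S_n\in\mathcal{S}_n$ be either (i) the B-spline quasi-interpolation operator $Q_{\rho,m(n)}$, where $\rho>0$ is fixed with $\rho<\left(\min\left\{1,\frac{2\ell-1}{\nu_\lambda^\lambda(\ell+j_0)a\lambda}\right\}\right)^{1/\lambda}$, or (ii) (for $\ell>1$) the B-spline interpolation operator $P_{\rho,m(n)}$, where $\rho>0$ is fixed with $\rho<\left(\min\left\{1,\frac{2\ell-1}{\nu_\lambda^\lambda(2^\kappa j_0+2\ell)2^{-\kappa\lambda}a\lambda}\right\}\right)^{1/\lambda}$. Then $S_n$ is asymptotically optimal for the sampling $n$-widths $\varrho_n(\boldsymbol{W}^r_{p,w}(\mathbb{R}),L_{q,w}(\mathbb{R}))$, and $$\varrho_n\bigl(\boldsymbol{W}^r_{p,w}(\mathbb{R}),L_{q,w}(\mathbb{R})\bigr)\asymp\sup_{f\in\boldsymbol{W}^r_{p,w}(\mathbb{R})}\|f-S_nf\|_{L_{q,w}(\mathbb{R})}\asymp n^{-r_{\lambda,p,q}},$$ that is, $\varrho_n(\boldsymbol{W}^r_{p,w}(\mathbb{R}),L_{q,w}(\mathbb{R}))\asymp n^{-r_{\lambda,p,q}}$ for all $n\in\mathbb{N}$, and the equivalence with the middle quantity holds for all $n$ with $m(n)\ge1$. Here $A_n\asymp B_n$ means $cA_n\le B_n\le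 CA_n$ with constants $c,C>0$ independent of $n$.
   Context: Weight: fix $\lambda>1$, $a>0$ and let $w(x)=\exp(-a|x|^\lambda)$, $x\in\mathbb{R}$. Spaces: for a measurable set $\Omega\subset\mathbb{R}$ and $1\le q<\infty$, $L_{q,w}(\Omega)$ is the space of measurable $f$ on $\Omega$ with finite norm $\|f\|_{L_{q,w}(\Omega)}=(\int_\Omega|f(x)w(x)|^q\,dx)^{1/q}$; $L_{\infty,w}(\Omega)=C_w(\Omega)$ is the space of continuous $f$ on $\Omega$ with finite norm $\sup_{x\in\Omega}|f(x)w(x)|$ (the same supremum expression is used to measure errors that are not continuous because of truncation). For $r\in\mathbb{N}$, $1\le p\le\infty$, $W^r_{p,w}(\mathbb{R})$ is the space of $f\in L_{p,w}(\mathbb{R})$ whose weak derivatives $f^{(k)}$, $0\le k\le r$, belong to $L_{p,w}(\mathbb{R})$ (so $f^{(r-1)}$ is absolutely continuous), with norm $\|f\|_{W^r_{p,w}(\mathbb{R})}=(\sum_{k=0}^r\|f^{(k)}\|_{L_{p,w}(\mathbb{R})}^p)^{1/p}$ (usual modification for $p=\infty$). Elements are identified with their continuous representatives; $\boldsymbol{W}^r_{p,w}(\mathbb{R})$ is the unit ball of $W^r_{p,w}(\mathbb{R})$. Sampling widths: $\mathcal{S}_n$ is the family of all linear sampling algorithms $S_kf=\sum_{i=1}^kf(y_i)\phi_i$ with $k\le n$, points $y_1,\dots,y_k\in\mathbb{R}$ (possibly coinciding) and functions $\phi_1,\dots,\phi_k$ on $\mathbb{R}$. For a set $F$ of continuous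 functions in a normed space $X$ of functions on $\mathbb{R}$, $\varrho_n(F,X):=\inf_{S_n\in\mathcal{S}_n}\sup_{f\in F}\|f-S_nf\|_X$. ''Asymptotically optimal'' means $\sup_{f\in F}\|f-S_nf\|_X\asymp\varrho_n(F,X)$. Exponents (with $1/\infty:=0$): $r_\lambda:=r(1-1/\lambda)$; $\delta_{\lambda,p,q}:=(1-1/\lambda)(1/p-1/q)$ if $p\le q$ and $\delta_{\lambda,p,q}:=(1/\lambda)(1/q-1/p)$ if $p>q$; $r_{\lambda,p,q}:=r_\lambda-\delta_{\lambda,p,q}$. Mhaskar–Rakhmanov–Saff number and mesh: $a_m:=\nu_\lambda m^{1/\lambda}$ with $\nu_\lambda:=\bigl(2^{\lambda-1}\Gamma(\lambda/2)^2/\Gamma(\lambda)\bigr)^{1/\lambda}$; for $0<\rho<1$, $h_m:=\rho a_m/m$. B-spline operators: fix $\ell\in\mathbb{N}$ and let $M$ be the symmetric cardinal B-spline of order $2\ell$ with support $[-\ell,\ell]$ and knots at the integers $-\ell,\dots,\ell$, i.e. $M(x)=\frac{1}{(2\ell-1)!}\sum_{k=0}^{2\ell}(-1)^k\binom{2\ell}{k}(x-k+\ell)_+^{2\ell-1}$, $x_+:=\max(0,x)$. Fix a finite even real sequence $(\lambda(j))_{|j|\le j_0}$ ($\lambda(-j)=\lambda(j)$), $j_0\ge\ell-1$, such that the quasi-interpolation operator $Qf(x):=\sum_{s\in\mathbb{Z}}\sum_{|j|\le j_0}\lambda(j)f(s-j)M(x-s)$ satisfies $Qf=f$ for every polynomial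 $f$ of degree at most $2\ell-1$. For $\ell>1$ let $\kappa:=\lceil\log_2(2\ell)-1\rceil$, $Rf(x):=M(0)^{-1}\sum_{s\in\mathbb{Z}}f(s)M(2^\kappa(x-s))$, and $P:=R+Q-RQ$ (where $RQ$ is the composition $f\mapsto R(Qf)$). For an operator $A\in\{Q,P\}$ and $h>0$ put $A_h:=\sigma_h\circ A\circ\sigma_{1/h}$, where $\sigma_hf(x):=f(x/h)$. For $m\in\mathbb{N}$ the truncated operators are $A_{\rho,m}f(x):=A_{h_m}f(x)$ for $x\in[-\rho a_m,\rho a_m]$ and $A_{\rho,m}f(x):=0$ otherwise; $Q_{\rho,m}f$ and $P_{\rho,m}f$ use only the $2(m+\ell+j_0)-1$ values $f(kh_m)$, $|k|\le m+\ell+j_0-1$. *)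

(* Defs.v *)
From HB Require Import structures.
From mathcomp Require Import all_boot all_order all_algebra.
From mathcomp Require Import all_classical all_reals all_analysis.

Set Implicit Arguments.
Unset Strict Implicit.
Unset Printing Implicit Defensive.

Import Order.TTheory GRing.Theory Num.Theory.
Import numFieldNormedType.Exports.

Local Open Scope classical_set_scope.
Local Open Scope ring_scope.

(** * Weighted Lebesgue spaces on the real line *)

Section WeightedLebesgue.
Context {R : realType}.
Local Notation mu := (@lebesgue_measure R).

Definition weight (lam a x : R) : R := expR (- a * `|x| `^ lam).

(* The measurable sets of [R] in the library are the Borel sets; a function is
   Lebesgue measurable iff it agrees almost everywhere with a Borel one. *)
Definition lebesgue_measurable_fun (f : R -> R) : Prop :=
  exists2 g : R -> R, measurable_fun [set: R] g & f = g %[ae mu].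

(* For [q = +oo] this is a genuine supremum, defined also for discontinuous
   functions. For [q] finite, the integral of the library is a lower integral
   on non-measurable functions and may vanish there, so those functions (which
   are outside the space) are given the norm [+oo]. *)
Definition wnorm (lam a : R) (q : \bar R) (f : R -> R) : \bar R :=
  if q is _%:E then
    if `[< lebesgue_measurable_fun f >]
    then Lnorm mu q (fun x => (f x * weight lam a x)%:E) else +oo%E
  else ereal_sup (range (fun x => `|f x * weight lam a x|%:E)).

(* [L_{q,w}(R)] for [q] finite, [C_w(R)] for [q = +oo]. *)
Definition wLspace (lam a : R) (q : \bar R) : set (R -> R) :=
  [set f | (if q is _%:E then lebesgue_measurable_fun f else continuous f)
           /\ (wnorm lam a q f < +oo)%E].

(** * Weighted Sobolev spaces *)

Definition test_function (phi : R -> R) : Prop :=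
  (forall k x, derivable (derive1n k phi) x 1) /\
  (exists A : R, forall x, A < `|x| -> phi x = 0).

Definition weak_derivative (k : nat) (f g : R -> R) : Prop :=
  forall phi, test_function phi ->
    \int[mu]_x (f x * derive1n k phi x) = (-1) ^+ k * \int[mu]_x (g x * phi x).

(* [D k] is the weak derivative of order [k] of [f], which is the continuous
   representative of its class. *)
Definition sobolev_derivatives (lam a : R) (r : nat) (p : \bar R)
    (f : R -> R) (D : nat -> R -> R) : Prop :=
  [/\ continuous f, D 0%N = f &
    forall k, (k <= r)%N -> weak_derivative k f (D k) /\ wLspace lam a p (D k)].

Definition sobolev_space (lam a : R) (r : nat) (p : \bar R) : set (R -> R) :=
  [set f | exists D, sobolev_derivatives lam a r p f D].

Definition sobolev_norm (lam a : R) (r : nat) (p : \bar R)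
    (D : nat -> R -> R) : \bar R :=
  if p is x%:E then
    ((\sum_(k < r.+1) wnorm lam a p (D k) `^ x) `^ x^-1)%E
  else (\big[maxe/0%E]_(k < r.+1) wnorm lam a p (D k))%E.

(* Weak derivatives are unique almost everywhere, so the norm does not depend
   on the choice of [D]. *)
Definition sobolev_ball (lam a : R) (r : nat) (p : \bar R) : set (R -> R) :=
  [set f | exists2 D, sobolev_derivatives lam a r p f D &
                      (sobolev_norm lam a r p D <= 1)%E].

(** * Linear sampling algorithms and sampling widths *)

Definition sampling_algorithms (n : nat) : set ((R -> R) -> R -> R) :=
  [set S | exists k : nat, exists y : 'I_k -> R, exists phi : 'I_k -> R -> R,
     (k <= n)%N /\ forall f x, S f x = \sum_(i < k) f (y i) * phi i x].

(* Worst-case error of [S] over [F] in [L_{q,w}(R)]. *)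
Definition sampling_error (lam a : R) (q : \bar R) (F : set (R -> R))
    (S : (R -> R) -> R -> R) : \bar R :=
  ereal_sup [set wnorm lam a q (f \- S f) | f in F].

Definition sampling_width (lam a : R) (q : \bar R) (F : set (R -> R))
    (n : nat) : \bar R :=
  ereal_inf [set sampling_error lam a q F S | S in sampling_algorithms n].

Definition asymp (E : set nat) (A B : nat -> \bar R) : Prop :=
  exists c C : R, [/\ 0 < c, 0 < C &
    forall n, E n -> (c%:E * A n <= B n)%E /\ (B n <= C%:E * A n)%E].

(** * Exponents *)

Definition inv_exponent (p : \bar R) : R := if p is x%:E then x^-1 else 0.

Definition delta_exponent (lam : R) (p q : \bar R) : R :=
  if (p <= q)%E then (1 - lam^-1) * (inv_exponent p - inv_exponent q)
  else lam^-1 * (inv_exponent q - inv_exponent p).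

Definition rate_exponent (lam : R) (p q : \bar R) (r : nat) : R :=
  r%:R * (1 - lam^-1) - delta_exponent lam p q.

(** * Mhaskar-Rakhmanov-Saff numbers *)

Definition Gamma (x : R) : R :=
  \int[mu]_(t in `]0, +oo[) (t `^ (x - 1) * expR (- t)).

Definition MRS_const (lam : R) : R :=
  (2 `^ (lam - 1) * Gamma (lam / 2) ^+ 2 / Gamma lam) `^ lam^-1.

Definition MRS_number (lam : R) (m : nat) : R :=
  MRS_const lam * m%:R `^ lam^-1.

Definition mesh (lam rho : R) (m : nat) : R := rho * MRS_number lam m / m%:R.

End WeightedLebesgue.

(** * B-spline quasi-interpolation and interpolation *)

Section BSplines.
Context {R : realType}.

Definition bspline (l : nat) (x : R) : R :=
  ((2 * l).-1)`!%:R^-1 *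
  \sum_(k < (2 * l).+1)
    (-1) ^+ k * 'C(2 * l, k)%:R * Num.max 0 (x - k%:R + l%:R) ^+ (2 * l).-1.

(* The sums over the integers are finite for each [x], the B-spline being
   compactly supported. Only the values [c j] with [|j| <= j0] matter. *)
Definition quasi_interp (l j0 : nat) (c : int -> R) (f : R -> R) (x : R) : R :=
  \sum_(s \in [set: int]) \sum_(j \in [set j : int | `|j| <= j0%:Z])
    c j * f ((s - j)%:~R) * bspline l (x - s%:~R).

Definition quasi_interp_mask (l j0 : nat) (c : int -> R) : Prop :=
  (forall j : int, `|j| <= j0%:Z -> c (- j) = c j) /\
  (forall P : {poly R}, (size P <= 2 * l)%N ->
     forall x, quasi_interp l j0 c (fun t => P.[t]) x = P.[x]).

Definition kappa (l : nat) : int :=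
  Num.ceil (ln (2 * l)%:R / ln 2 - 1 : R).

Definition spline_interp0 (l : nat) (f : R -> R) (x : R) : R :=
  (bspline l 0)^-1 *
  \sum_(s \in [set: int]) f (s%:~R) * bspline l (2 ^ kappa l * (x - s%:~R)).

Definition spline_interp (l j0 : nat) (c : int -> R) (f : R -> R) (x : R) : R :=
  spline_interp0 l f x + quasi_interp l j0 c f x
  - spline_interp0 l (quasi_interp l j0 c f) x.

Definition dilation (h : R) (f : R -> R) (x : R) : R := f (x / h).

Definition scaled_op (A : (R -> R) -> R -> R) (h : R) : (R -> R) -> R -> R :=
  dilation h \o A \o dilation h^-1.

Definition truncated_op (A : (R -> R) -> R -> R) (lam rho : R) (m : nat)
    (f : R -> R) (x : R) : R :=
  if `|x| <= rho * MRS_number lam m then scaled_op A (mesh lam rho m) f x else 0.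

Definition quasi_interp_bound (lam a : R) (l j0 : nat) : R :=
  (Num.min 1 ((2 * l%:R - 1) /
     (MRS_const lam `^ lam * (l + j0)%:R * a * lam))) `^ lam^-1.

Definition spline_interp_bound (lam a : R) (l j0 : nat) : R :=
  (Num.min 1 ((2 * l%:R - 1) /
     (MRS_const lam `^ lam * (2 ^ kappa l * j0%:R + 2 * l%:R)
      * 2 `^ (- (kappa l)%:~R * lam) * a * lam))) `^ lam^-1.

End BSplines.

(* The largest natural number [m] with [2(m + l + j0) - 1 <= n], and 0 if there
   is none; for [l >= 1], such an [m] is at most [n]. *)
Definition mesh_index (l j0 n : nat) : nat :=
  \max_(m < n.+1 | (2 * (m + l + j0) - 1 <= n)%N) m.

(* Main.v *)
Require Import Defs.
From HB Require Import structures.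
From mathcomp Require Import all_boot all_order all_algebra.
From mathcomp Require Import all_classical all_reals all_analysis measurable_realfun.
From mathcomp Require Import ring lra zify.
Set Implicit Arguments.
Unset Strict Implicit.
Unset Printing Implicit Defensive.
Import Order.TTheory GRing.Theory Num.Theory.
Import numFieldNormedType.Exports.
Local Open Scope classical_set_scope.
Local Open Scope ring_scope.

(* Write [om = 1 - 1/lam] and [E = r - 1/p + 1/q].

   Centre. On [-T, T], [T ~ m^(1/lam)], the mesh [h ~ T / m] satisfies
   [T^(lam-1) h ~ 1], so that the weight is essentially constant on windows of
   boundedly many cells. The functional [f |-> f x - (A_h f) x] is local and kills
   polynomials of degree less than [r], hence is bounded by [h^(r-1)] times the
   integral of [|f^(r)|] over such a window. Summing over the [2m] cells gives
   [h^E], times [m^(1/q-1/p)] if [q < p].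

   Tails. Put nodes at [x_j = (La j)^(1/lam)], so that [w (x_j) = exp (- a La j)].
   Extrapolating [f] from cell [j] to cell [j+1] by Lagrange interpolation costs a
   factor independent of [La], which the decay of the weight beats if [La] is large.
   The weighted suprema on the cells then satisfy a contractive recursion driven by
   the local norms of [f^(r)], and the tail beyond [T] obeys the same bound as the
   centre.

   Lower bound. Half of the [2n] cells of length [h = T / (2n)] in [T, 2T],
   [T = n^(1/lam)], contain no sampling point. A sum of scaled bumps in one
   ([p <= q]) or in [n] ([q < p]) of these empty cells is not seen by the algorithm. *)

(** * Weighted sequences *)

(** All norms are read cell by cell. The derivative f^(r) enters only through the sequence of its
    weighted p-norms on cells, bounded in l_p; the error leaves as suprema on cells times the cell
    length to the power 1/q, to be bounded in l_q. Passing from l_p to l_q is an embedding if p <=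
    q, and Hoelder's inequality with 1/s = 1/q - 1/p if q < p. On the 2m central cells Hoelder costs
    m^(1/q-1/p). On the infinite tail, whose cells carry the factor j^(-om E), it requires om E s >
    1, which is exactly the positivity of r_{lam,p,q}, and from cell J on it costs J^(1/q-1/p).
    Hence centre and tail share one rate.

    The exponent E collects three powers of the cell length: r - 1 from Peano's remainder, 1 - 1/p
    from Hoelder's inequality on a cell, 1/q from the q-norm of a cell. With h ~ m^(1/lam-1) this
    gives m^(-om E).

    In the tail no sample is available, and f is controlled only by its own weighted norm and that
    of f^(r). Extrapolation carries the control outwards one cell at a time, so that weights are
    compared only across three neighbouring cells. *)

Local Notation inve := inv_exponent.

Lemma le_of_eq d (T : porderType d) (x y : T) : x = y -> (x <= y)%O.
Proof. by move=> ->. Qed.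

Section PositivePowers.
Context {R : realType}.
Implicit Types x s t : R.

Lemma gt0_powRD x s t : 0 < x -> x `^ (s + t) = x `^ s * x `^ t.
Proof. by move=> x0; apply: powRD; apply/implyP => _; rewrite gt_eqF. Qed.

Lemma gt0_powRB x s t : 0 < x -> x `^ (s - t) = x `^ s / x `^ t.
Proof. by move=> x0; apply: powRB; apply/implyP => _; rewrite gt_eqF. Qed.

End PositivePowers.

Section SequenceNorms.
Context {R : realType}.
Implicit Types (e p q : \bar R) (u v b : nat -> R) (K L B : R).

(** Membership in the ball of radius K of l_e, stated through partial sums so that no series has to
    converge beforehand; it is meant for nonnegative sequences. *)
Definition lp_bounded e v K : Prop :=
  if e is x%:E then forall N, \sum_(i < N) v i `^ x <= K `^ x
  else forall i, v i <= K.

Lemma le_lp_bounded e u v K : (1 <= e)%E -> (forall i, 0 <= v i <= u i) ->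
  lp_bounded e u K -> lp_bounded e v K.
Proof.
case: e => [x| |]//= e1 vu.
- move=> uK N; apply: le_trans (uK N); apply: ler_sum => i _.
  have /andP[v0 vui] := vu i.
  by apply: ge0_ler_powR; rewrite ?nnegrE//; [rewrite lee_fin in e1; lra|lra].
- by move=> uK i; apply: le_trans (uK i); have /andP[] := vu i.
Qed.

Lemma lp_bounded_le e v K i : (1 <= e)%E -> 0 <= K -> (forall i, 0 <= v i) ->
  lp_bounded e v K -> v i <= K.
Proof.
case: e => [x| |]//= e1 K0 v0 vK.
rewrite lee_fin in e1.
rewrite leNgt; apply/negP => Kv.
have := vK i.+1; rewrite big_ord_recr/= leNgt => /negP; apply.
apply: (@lt_le_trans _ _ (v i `^ x)); last first.
  by rewrite lerDr; apply: sumr_ge0 => j _; exact: powR_ge0.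
by apply: gt0_ltr_powR; rewrite ?nnegrE//; lra.
Qed.

Lemma lp_boundedW e v K L : (1 <= e)%E -> 0 <= K -> K <= L ->
  lp_bounded e v K -> lp_bounded e v L.
Proof.
case: e => [x| |]//= e1 K0 KL.
- rewrite lee_fin in e1; move=> vK N; apply: (le_trans (vK N)).
  by apply: ge0_ler_powR; rewrite ?nnegrE//; lra.
- by move=> vK i; exact: le_trans (vK i) KL.
Qed.

Lemma lp_boundedZ e v K L : (1 <= e)%E -> 0 <= L -> 0 <= K -> (forall i, 0 <= v i) ->
  lp_bounded e v K -> lp_bounded e (fun i => L * v i) (L * K).
Proof.
case: e => [x| |]//= e1 L0 K0 v0 vK.
- move=> N; rewrite powRM//.
  under eq_bigr do rewrite powRM//.
  by rewrite -mulr_sumr ler_wpM2l// powR_ge0.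
- by move=> i; rewrite ler_wpM2l.
Qed.

(** A crude form of Minkowski's inequality: u + v is at most twice the larger term, and the sum of
    the two powers costs a second factor 2, absorbed because the exponent is at least 1. *)
Lemma lp_boundedD e u v K L : (1 <= e)%E -> 0 <= K -> 0 <= L ->
  (forall i, 0 <= u i) -> (forall i, 0 <= v i) ->
  lp_bounded e u K -> lp_bounded e v L ->
  lp_bounded e (fun i => u i + v i) (4 * (K + L)).
Proof.
case: e => [x| |]//= e1 K0 L0 u0 v0 uK vL; last first.
  by move=> i; have := uK i; have := vL i; lra.
rewrite lee_fin in e1; move=> N.
have x0 : 0 <= x by lra.
have h i : (u i + v i) `^ x <= 2 `^ x * (u i `^ x + v i `^ x).
  rewrite mulrDr -!powRM//.
  have [uv|vu] := leP (u i) (v i).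
    apply: (@le_trans _ _ ((2 * v i) `^ x)).
      by apply: ge0_ler_powR; rewrite ?nnegrE// ?addr_ge0 ?mulr_ge0//; have := u0 i; lra.
    by rewrite lerDr powR_ge0.
  apply: (@le_trans _ _ ((2 * u i) `^ x)).
    by apply: ge0_ler_powR; rewrite ?nnegrE// ?addr_ge0 ?mulr_ge0//; have := u0 i; lra.
  by rewrite lerDl powR_ge0.
apply: (@le_trans _ _ (2 `^ x * (K `^ x + L `^ x))).
  apply: (@le_trans _ _ (\sum_(i < N) (2 `^ x * (u i `^ x + v i `^ x)))).
    by apply: ler_sum => i _; exact: h.
  rewrite -mulr_sumr ler_wpM2l ?powR_ge0// big_split/=.
  by apply: lerD; [exact: uK|exact: vL].
have -> : 4 * (K + L) = 2 * (2 * (K + L)) :> R by ring.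
rewrite [leRHS]powRM ?mulr_ge0 ?addr_ge0//.
rewrite ler_wpM2l ?powR_ge0//.
rewrite powRM ?addr_ge0//.
apply: (@le_trans _ _ (2 * (K + L) `^ x)).
  have -> : 2 * (K + L) `^ x = (K + L) `^ x + (K + L) `^ x by ring.
  by apply: lerD; apply: ge0_ler_powR; rewrite ?nnegrE ?addr_ge0//; lra.
by rewrite ler_wpM2r ?powR_ge0//; apply: le1r_powR => //; lra.
Qed.

Lemma lp_bounded_shift e v K k : (1 <= e)%E ->
  lp_bounded e v K -> lp_bounded e (fun i => v (k + i)%N) K.
Proof.
case: e => [x| |]//= e1 vK.
move=> N; apply: le_trans (vK (k + N)%N).
rewrite big_split_ord/= lerDr; apply: sumr_ge0 => i _; exact: powR_ge0.
Qed.

Lemma lp_bounded_window e k : (1 <= e)%E ->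
  exists2 C : R, 0 < C & forall v K, 0 <= K -> (forall i, 0 <= v i) ->
    lp_bounded e v K -> lp_bounded e (fun i => \sum_(j < k) v (i + j)%N) (C * K).
Proof.
move=> e1; elim: k => [|k [C C0 IH]].
  exists 1 => // v K K0 v0 vK; rewrite mul1r; apply: le_lp_bounded e1 _ vK => i.
  by rewrite big_ord0 lexx v0.
exists (4 * (C + 1)); first lra.
move=> v K K0 v0 vK; have CK0 : 0 <= C * K by rewrite mulr_ge0// ltW.
have -> : 4 * (C + 1) * K = 4 * (C * K + K) by ring.
have -> : (fun i => \sum_(j < k.+1) v (i + j)%N) =
          (fun i => \sum_(j < k) v (i + j)%N + v (k + i)%N).
  by apply/funext => i; rewrite big_ord_recr/= addnC.
apply: (@lp_boundedD e (fun i => \sum_(j < k) v (i + j)%N) (fun i => v (k + i)%N)) => //.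
- by move=> i; apply: sumr_ge0.
- exact: IH.
- exact: lp_bounded_shift.
Qed.

(** For finite e = x, either v_i <= V_i / 4 and V_(i+1) <= 3/4 V_i, or V_(i+1) <= 3 v_i. Hence the
    partial sums s of V^x satisfy s <= K^x + 3/4 s + (3K)^x, and s can be absorbed on the left. *)
Lemma lp_bounded_recursion e (V : nat -> R) v K : (1 <= e)%E -> 0 <= K ->
  (forall i, 0 <= v i) -> (forall i, 0 <= V i) ->
  V 0%N <= K -> (forall i, V i.+1 <= 2^-1 * V i + v i) ->
  lp_bounded e v K -> lp_bounded e V (24 * K).
Proof.
case: e => [x| |]//= e1 K0 v0 V0 VK Vrec vK; last first.
  suff h i : V i <= 4 * K by move=> i; have := h i; lra.
  elim: i => [|i IH]; first by lra.
  by have := Vrec i; have := vK i; lra.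
rewrite lee_fin in e1; have x0 : 0 <= x by lra.
have step i : V i.+1 `^ x <= 3 / 4 * V i `^ x + (3 * v i) `^ x.
  have Vi := V0 i; have vi := v0 i.
  have [vV|Vv] := leP (v i) (4^-1 * V i).
    apply: (@le_trans _ _ ((3 / 4 * V i) `^ x)).
      by apply: ge0_ler_powR; rewrite ?nnegrE//; have := Vrec i; lra.
    rewrite (@powRM _ (3 / 4))//.
    have h : (3 / 4 : R) `^ x <= 3 / 4 by apply: ge1r_powR => //; lra.
    apply: (@le_trans _ _ (3 / 4 * V i `^ x)); first by rewrite ler_wpM2r ?powR_ge0.
    by rewrite lerDl powR_ge0.
  apply: (@le_trans _ _ ((3 * v i) `^ x)).
    by apply: ge0_ler_powR; rewrite ?nnegrE//; have := Vrec i; lra.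
  by have := powR_ge0 (V i) x; lra.
move=> N.
have vK' : \sum_(i < N) (3 * v i) `^ x <= (3 * K) `^ x.
  rewrite (eq_bigr (fun i : 'I_N => 3 `^ x * v i `^ x)) => [|i _]; last by rewrite powRM.
  by rewrite powRM// -mulr_sumr ler_wpM2l ?powR_ge0.
set s := \sum_(i < N) _ in vK' *.
have h1 : \sum_(i < N.+1) V i `^ x <= K `^ x + (3 / 4 * (\sum_(i < N) V i `^ x) + (3 * K) `^ x).
  rewrite big_ord_recl; apply: lerD.
    by apply: ge0_ler_powR; rewrite ?nnegrE//; lra.
  apply: (@le_trans _ _ (\sum_(i < N) (3 / 4 * V i `^ x + (3 * v i) `^ x))).
    by apply: ler_sum => i _; exact: step.
  by rewrite big_split/= -mulr_sumr lerD2l.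
have h2 : \sum_(i < N) V i `^ x <= \sum_(i < N.+1) V i `^ x.
  by rewrite big_ord_recr/= lerDl powR_ge0.
have h3 : K `^ x <= (3 * K) `^ x.
  by apply: ge0_ler_powR; rewrite ?nnegrE//; lra.
apply: (@le_trans _ _ (8 * (3 * K) `^ x)); first lra.
have -> : 24 * K = 8 * (3 * K) by ring.
rewrite [leRHS]powRM ?mulr_ge0// ler_wpM2r ?powR_ge0//.
by apply: le1r_powR; lra.
Qed.

Lemma lp_bounded_embed p q v K : (1 <= p)%E -> (p <= q)%E -> 0 <= K ->
  (forall i, 0 <= v i) -> lp_bounded p v K -> lp_bounded q v K.
Proof.
move=> p1 pq K0 v0 vK.
have ub i : v i <= K by apply: lp_bounded_le vK.
case: q pq => [y| |]//=.
case: p p1 vK => [x| |]//= x1 vK xy N.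
rewrite !lee_fin in x1 xy.
have split t : 0 <= t -> t `^ y = t `^ (y - x) * t `^ x.
  move=> t0; rewrite -powRD ?subrK//; apply/implyP => /eqP h; exfalso; lra.
rewrite [leRHS]split//.
apply: (@le_trans _ _ (K `^ (y - x) * \sum_(i < N) v i `^ x)).
  rewrite mulr_sumr; apply: ler_sum => i _; rewrite split//.
  rewrite ler_wpM2r ?powR_ge0//.
  by apply: ge0_ler_powR; rewrite ?nnegrE//; lra.
by rewrite ler_wpM2l ?powR_ge0//; exact: vK.
Qed.

(** Takes the place of Young's inequality in [lp_bounded_holder]: when 1/u + 1/w = 1/y, the larger
    of P^u and Q^w alone dominates (PQ)^y. *)
Lemma powR_mul_le (P Q u w y : R) : 0 <= P -> 0 <= Q -> 0 < u -> 0 < w -> 0 <= y ->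
  P `^ u <= Q `^ w -> (1 + w / u) * y = w -> (P * Q) `^ y <= Q `^ w.
Proof.
move=> P0 Q0 u0 w0 y0 PQ E.
have PQ' : P <= Q `^ (w / u).
  have -> : P = (P `^ u) `^ u^-1 by rewrite -powRrM mulfV ?powRr1// gt_eqF.
  rewrite powRrM; apply: ge0_ler_powR; rewrite ?nnegrE ?powR_ge0//.
  by rewrite invr_ge0 ltW.
have -> : Q `^ w = (Q `^ (1 + w / u)) `^ y by rewrite -powRrM E.
apply: ge0_ler_powR; rewrite ?nnegrE ?mulr_ge0 ?powR_ge0//.
rewrite powRD; last first.
  by apply/implyP => /eqP h; have := divr_gt0 w0 u0; lra.
by rewrite powRr1// mulrC ler_wpM2l.
Qed.

Lemma lp_bounded_holder p q b v K B : (1 <= q)%E -> (q < p)%E -> 0 < K -> 0 < B ->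
  (forall i, 0 <= v i) -> (forall i, 0 <= b i) ->
  (forall N, \sum_(i < N) b i `^ (inve q - inve p)^-1
             <= B `^ (inve q - inve p)^-1) ->
  lp_bounded p v K -> lp_bounded q (fun i => b i * v i) (2 * (B * K)).
Proof.
case: q => [y| |]//= y1 yp K0 B0 v0 b0 bB vK N; last by case: p yp {bB vK}.
rewrite lee_fin in y1.
set s := (y^-1 - inve p)^-1 in bB.
(* After this normalisation the s-sums of X, and for finite p the p-sums of Y, are at most 1; the
   pointwise bound by X^s + Y^p then produces the factor 2. *)
pose X i := b i / B; pose Y i := v i / K.
have X0 i : 0 <= X i by rewrite divr_ge0// ltW.
have Y0 i : 0 <= Y i by rewrite divr_ge0// ltW.
have XN M : \sum_(i < M) X i `^ s <= 1.
  have Bs : 0 < B `^ s by exact: powR_gt0.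
  rewrite -(ler_pM2r Bs) mul1r mulr_suml.
  apply: le_trans (bB M); apply: ler_sum => i _.
  by rewrite -powRM//; last exact: ltW; rewrite divfK// gt_eqF.
suff h : \sum_(i < N) (X i * Y i) `^ y <= 2.
  have -> : \sum_(i < N) (b i * v i) `^ y =
            (B * K) `^ y * \sum_(i < N) (X i * Y i) `^ y.
    rewrite mulr_sumr; apply: eq_bigr => i _.
    rewrite -[RHS]powRM; [|by rewrite ltW ?mulr_gt0|by rewrite mulr_ge0].
    congr (_ `^ _); rewrite /X /Y; field.
    by rewrite !gt_eqF.
  rewrite [leRHS]powRM//; last by rewrite ltW ?mulr_gt0.
  rewrite mulrC ler_wpM2r ?powR_ge0//.
  by apply: (le_trans h); apply: le1r_powR; lra.
move: @s bB XN yp vK; case: p => [x| |] // s _ XN yp vK; last first.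
  have -> : 2 = 1 + 1 :> R by ring.
  rewrite -[leLHS]addr0; apply: lerD => //.
  apply: le_trans (XN N); apply: ler_sum => i _.
  rewrite /s subr0 invrK; apply: ge0_ler_powR; rewrite ?nnegrE ?(mulr_ge0 (X0 i) (Y0 i))//; first lra.
  by rewrite ler_piMr// /Y ler_pdivrMr// mul1r.
rewrite lte_fin in yp.
have YN M : \sum_(i < M) Y i `^ x <= 1.
  have Bs : 0 < K `^ x by exact: powR_gt0.
  rewrite -(ler_pM2r Bs) mul1r mulr_suml.
  apply: le_trans (vK M); apply: ler_sum => i _.
  by rewrite -powRM//; last exact: ltW; rewrite divfK// gt_eqF.
have s0 : 0 < s by rewrite /s invr_gt0 subr_gt0 ltf_pV2// posrE; lra.
have e1 : (1 + x / s) * y = x by rewrite /s /= invrK; field; apply/andP; split; apply/eqP; lra.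
have e2 : (1 + s / x) * y = s.
  have -> : s = x * y / (x - y).
    rewrite /s /=; have -> : y^-1 - x^-1 = (x - y) / (x * y).
      by field; apply/andP; split; apply/eqP; lra.
    by rewrite invf_div.
  by field; apply/andP; split; apply/eqP; lra.
suff h i : (X i * Y i) `^ y <= X i `^ s + Y i `^ x.
  apply: (@le_trans _ _ (\sum_(i < N) (X i `^ s + Y i `^ x))).
    by apply: ler_sum => i _; exact: h.
  by rewrite big_split/=; have := XN N; have := YN N; lra.
have x0 : 0 < x by lra.
have [XY|YX] := leP (X i `^ s) (Y i `^ x).
  apply: le_trans (powR_mul_le _ _ s0 _ _ XY e1) _ => //; first lra.
  by rewrite lerDr powR_ge0.
rewrite mulrC; apply: le_trans (powR_mul_le _ _ x0 _ _ (ltW YX) e2) _ => //; first lra.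
by rewrite lerDl powR_ge0.
Qed.

Lemma lp_bounded_weight p q b v K B : (1 <= p)%E -> (1 <= q)%E -> 0 < K -> 0 < B ->
  (forall i, 0 <= v i) -> (forall i, 0 <= b i) ->
  (if (p <= q)%E then forall i, b i <= B else
   forall N, \sum_(i < N) b i `^ (inve q - inve p)^-1
             <= B `^ (inve q - inve p)^-1) ->
  lp_bounded p v K -> lp_bounded q (fun i => b i * v i) (2 * (B * K)).
Proof.
move=> p1 q1 K0 B0 v0 b0; case: ifPn => [pq bB vK|]; last first.
  by rewrite -ltNge => qp; exact: lp_bounded_holder.
have vKq := lp_bounded_embed p1 pq (ltW K0) v0 vK.
apply: (@lp_boundedW _ _ (B * K)) => //; first by rewrite mulr_ge0// ltW.
  by have := mulr_gt0 B0 K0; lra.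
apply: (@le_lp_bounded _ (fun i => B * v i)) => //.
  by move=> i; rewrite mulr_ge0//= ler_wpM2r.
by apply: lp_boundedZ => //; exact: ltW.
Qed.

(** The right-hand sides telescope, which replaces the comparison of the sum with an integral in
    [sum_powR_tail]. The inequality reduces to a bound on (t / (t + 1))^be, obtained from ln (1 + u)
    <= u and exp u >= 1 + u. *)
Lemma powR_telescope (be t : R) : 0 < be -> 1 <= t ->
  t `^ (- (1 + be)) <= (2 + be) / be * (t `^ (- be) - (t + 1) `^ (- be)).
Proof.
move=> be0 t1.
have t0 : 0 < t by lra.
have T0 : 0 < t + 1 by lra.
have -> : (t + 1) `^ (- be) = t `^ (- be) * (t / (t + 1)) `^ be.
  have tE : t = (t / (t + 1)) * (t + 1) by field; rewrite gt_eqF.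
  rewrite [in t `^ (- be)]tE powRM ?divr_ge0//; [|by rewrite ltW|by rewrite ltW..].
  rewrite mulrAC -powRD; last by apply/implyP => _; rewrite gt_eqF// divr_gt0.
  by rewrite addNr powRr0 mul1r.
have h : (t / (t + 1)) `^ be <= (t + 1) / (t + 1 + be).
  rewrite /powR ifF; last by rewrite gt_eqF// divr_gt0.
  have l1 : ln (t / (t + 1)) <= - (t + 1)^-1.
    have -> : t / (t + 1) = 1 + - (t + 1)^-1 by field; rewrite gt_eqF.
    apply: le_ln1Dx; rewrite ltrN2 invf_lt1//; lra.
  apply: (@le_trans _ _ (expR (- (be / (t + 1))))).
    by rewrite ler_expR -mulrN ler_wpM2l// ltW.
  rewrite expRN.
  have -> : (t + 1) / (t + 1 + be) = (1 + be / (t + 1))^-1.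
    by field; apply/andP; split; apply/eqP; lra.
  have := divr_gt0 be0 T0 => d0.
  by rewrite lef_pV2 ?posrE ?expR_gt0 ?expR_ge1Dx//; lra.
have -> : - (1 + be) = - 1 + - be by ring.
rewrite gt0_powRD//.
rewrite powR_inv1 ?(ltW t0)// mulrC.
rewrite -{2}[t `^ (- be)]mulr1 -mulrBr mulrCA ler_wpM2l ?powR_ge0//.
apply: (@le_trans _ _ ((2 + be) / be * (1 - (t + 1) / (t + 1 + be)))); last first.
  by rewrite ler_wpM2l ?lerB// divr_ge0//; lra.
have -> : (2 + be) / be * (1 - (t + 1) / (t + 1 + be)) = (2 + be) / (t + 1 + be).
  by field; apply/andP; split; apply/eqP; lra.
rewrite ler_pdivlMr; last lra.
rewrite mulrC ler_pdivrMr//; nra.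
Qed.

Lemma sum_powR_tail (ga : R) : 1 < ga -> exists2 C, 0 < C &
  forall J N, \sum_(i < N) (J + i).+1%:R `^ (- ga) <= C * J.+1%:R `^ (1 - ga).
Proof.
move=> ga1; pose be := ga - 1; exists ((2 + be) / be).
  by rewrite divr_gt0// /be; lra.
move=> J N.
have -> : 1 - ga = - be by rewrite /be; ring.
apply: (@le_trans _ _ ((2 + be) / be *
   (J.+1%:R `^ (- be) - (J + N).+1%:R `^ (- be)))); last first.
  by rewrite ler_wpM2l ?divr_ge0 ?gerBl ?powR_ge0// /be; lra.
elim: N => [|N IH]; first by rewrite big_ord0 addn0 subrr mulr0.
rewrite big_ord_recr/=.
have := @powR_telescope be (J + N).+1%:R.
have -> : 1 + be = ga by rewrite /be; ring.
rewrite natr1 addnS => h.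
have h' := h ltac:(by rewrite /be; lra) ltac:(by rewrite ler1n).
by move: IH h'; rewrite !mulrBr; lra.
Qed.

Lemma inv_exponent_lt p q : (1 <= q)%E -> (q < p)%E -> inve p < inve q.
Proof.
case: q => [y| |]//=; last by case: p.
rewrite lee_fin => y1.
case: p => [x| |]//=.
  by rewrite lte_fin => yx; rewrite ltf_pV2// posrE; lra.
by move=> _; rewrite invr_gt0; lra.
Qed.

Lemma inv_exponent_le1 p : (1 <= p)%E -> 0 <= inve p <= 1.
Proof.
case: p => [x| |]//=; last by rewrite ler01 lexx.
by rewrite lee_fin => x1; rewrite invr_ge0 invf_le1; lra.
Qed.

(** If q < p, with 1/s = 1/q - 1/p, the weights have a finite s-norm from index J on when th s > 1,
    of order J^(1/s - th); this is the loss in the exponent. If p <= q, the first weight is the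
    largest and nothing is lost. *)
Lemma lp_bounded_tail p q (th : R) : (1 <= p)%E -> (1 <= q)%E -> 0 <= th ->
  ((q < p)%E -> 1 < th * (inve q - inve p)^-1) ->
  exists2 C, 0 < C & forall J v K, 0 < K -> (forall i, 0 <= v i) ->
    lp_bounded p v K ->
    lp_bounded q (fun i => (J + i).+1%:R `^ (- th) * v (J + i)%N)
      (C * J.+1%:R `^ (- (if (p <= q)%E then th
                         else th - (inve q - inve p))) * K).
Proof.
move=> p1 q1 th0 hqp; case: ifPn => [pq|].
  exists 2 => // J v K K0 v0 vK.
  rewrite -mulrA; apply: (lp_bounded_weight p1 q1 K0) => //=.
  - rewrite pq => i; rewrite !powRN lef_pV2 ?posrE ?powR_gt0//.
    by apply: ge0_ler_powR; rewrite ?nnegrE ?ler_nat// ltnS leq_addr.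
  - exact: lp_bounded_shift.
rewrite -ltNge => qp; have := hqp qp; set s := _^-1 => ths.
have s0 : 0 < s by rewrite invr_gt0 subr_gt0 inv_exponent_lt.
have [C C0 HC] := sum_powR_tail ths.
exists (2 * C `^ s^-1); first by rewrite mulr_gt0// powR_gt0.
move=> J v K K0 v0 vK.
rewrite -2!mulrA (mulrA _ _ K); apply: (lp_bounded_weight p1 q1) => //=.
- by rewrite mulr_gt0// powR_gt0.
- rewrite leNgt qp/= => N; rewrite -/s.
  have -> : (C `^ s^-1 * J.+1%:R `^ (- (th - (inve q - inve p)))) `^ s
            = C * J.+1%:R `^ (1 - th * s).
    rewrite powRM ?powR_ge0// -!powRrM mulVf ?gt_eqF// powRr1 ?ltW//.
    have -> : inve q - inve p = s^-1 by rewrite /s invrK.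
    congr (_ * _ `^ _); field; exact: lt0r_neq0.
  apply: le_trans (HC J N); apply: ler_sum => i _.
  by rewrite -powRrM mulNr.
- exact: lp_bounded_shift.
Qed.

Lemma lp_bounded_block p q n v K : (1 <= p)%E -> (1 <= q)%E -> (0 < n)%N ->
  0 < K -> (forall i, 0 <= v i) -> lp_bounded p v K ->
  lp_bounded q (fun i => (i < n)%:R * v i)
    (2 * (n%:R `^ (if (p <= q)%E then 0
                   else inve q - inve p) * K)).
Proof.
move=> p1 q1 n0 K0 v0 vK; apply: (lp_bounded_weight p1 q1) => //=.
  by apply: powR_gt0; rewrite ltr0n.
have [pq i|] := boolP (p <= q)%E; first by rewrite powRr0; case: (_ < _)%N.
rewrite -ltNge => qp N; set s := inve q - _.
have s0 : 0 < s.
  by rewrite subr_gt0 inv_exponent_lt.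
rewrite -powRrM mulfV ?gt_eqF// powRr1//.
have -> : \sum_(i < N) (i < n)%:R `^ s^-1 = \sum_(i < N) (i < n)%:R :> R.
  by apply: eq_bigr => i _; case: (_ < _)%N; rewrite ?powR1// powR0// invr_eq0 gt_eqF.
rewrite -natr_sum ler_nat.
suff -> : (\sum_(i < N) (i < n) = minn N n)%N by exact: geq_minr.
elim: N => [|N IH]; first by rewrite big_ord0 min0n.
by rewrite big_ord_recr/= IH; lia.
Qed.

End SequenceNorms.

(** * Smooth functions *)

Section SmoothFunctions.
Context {R : realType}.
Implicit Types (f g : R -> R) (n k : nat).

Definition smooth f := forall k x, derivable (derive1n k f) x 1.

(** The recursion passes to the derivative of f itself, so closure under products and inverses is a
    plain induction on n, without Leibniz's formula. *)
Fixpoint diff_upto n f : Prop :=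
  (forall x, derivable f x 1) /\ (if n is m.+1 then diff_upto m (derive1 f) else True).

Lemma smoothP f : (forall n, diff_upto n f) <-> smooth f.
Proof.
split=> [fn k|fs n].
  elim: k f fn => [|k IH] f fn x; first by have [] := fn 0%N.
  by rewrite derive1Sn; apply: IH => n; have [] := fn n.+1.
elim: n f fs => [|n IH] f fs; (split; first exact: (fs 0%N)); first by [].
by apply: IH => k x; rewrite -derive1Sn.
Qed.

Lemma derive1_funE f g : (forall x : R, is_derive x (1 : R) f (g x)) -> derive1 f = g.
Proof. by move=> fg; apply/funext => x; rewrite derive1E; exact: derive_val. Qed.

Lemma derivable_is_derive f (x : R) : derivable f x 1 -> is_derive x (1 : R) f (derive1 f x).
Proof. by rewrite derive1E => /derivableP. Qed.

Lemma diff_uptoW n f : diff_upto n.+1 f -> diff_upto n f.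
Proof.
elim: n f => [|n IH] f [df dn].
  by split; [exact: df|].
by split; [exact: df|exact: IH].
Qed.

Lemma diff_upto_derivable n f x : diff_upto n f -> derivable f x 1.
Proof. by case: n => [|n] [df _]; exact: df. Qed.

Lemma diff_uptoD n f g : diff_upto n f -> diff_upto n g ->
  diff_upto n (fun x => f x + g x).
Proof.
elim: n f g => [|n IH] f g [df fn] [dg gn];
  (split; first by move=> x; exact: derivableD); first by [].
suff -> : derive1 (fun x => f x + g x) = (fun x => derive1 f x + derive1 g x).
  exact: IH.
by apply: derive1_funE => x; apply: is_deriveD; exact: derivable_is_derive.
Qed.

Lemma diff_uptoM n f g : diff_upto n f -> diff_upto n g ->
  diff_upto n (fun x => f x * g x).
Proof.
elim: n f g => [|n IH] f g [df fn] [dg gn];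
  (split; first by move=> x; exact: derivableM); first by [].
suff -> : derive1 (fun x => f x * g x) =
          (fun x => f x * derive1 g x + g x * derive1 f x).
  by apply: diff_uptoD; apply: IH => //; exact: diff_uptoW.
by apply: derive1_funE => x; apply: is_deriveM; exact: derivable_is_derive.
Qed.

Lemma diff_upto_cst n (c : R) : diff_upto n (fun=> c).
Proof.
elim: n c => [|n IH] c;
  (split; first by move=> x; exact: derivable_cst); first by [].
by rewrite (@derive1_funE _ (fun=> 0)).
Qed.

Lemma diff_upto_affine n f (a b : R) : diff_upto n f ->
  diff_upto n (fun x => f (a * x + b)).
Proof.
have aff (x : R) : is_derive x (1 : R) (fun y => a * y + b) a.
  by apply: trigger_derive; rewrite addr0 /GRing.scale/= mulr1.
have comp h (x : R) : derivable h (a * x + b) 1 ->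
    is_derive x (1 : R) (fun y => h (a * y + b)) (a * derive1 h (a * x + b)).
  move=> dh; rewrite mulrC.
  by apply: (@is_derive1_comp _ h (fun y => a * y + b)); exact: derivable_is_derive.
elim: n f => [|n IH] f [df fn];
  (split; first by move=> x; have [] := comp f x (df _)); first by [].
suff -> : derive1 (fun x => f (a * x + b)) = (fun x => a * derive1 f (a * x + b)).
  by apply: diff_uptoM; [exact: diff_upto_cst|exact: IH].
by apply: derive1_funE => x; exact: comp.
Qed.

Lemma diff_uptoV n f : (forall x, f x != 0) -> diff_upto n f ->
  diff_upto n (fun x => (f x)^-1).
Proof.
move=> f0; elim: n => [|n IH] fn;
  (split; first by move=> x; apply: derivableV => //; apply: diff_upto_derivable fn);
  first by [].
suff -> : derive1 (fun x => (f x)^-1) =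
          (fun x => - 1 * ((f x)^-1 * (f x)^-1 * derive1 f x)).
  apply: diff_uptoM; first exact: diff_upto_cst.
  apply: diff_uptoM; last by case: fn.
  by apply: diff_uptoM; apply: IH; exact: diff_uptoW.
apply: derive1_funE => x; apply: trigger_derive.
  apply: is_deriveV => //; apply: derivable_is_derive.
  exact: diff_upto_derivable fn.
by rewrite /GRing.scale/= expr2 invfM; ring.
Qed.

Lemma diff_upto_horner n (p : {poly R}) : diff_upto n (horner p).
Proof.
elim: n p => [|n IH] p;
  (split; first by move=> x; exact: derivable_horner); first by [].
by rewrite -derivE.
Qed.

Lemma smooth_continuous f k : smooth f -> continuous (derive1n k f).
Proof.
move=> fs x; apply/differentiable_continuous.
by apply/derivable1_diffP; exact: fs.
Qed.

Lemma horner_expN_bounded (p : {poly R}) :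
  exists2 C, 0 <= C & forall t, 0 <= t -> `|p.[t] * expR (- t)| <= C.
Proof.
exists (\sum_(i < size p) `|p`_i| * i`!%:R).
  by apply: sumr_ge0 => i _; rewrite mulr_ge0.
move=> t t0; rewrite horner_coef mulr_suml.
apply: (le_trans (ler_norm_sum _ _ _)); apply: ler_sum => i _.
rewrite -mulrA normrM ler_wpM2l//.
rewrite ger0_norm ?mulr_ge0 ?exprn_ge0 ?expR_ge0//.
rewrite expRN ler_pdivrMr ?expR_gt0//.
case: (nat_of_ord i) => [|j].
  by rewrite expr0 fact0 mul1r; have := expR_ge1Dx t; lra.
rewrite -ler_pdivrMl ?ltr0n ?fact_gt0// mulrC.
by apply: le_trans (expR_ge1Dxn j t0); rewrite lerDr.
Qed.

(* [flat_exp 1] is the classical smooth function that is flat at [0]; the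
   polynomial factor makes the family stable under differentiation. *)
Definition flat_exp (p : {poly R}) (x : R) : R :=
  if x <= 0 then 0 else p.[x^-1] * expR (- x^-1).

(** The exponential bound for the polynomial X^2 p, taken at 1/x, gives quadratic decay at 0. This
    is what [is_derive_quadratic] needs to differentiate at the junction point. *)
Lemma flat_exp_bounded (p : {poly R}) :
  exists C, forall x, `|flat_exp p x| <= C * x ^+ 2.
Proof.
have [C C0 HC] := horner_expN_bounded ('X^2 * p).
exists C => x; rewrite /flat_exp; case: ifPn => [_|].
  by rewrite normr0 mulr_ge0// sqr_ge0.
rewrite -ltNge => x0.
have := HC x^-1; rewrite invr_ge0 ltW// => /(_ isT).
rewrite hornerM hornerXn -mulrA normrM ger0_norm; last by rewrite exprn_ge0// invr_ge0 ltW.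
by rewrite exprVn mulrC ler_pdivrMr// exprn_gt0.
Qed.

Lemma is_derive_quadratic f (C : R) : f 0 = 0 -> (forall x, `|f x| <= C * x ^+ 2) ->
  is_derive (0 : R) (1 : R) f 0.
Proof.
move=> f0 fC.
suff h : h^-1 *: (f (h *: 1 + 0) - f 0) @[h --> 0^'] --> (0 : R).
  by apply: DeriveDef; [apply/cvg_ex; exists 0|exact/cvg_lim].
apply/cvgrPdist_lt => e e0; near=> h.
have h0 : h != 0 by near: h; exact: nbhs_dnbhs_neq.
rewrite f0 addr0 subr0 sub0r normrN /GRing.scale/= mulr1 normrM normfV.
rewrite ltr_pdivrMl ?normr_gt0//.
apply: le_lt_trans (fC h) _.
have hC : `|h| < e / (`|C| + 1).
  by near: h; apply: dnbhs0_lt; rewrite divr_gt0// ltr_wpDl.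
have C1 : 0 < `|C| + 1 by rewrite ltr_wpDl.
rewrite ltr_pdivlMr// in hC.
have h00 : 0 < `|h| by rewrite normr_gt0.
rewrite -real_normK ?num_real// expr2 mulrCA ltr_pM2l//.
apply: le_lt_trans hC; rewrite mulrC ler_wpM2l//.
by have := ler_norm C; lra.
Unshelve. all: by end_near. Qed.

Lemma is_derive_flat_exp (p : {poly R}) (x : R) :
  is_derive x (1 : R) (flat_exp p) (flat_exp ('X^2 * (p - p^`())) x).
Proof.
have [x0|x0|->] := ltgtP x 0.
- have -> : flat_exp ('X^2 * (p - p^`())) x = 0 by rewrite /flat_exp ltW.
  apply: (@near_eq_is_derive R R R (cst 0)).
  near=> y; rewrite /flat_exp ifT//.
  by apply: ltW; near: y; exact: lt_nbhsl.
- have -> : flat_exp ('X^2 * (p - p^`())) x =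
    ('X^2 * (p - p^`())).[x^-1] * expR (- x^-1) by rewrite /flat_exp leNgt x0.
  apply: (@near_eq_is_derive R R R (fun y : R => p.[y^-1] * expR (- y^-1))).
    near=> y; rewrite /flat_exp ifF//.
    apply/negbTE; rewrite -ltNge; near: y; exact: lt_nbhsr.
  have x1 : x != 0 by rewrite gt_eqF.
  have dV : is_derive x (1 : R) (fun y => y^-1) (- x ^- 2).
    by apply: trigger_derive; [exact: is_deriveV|rewrite /GRing.scale/= mulr1].
  have d1 : is_derive x (1 : R) (fun y => p.[y^-1]) (p^`().[x^-1] * - x ^- 2).
    exact: (@is_derive1_comp _ (horner p) (fun y => y^-1)).
  have d2 : is_derive x (1 : R) (fun y => expR (- y^-1)) (expR (- x^-1) * x ^- 2).
    apply: (@is_derive1_comp _ expR (fun y => - y^-1)).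
    by rewrite -[X in is_derive _ _ _ X]opprK; exact: is_deriveN.
  apply: (trigger_derive (is_deriveM d1 d2)).
  rewrite /GRing.scale/= hornerM hornerXn hornerD hornerN exprVn; ring.
- have -> : flat_exp ('X^2 * (p - p^`())) 0 = 0 by rewrite /flat_exp lexx.
  have [C HC] := flat_exp_bounded p.
  apply: is_derive_quadratic HC; by rewrite /flat_exp lexx.
Unshelve. all: by end_near. Qed.

Lemma diff_upto_flat_exp n (p : {poly R}) : diff_upto n (flat_exp p).
Proof.
elim: n p => [|n IH] p.
  by split; [move=> x; have [] := is_derive_flat_exp p x|].
split; first by move=> x; have [] := is_derive_flat_exp p x.
suff -> : derive1 (flat_exp p) = flat_exp ('X^2 * (p - p^`())) by exact: IH.
by apply: derive1_funE => x; exact: is_derive_flat_exp.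
Qed.

Lemma derive1n_eq_on (U : set R) f g k : open U -> (forall x, U x -> f x = g x) ->
  forall x, U x -> derive1n k f x = derive1n k g x.
Proof.
move=> oU; elim: k f g => [|k IH] f g fg x Ux; first exact: fg.
rewrite !derive1Sn; apply: (IH) Ux => {}x Ux.
rewrite !derive1E; apply: near_eq_derive.
by near=> y; apply: fg; near: y; exact: open_nbhs_nbhs.
Unshelve. all: by end_near. Qed.

Lemma derive1n_horner k (p : {poly R}) : derive1n k (horner p) = horner p^`(k).
Proof.
elim: k p => [|k IH] p; first by rewrite derivn0.
by rewrite derive1Sn -derivE IH derivSn.
Qed.

Lemma smoothW f k : smooth f -> smooth (derive1n k f).
Proof.
move=> fs; elim: k => [//|k IH] m x.
by rewrite derive1nS -derive1Sn; exact: IH.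
Qed.

Lemma smooth_cst (c : R) : smooth (fun=> c).
Proof. by apply/smoothP => n; exact: diff_upto_cst. Qed.

Lemma smoothD f g : smooth f -> smooth g -> smooth (fun x => f x + g x).
Proof. by move=> /smoothP fs /smoothP gs; apply/smoothP => n; exact: diff_uptoD. Qed.

Lemma smoothM f g : smooth f -> smooth g -> smooth (fun x => f x * g x).
Proof. by move=> /smoothP fs /smoothP gs; apply/smoothP => n; exact: diff_uptoM. Qed.

Lemma smooth_affine f (a b : R) : smooth f -> smooth (fun x => f (a * x + b)).
Proof. by move=> /smoothP fs; apply/smoothP => n; exact: diff_upto_affine. Qed.

Lemma smoothV f : (forall x, f x != 0) -> smooth f -> smooth (fun x => (f x)^-1).
Proof. by move=> f0 /smoothP fs; apply/smoothP => n; exact: diff_uptoV. Qed.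

Lemma smooth_horner (p : {poly R}) : smooth (horner p).
Proof. by apply/smoothP => n; exact: diff_upto_horner. Qed.

Lemma smooth_flat_exp (p : {poly R}) : smooth (flat_exp p).
Proof. by apply/smoothP => n; exact: diff_upto_flat_exp. Qed.

Lemma smooth_sum (I : Type) (s : seq I) (F : I -> R -> R) :
  (forall i, smooth (F i)) -> smooth (fun x => \sum_(i <- s) F i x).
Proof.
move=> Fs; elim: s => [|i s IH].
  by under eq_fun do rewrite big_nil; exact: smooth_cst.
by under eq_fun do rewrite big_cons; exact: (smoothD (Fs i) IH).
Qed.

Lemma smooth_is_derive f (x : R) : smooth f -> is_derive x (1 : R) f (derive1 f x).
Proof. by move=> fs; apply: derivable_is_derive; exact: (fs 0%N). Qed.

Lemma derive1nD f g k : smooth f -> smooth g ->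
  derive1n k (fun x => f x + g x) = (fun x => derive1n k f x + derive1n k g x).
Proof.
move=> fs gs; elim: k => [//|k IH]; rewrite !derive1nS IH.
by apply: derive1_funE => x; apply: is_deriveD; apply: smooth_is_derive; exact: smoothW.
Qed.

Lemma derive1nZ f (c : R) k : smooth f ->
  derive1n k (fun x => c * f x) = (fun x => c * derive1n k f x).
Proof.
move=> fs; elim: k => [//|k IH]; rewrite !derive1nS IH.
by apply: derive1_funE => x; apply: is_deriveZ; apply: smooth_is_derive; exact: smoothW.
Qed.

Lemma derive1n_affine f (a b : R) k : smooth f ->
  derive1n k (fun x => f (a * x + b)) = (fun x => a ^+ k * derive1n k f (a * x + b)).
Proof.
move=> fs; elim: k => [|k IH].
  by apply/funext => x; rewrite expr0 mul1r.
rewrite !derive1nS IH; apply: derive1_funE => x.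
have aff : is_derive x (1 : R) (fun y => a * y + b) a.
  by apply: trigger_derive; rewrite addr0 /GRing.scale/= mulr1.
rewrite exprSr -mulrA; apply: is_deriveZ; rewrite mulrC.
apply: (@is_derive1_comp _ (derive1n k f) (fun y => a * y + b)).
by apply: smooth_is_derive; exact: smoothW.
Qed.

Lemma derive1n_sum (I : Type) (s : seq I) (F : I -> R -> R) k :
  (forall i, smooth (F i)) ->
  derive1n k (fun x => \sum_(i <- s) F i x) = (fun x => \sum_(i <- s) derive1n k (F i) x).
Proof.
move=> Fs; elim: s => [|i s IH].
  under eq_fun do rewrite big_nil.
  under [RHS]eq_fun do rewrite big_nil.
  elim: k => [//|k IH]; rewrite derive1nS IH.
  by apply: derive1_funE => x; exact: is_derive_cst.
under eq_fun do rewrite big_cons.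
under [RHS]eq_fun do rewrite big_cons.
by rewrite derive1nD ?IH//; exact: smooth_sum.
Qed.

(** The classical smooth transition from 0 on the negative axis to 1 beyond 1. The argument 1 - s is
    written in affine form so that [smooth_affine] applies. *)
Definition smooth_step (s : R) : R :=
  flat_exp 1 s / (flat_exp 1 s + flat_exp 1 (- 1 * s + 1)).

Lemma flat_exp1_ge0 (x : R) : 0 <= flat_exp 1 x.
Proof. by rewrite /flat_exp; case: ifP => // _; rewrite hornerC mul1r expR_ge0. Qed.

Lemma flat_exp1_gt0 (x : R) : 0 < x -> 0 < flat_exp 1 x.
Proof. by move=> x0; rewrite /flat_exp leNgt x0/= hornerC mul1r expR_gt0. Qed.

Lemma smooth_step_denom (s : R) : 0 < flat_exp 1 s + flat_exp 1 (- 1 * s + 1).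
Proof.
have [s0|s0] := ltP 0 s; first by rewrite ltr_pwDl ?flat_exp1_gt0 ?flat_exp1_ge0.
by rewrite ltr_wpDl ?flat_exp1_ge0 ?flat_exp1_gt0//; lra.
Qed.

Lemma smooth_smooth_step : smooth smooth_step.
Proof.
apply: smoothM; first exact: smooth_flat_exp.
apply: smoothV; first by move=> x; rewrite gt_eqF ?smooth_step_denom.
by apply: smoothD; [exact: smooth_flat_exp|apply: smooth_affine; exact: smooth_flat_exp].
Qed.

Lemma smooth_step_bounds (s : R) : 0 <= smooth_step s <= 1.
Proof.
rewrite divr_ge0 ?flat_exp1_ge0 ?(ltW (smooth_step_denom s))//=.
by rewrite ler_pdivrMr ?smooth_step_denom// mul1r lerDl flat_exp1_ge0.
Qed.

Lemma smooth_step0 (s : R) : s <= 0 -> smooth_step s = 0.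
Proof. by move=> s0; rewrite /smooth_step {1}/flat_exp s0 mul0r. Qed.

Lemma smooth_step1 (s : R) : 1 <= s -> smooth_step s = 1.
Proof.
move=> s1; rewrite /smooth_step.
have -> : flat_exp 1 (- 1 * s + 1) = 0 :> R by rewrite /flat_exp ifT//; lra.
by rewrite addr0 divff// gt_eqF// flat_exp1_gt0//; lra.
Qed.

(* A smooth modification of the truncated power [s_+^d / d!]; its derivative of
   order [d + 1] is a bump of integral [1] supported in [0, 1]. *)
Definition smooth_ramp (d : nat) (s : R) : R := ((d`!%:R)^-1 *: 'X^d).[s] * smooth_step s.

Lemma smooth_smooth_ramp d : smooth (smooth_ramp d).
Proof. by apply: smoothM; [exact: smooth_horner|exact: smooth_smooth_step]. Qed.

Lemma smooth_ramp0 d (s : R) : s <= 0 -> smooth_ramp d s = 0.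
Proof. by move=> s0; rewrite /smooth_ramp smooth_step0// mulr0. Qed.

Lemma smooth_ramp1 d (s : R) : 1 <= s -> smooth_ramp d s = ((d`!%:R)^-1 *: 'X^d).[s].
Proof. by move=> s1; rewrite /smooth_ramp smooth_step1// mulr1. Qed.

Lemma smooth_ramp_bound d (s B : R) : 0 <= B -> s <= B -> `|smooth_ramp d s| <= B ^+ d.
Proof.
move=> B0 sB; have [s0|s0] := leP s 0.
  by rewrite smooth_ramp0// normr0 exprn_ge0.
rewrite /smooth_ramp hornerZ hornerXn 2!normrM.
have /andP[c0 c1] := smooth_step_bounds s.
rewrite (ger0_norm c0) (ger0_norm (exprn_ge0 d (ltW s0))).
rewrite ger0_norm ?invr_ge0//.
apply: (@le_trans _ _ (1 * B ^+ d * 1)); last by rewrite mul1r mulr1.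
apply: ler_pM => //; first by rewrite mulr_ge0 ?invr_ge0 ?exprn_ge0 ?ltW.
apply: ler_pM => //; rewrite ?invr_ge0 ?exprn_ge0 ?(ltW s0)//.
  by rewrite invf_le1 ?ltr0n ?fact_gt0// ler1n fact_gt0.
by rewrite lerXn2r ?nnegrE ?(ltW s0).
Qed.

Lemma derive1n_ramp0 d k (s : R) : s < 0 -> derive1n k (smooth_ramp d) s = 0.
Proof.
move=> s0.
rewrite (@derive1n_eq_on [set x | x < 0] _ (horner 0))//.
- by rewrite derive1n_horner linear0 horner0.
- by move=> x /= x0; rewrite smooth_ramp0 ?ltW// horner0.
Qed.

Lemma derive1n_ramp1 d k (s : R) : 1 < s ->
  derive1n k (smooth_ramp d) s = ((d`!%:R)^-1 *: ('X^(d - k) *+ d ^_ k)).[s].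
Proof.
move=> s1.
rewrite (@derive1n_eq_on [set x | 1 < x] _ (horner ((d`!%:R)^-1 *: 'X^d)))//.
- by rewrite derive1n_horner derivnZ derivnXn.
- by move=> x /= x1; rewrite smooth_ramp1// ltW.
Qed.

Lemma derive1n_ramp_top d (s : R) : 1 < s -> derive1n d (smooth_ramp d) s = 1.
Proof.
move=> s1; rewrite derive1n_ramp1// subnn expr0 ffactnn hornerZ hornerMn hornerC.
by rewrite mulVf// pnatr_eq0 -lt0n fact_gt0.
Qed.

Lemma derive1n_ramp_above d (s : R) : 1 < s -> derive1n d.+1 (smooth_ramp d) s = 0.
Proof.
by move=> s1; rewrite derive1n_ramp1// ffact_small// mulr0n scaler0 horner0.
Qed.

Lemma derive1n_ramp_bounded d :
  exists2 M, 0 <= M & forall s, `|derive1n d.+1 (smooth_ramp d) s| <= M.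
Proof.
have cn : {within `[(0:R), 1], continuous (fun s => `|derive1n d.+1 (smooth_ramp d) s|)}.
  apply: continuous_subspaceT => x.
  exact: (cvg_norm (@smooth_continuous _ d.+1 (@smooth_smooth_ramp d) x)).
have [c _ cmax] := EVT_max ler01 cn.
exists `|derive1n d.+1 (smooth_ramp d) c| => // s.
have [s0|s0] := ltP s 0; first by rewrite derive1n_ramp0// normr0.
have [s1|s1] := leP s 1; first by apply: cmax; rewrite in_itv/= s0.
by rewrite derive1n_ramp_above// normr0.
Qed.

End SmoothFunctions.

(** * The Peano kernel of a functional vanishing on polynomials *)

Section PeanoKernel.
Context {R : realType}.
Local Notation mu := (@lebesgue_measure R).
Implicit Types (f g F K : R -> R) (a b z e : R).

Lemma measure_segment a b : a <= b -> fine (mu `[a, b]) = b - a.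
Proof.
move=> ab; rewrite lebesgue_measure_itv/= lte_fin; case: ltP => // ba.
by rewrite (_ : a = b) ?subrr//; apply/eqP; rewrite eq_le ab.
Qed.

Lemma continuous_integrable f a b : continuous f -> mu.-integrable `[a, b] (EFin \o f).
Proof.
move=> cf; apply: continuous_compact_integrable; first exact: segment_compact.
exact: continuous_subspaceT.
Qed.

Lemma Rintegral_ftc F K a b : a < b -> continuous K ->
  (forall x : R, is_derive x (1 : R) F (K x)) ->
  \int[mu]_(x in `[a, b]) K x = F b - F a.
Proof.
move=> ab cK FK; rewrite /Rintegral (@continuous_FTC2 _ K F)//.
- exact: continuous_subspaceT.
- have cF x : {for x, continuous F}.
    by apply/differentiable_continuous/derivable1_diffP; have [] := FK x.
  split; [by move=> x _; have [] := FK x| |].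
    by apply: cvg_at_right_filter; exact: cF.
  by apply: cvg_at_left_filter; exact: cF.
- by move=> x _; rewrite derive1E; have [_ ->] := FK x.
Qed.

Lemma Rintegral_supported f a b : (forall x, x < a \/ b < x -> f x = 0) ->
  \int[mu]_x f x = \int[mu]_(x in `[a, b]) f x.
Proof.
move=> f0; rewrite [RHS]Rintegral_mkcond; congr Rintegral.
apply/funext => x; rewrite patchE; case: ifPn => // /negP xab.
apply: f0; apply: contra_notP xab; rewrite not_orE !(rwP negP) -!leNgt => -[ax xb].
by rewrite inE/= in_itv/= ax xb.
Qed.

Lemma integrable_supported f a b : (forall x, x < a \/ b < x -> f x = 0) ->
  mu.-integrable `[a, b] (EFin \o f) -> mu.-integrable [set: R] (EFin \o f).
Proof.
move=> f0 fi.
have := (@integrable_mkcond _ _ R mu _ (EFin \o f) (measurable_itv `[a, b])).1 fi.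
apply: eq_integrable => // x _; rewrite patchE/=; case: ifPn => // /negP xab.
rewrite f0//; apply: contra_notP xab; rewrite not_orE !(rwP negP) -!leNgt => -[ax xb].
by rewrite inE/= in_itv/= ax xb.
Qed.

(** An approximate identity at z as e tends to 0. It lives on [z, z + e]; the wider interval
    [z - e, z + 2 e] is used below because the derivatives of the ramp are computed only strictly
    outside [0, 1]. *)
Definition ramp_kernel d e z (s : R) : R :=
  e^-1 * derive1n d.+1 (smooth_ramp d) (e^-1 * s + - (e^-1 * z)).

Lemma ramp_kernel_supported d e z s : 0 < e -> s < z - e \/ z + 2 * e < s ->
  ramp_kernel d e z s = 0.
Proof.
move=> e0 zs; have E : e^-1 * s + - (e^-1 * z) = (s - z) / e by ring.
rewrite /ramp_kernel E; case: zs => zs.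
  by rewrite derive1n_ramp0 ?mulr0// ltr_pdivrMr//; lra.
by rewrite derive1n_ramp_above ?mulr0// ltr_pdivlMr//; lra.
Qed.

Lemma continuous_ramp_kernel d e z : continuous (ramp_kernel d e z).
Proof.
pose h := fun s : R => derive1n d.+1 (smooth_ramp d) (e^-1 * s + - (e^-1 * z)).
have hs : smooth h by apply: smooth_affine; apply: smoothW; exact: smooth_smooth_ramp.
have hc : continuous h := @smooth_continuous _ h 0%N hs.
have cc : continuous (fun _ : R => e^-1) by move=> x; exact: cvg_cst.
move=> x; exact: (continuousM (cc x) (hc x)).
Qed.

Lemma Rintegral_ramp_kernel d e z : 0 < e ->
  \int[mu]_(s in `[z - e, z + 2 * e]) ramp_kernel d e z s = 1.
Proof.
move=> e0.
pose F s := derive1n d (smooth_ramp d) (e^-1 * s + - (e^-1 * z)).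
have dF (x : R) : is_derive x (1 : R) F (ramp_kernel d e z x).
  have sd := @smoothW R _ d (@smooth_smooth_ramp R d).
  have := smooth_is_derive x (@smooth_affine R _ e^-1 (- (e^-1 * z)) sd).
  by rewrite -derive1n1 derive1n_affine// expr1 derive1n1 -derive1nS.
have ee : z - e < z + 2 * e by lra.
rewrite (Rintegral_ftc ee (@continuous_ramp_kernel d e z) dF) /F.
have -> : e^-1 * (z + 2 * e) - e^-1 * z = 2 by field; exact: lt0r_neq0.
have -> : e^-1 * (z - e) - e^-1 * z = - 1 by field; exact: lt0r_neq0.
by rewrite derive1n_ramp_top ?derive1n_ramp0 ?subr0//; lra.
Qed.

(** As its integral is 1, the kernel acts on f - f z. Its sign is not controlled, so the bound is
    its supremum, a constant over e, times the length 3 e of the interval. *)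
Lemma ramp_kernel_approx d : exists2 M : R, 0 <= M & forall f e z (del : R),
  continuous f -> 0 < e -> 0 <= del ->
  (forall s, z - e <= s <= z + 2 * e -> `|f s - f z| <= del) ->
  `|\int[mu]_s (f s * ramp_kernel d e z s) - f z| <= M * del.
Proof.
have [M M0 HM] := @derive1n_ramp_bounded R d.
exists (3 * M); first lra.
move=> f e z del cf e0 del0 fz.
pose I := `[z - e, z + 2 * e]%classic : set R.
have cK := @continuous_ramp_kernel d e z.
rewrite (@Rintegral_supported _ (z - e) (z + 2 * e)); last first.
  by move=> x zx; rewrite ramp_kernel_supported// mulr0.
have cfK : continuous (fun s => f s * ramp_kernel d e z s).
  by move=> x; apply: continuousM; [exact: cf|exact: cK].
have czK : continuous (fun s => f z * ramp_kernel d e z s).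
  by move=> x; apply: continuousM; [exact: cvg_cst|exact: cK].
have -> : f z = \int[mu]_(s in I) (f z * ramp_kernel d e z s).
  rewrite RintegralZl ?Rintegral_ramp_kernel ?mulr1//; first exact: measurable_itv.
  exact: continuous_integrable.
rewrite -RintegralB//; [|exact: continuous_integrable..].
have cB : continuous (fun s => f s * ramp_kernel d e z s - f z * ramp_kernel d e z s).
  by move=> x; apply: cvgB; [exact: cfK|exact: czK].
apply: (le_trans (le_normr_Rintegral _ _)) => //; first exact: continuous_integrable.
apply: (@le_trans _ _ (\int[mu]_(s in I) (del * (e^-1 * M)))).
  apply: le_Rintegral => //.
  - by apply: continuous_integrable => x; apply: cvg_norm; exact: cB.
  - by apply: continuous_integrable => x; exact: cvg_cst.
  - move=> x; rewrite /I/= in_itv/= => xI.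
    rewrite -mulrBl normrM ler_pM ?fz//.
    by rewrite normrM ger0_norm ?invr_ge0 ?(ltW e0)// ler_wpM2l ?invr_ge0 ?(ltW e0).
rewrite /I Rintegral_cst//.
have zz : z - e <= z + 2 * e by lra.
rewrite (measure_segment zz).
have -> // : del * (e^-1 * M) * (z + 2 * e - (z - e)) <= 3 * M * del.
apply: le_of_eq; field; exact: lt0r_neq0.
Qed.

Definition lin_apply (A : seq (R * R)) f : R := \sum_(c <- A) c.1 * f c.2.
Definition lin_mass (A : seq (R * R)) : R := \sum_(c <- A) `|c.1|.

Lemma lin_mass_ge0 A : 0 <= lin_mass A.
Proof. exact: sumr_ge0. Qed.

Lemma uniform_near (A : seq (R * R)) f del e0 : continuous f -> 0 < del -> 0 < e0 ->
  exists2 e, 0 < e <= e0 & forall c, c \in A ->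
    forall s, c.2 - e <= s <= c.2 + 2 * e -> `|f s - f c.2| <= del.
Proof.
move=> cf del0 e00; elim: A => [|c A [e /andP[e1 e2] IH]].
  by exists e0; rewrite ?e00 ?lexx.
have /cvgrPdist_le/(_ _ del0)/nbhs_ballP[e' /= e'0 He'] := cf c.2.
exists (Num.min e (e' / 4)).
  rewrite lt_min e1 divr_gt0//= ge_min e2//.
have h1 : Num.min e (e' / 4) <= e by rewrite ge_min lexx.
have h2 : Num.min e (e' / 4) <= e' / 4 by rewrite ge_min lexx orbT.
move=> c'; rewrite inE => /orP[/eqP ->|c'A] s /andP[s1 s2].
  rewrite distrC; apply: He'; rewrite /ball/= ltr_norml; apply/andP; split; lra.
by apply: IH => //; apply/andP; split; lra.
Qed.

Lemma Rintegral_lincomb (A : seq (R * R)) f (K : R * R -> R -> R) :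
  (forall c, mu.-integrable [set: R] (EFin \o (fun s => f s * K c s))) ->
  (\int[mu]_s (f s * (\sum_(c <- A) c.1 * K c s)) =
    \sum_(c <- A) (c.1 * \int[mu]_s (f s * K c s))) /\
  mu.-integrable [set: R] (EFin \o (fun s => f s * (\sum_(c <- A) c.1 * K c s))).
Proof.
move=> ifK; elim: A => [|c B [IH1 IH2]].
  have E : (fun s => f s * (\sum_(c <- [::]) c.1 * K c s)) = fun=> 0.
    by apply/funext => s; rewrite big_nil mulr0.
  rewrite E; split; last exact: integrable0.
  by rewrite big_nil Rintegral_cst// mul0r.
have E : (fun s => f s * \sum_(c0 <- (c :: B)) c0.1 * K c0 s) =
  (fun s => c.1 * (f s * K c s) + f s * (\sum_(c0 <- B) c0.1 * K c0 s)).
  by apply/funext => s; rewrite big_cons mulrDr mulrCA.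
rewrite E.
have i1 : mu.-integrable [set: R] (EFin \o (fun s => c.1 * (f s * K c s))).
  exact: (integrableZl measurableT c.1 (ifK c)).
split; first by rewrite RintegralD// RintegralZl// IH1 big_cons.
exact: (integrableD measurableT i1 IH2).
Qed.

Lemma integrable_mul_bounded g f a b (M : R) : mu.-integrable `[a, b] (EFin \o g) ->
  measurable_fun [set: R] f -> (forall s, `|f s| <= M) ->
  mu.-integrable `[a, b] (EFin \o (fun s => g s * f s)).
Proof.
move=> ig mf fM.
have mf' : measurable_fun `[a, b] f by exact: measurable_funTS.
have bf : [bounded f x | x in `[a, b]].
  exists M; split; first by rewrite num_real.
  by move=> x xM s _; apply: le_trans (fM s) (ltW xM).
have := @integrableMl _ _ R mu _ (measurable_itv `[a, b]) _ _ ig mf' bf.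
by apply: eq_integrable => // s _ /=; rewrite EFinM.
Qed.

Lemma peano_bound d f g (A : seq (R * R)) lo hi e : continuous f ->
  (forall a b, mu.-integrable `[a, b] (EFin \o g)) ->
  weak_derivative d.+1 f g ->
  (forall P : {poly R}, (size P <= d.+1)%N -> lin_apply A (horner P) = 0) ->
  (forall c, c \in A -> lo <= c.2 <= hi) -> lo <= hi -> 0 < e ->
  `|lin_apply A f| <=
    lin_mass A * (hi - lo + e) ^+ d * \int[mu]_(x in `[lo, hi + e]) `|g x|.
Proof.
move=> cf ig wfg Apoly Alohi lohi e_gt0.
have [M M0 HM] := ramp_kernel_approx d.
apply/ler_addgt0Pr => th th0.
have mA := lin_mass_ge0 A.
have D0 : 0 < lin_mass A * M + 1 by rewrite ltr_wpDl// mulr_ge0.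
pose del := th / (lin_mass A * M + 1).
have del0 : 0 < del by rewrite divr_gt0.
have [t /andP[t0 te] Ht] := uniform_near A cf del0 e_gt0.
(* The factor t^d undoes the rescaling: a distance t to the right of its node, each term is exactly
   c (s - z)^d / d!. *)
pose phi s := \sum_(c <- A) (c.1 * t ^+ d) * smooth_ramp d (t^-1 * s + - (t^-1 * c.2)).
have sphi_i (c : R * R) :
    smooth (fun s => (c.1 * t ^+ d) * smooth_ramp d (t^-1 * s + - (t^-1 * c.2))).
  apply: smoothM; first exact: smooth_cst.
  by apply: smooth_affine; exact: smooth_smooth_ramp.
have sphi : smooth phi by exact: smooth_sum.
have argE s z : t^-1 * s + - (t^-1 * z) = (s - z) / t by ring.
have phi0 s : s < lo \/ hi + t < s -> phi s = 0.
  case=> sl.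
    apply: big1_seq => c /andP[_ /Alohi/andP[c1 c2]].
    rewrite smooth_ramp0 ?mulr0// argE ler_pdivrMr//; lra.
  (* To the right of all nodes phi s is the functional applied to the polynomial z |-> (s - z)^d /
     d!, hence 0; this makes the support of phi compact. *)
  transitivity (lin_apply A (horner ((d`!%:R^-1 * (- 1) ^+ d) *: ('X - s%:P) ^+ d))); last first.
    apply: Apoly; apply: (leq_trans (size_scale_leq _ _)).
    by rewrite size_exp_XsubC.
  apply: eq_big_seq => c /Alohi/andP[c1 c2].
  rewrite smooth_ramp1; last by rewrite argE ler_pdivlMr//; lra.
  rewrite argE hornerZ hornerXn hornerZ horner_exp hornerXsubC -mulrA; congr (_ * _).
  have -> : s - c.2 = -1 * (c.2 - s) by ring.
  rewrite -mulrA !exprMn exprVn.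
  set u := (-1) ^+ d; set v := (c.2 - s) ^+ d; set w := t ^+ d.
  have w0 : w != 0 by rewrite expf_neq0// gt_eqF.
  by field; rewrite w0 pnatr_eq0 -lt0n fact_gt0.
have phib s : s <= hi + t -> `|phi s| <= lin_mass A * (hi - lo + e) ^+ d.
  move=> sl; rewrite mulr_suml; apply: (le_trans (ler_norm_sum _ _ _)).
  rewrite big_seq [leRHS]big_seq; apply: ler_sum => c /Alohi/andP[c1 c2].
  rewrite -mulrA normrM ler_wpM2l//.
  rewrite normrM ger0_norm ?exprn_ge0 ?(ltW t0)//.
  apply: (@le_trans _ _ (t ^+ d * ((hi - lo + e) / t) ^+ d)).
    rewrite ler_wpM2l ?exprn_ge0 ?(ltW t0)//.
    apply: smooth_ramp_bound.
      by rewrite divr_ge0 ?(ltW t0)//; lra.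
    by rewrite argE ler_pM2r ?invr_gt0//; lra.
  by rewrite -exprMn mulrC divfK// gt_eqF.
have dphi : derive1n d.+1 phi = fun s => \sum_(c <- A) c.1 * ramp_kernel d t c.2 s.
  rewrite derive1n_sum//; apply/funext => s; apply: eq_bigr => c _.
  rewrite derive1nZ; last by apply: smooth_affine; exact: smooth_smooth_ramp.
  rewrite derive1n_affine; last exact: smooth_smooth_ramp.
  rewrite /ramp_kernel -mulrA; congr (_ * _); rewrite mulrA; congr (_ * _).
  by rewrite exprS mulrCA exprVn divff ?mulr1// expf_neq0// gt_eqF.
have test : test_function phi.
  split; first exact: sphi.
  exists (`|lo| + `|hi| + t) => x.
  move=> xA; apply: phi0.
  have h1 := ler_norm hi; have h2 := ler_norm (- lo).
  have h3 := normr_ge0 hi; have h4 := normr_ge0 lo; rewrite normrN in h2.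
  have [x0|x0] := leP 0 x.
    by right; move: xA; rewrite (ger0_norm x0); lra.
  by left; move: xA; rewrite (ltr0_norm x0); lra.
have ifK (c : R * R) : mu.-integrable [set: R]
    (EFin \o (fun s => f s * ramp_kernel d t c.2 s)).
  apply: (@integrable_supported _ (c.2 - t) (c.2 + 2 * t)).
    by move=> x zx; rewrite ramp_kernel_supported// mulr0.
  apply: continuous_integrable => x.
  by apply: continuousM; [exact: cf|exact: continuous_ramp_kernel].
have LHS : \int[mu]_s (f s * derive1n d.+1 phi s) =
    \sum_(c <- A) c.1 * \int[mu]_s (f s * ramp_kernel d t c.2 s).
  rewrite dphi.
  by have [-> _] := Rintegral_lincomb A ifK.
have RHS : `|\int[mu]_s (f s * derive1n d.+1 phi s)| <=
    lin_mass A * (hi - lo + e) ^+ d * \int[mu]_(x in `[lo, hi + e]) `|g x|.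
  rewrite (wfg _ test) normrM normrX normrN1 expr1n mul1r.
  have sub : `[lo, hi + t] `<=` `[lo, hi + e].
    by apply: subset_itvl; rewrite bnd_simp; lra.
  rewrite (@Rintegral_supported _ lo (hi + e)); last first.
    by move=> x hx; rewrite phi0 ?mulr0//; case: hx => hx; [left|right]; lra.
  have cphi : continuous phi by exact: (@smooth_continuous _ _ 0%N sphi).
  have phib' s : `|phi s| <= lin_mass A * (hi - lo + e) ^+ d.
    have [/phib//|st] := leP s (hi + t).
    by rewrite phi0; [rewrite normr0 mulr_ge0// exprn_ge0//; lra|right].
  have igphi : mu.-integrable `[lo, hi + e] (EFin \o (fun s => g s * phi s)).
    by apply: integrable_mul_bounded phib'; [exact: ig|exact: continuous_measurable_fun].
  apply: (le_trans (le_normr_Rintegral _ igphi)) => //.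
  have ig1 := integrable_norm (ig lo (hi + e)).
  rewrite -RintegralZl//.
  apply: le_Rintegral => //.
  - exact: (integrable_norm igphi).
  - exact: (integrableZl _ (lin_mass A * (hi - lo + e) ^+ d) ig1).
  - by move=> s _; rewrite normrM mulrC ler_wpM2r.
rewrite -[lin_apply A f](subrK (\int[mu]_s (f s * derive1n d.+1 phi s))) addrC.
apply: (le_trans (ler_normD _ _)); apply: lerD => //.
rewrite LHS /lin_apply -sumrB.
apply: (le_trans (ler_norm_sum _ _ _)).
apply: (@le_trans _ _ (\sum_(c <- A) `|c.1| * (M * del))).
  rewrite big_seq [leRHS]big_seq; apply: ler_sum => c cA.
  rewrite -mulrBr normrM ler_wpM2l// distrC.
  by apply: HM => //; [exact: ltW|move=> s; exact: Ht].
rewrite -mulr_suml -/(lin_mass A) mulrA /del mulrA ler_pdivrMr// mulrC ler_wpM2l ?(ltW th0)//.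
lra.
Qed.

End PeanoKernel.

(** * Weighted norms and cells *)

Section NonMeasurable.
Import HBNNSimple.
Context {R : realType}.
Local Notation mu := (@lebesgue_measure R).
Local Open Scope ereal_scope.

Lemma ae_imp (P Q : R -> Prop) : (forall x, P x -> Q x) ->
  {ae mu, forall x, P x} -> {ae mu, forall x, Q x}.
Proof.
move=> PQ [N [mN N0 sub]]; exists N; split=> // x /= nQ.
by apply: sub => /= Px; exact/nQ/PQ.
Qed.

Lemma measurable_lebesgue (f : R -> R) :
  measurable_fun [set: R] f -> lebesgue_measurable_fun f.
Proof.
by exists f => //; exists set0; split; [exact: measurable0|exact: measure0|move=> x /= []].
Qed.

(* The function [G] need not be measurable: its integral is then a lower
   integral, insensitive to null sets all the same. *)
Lemma ge0_ae_eq_lower_integral (F G : R -> \bar R) : measurable_fun [set: R] F ->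
  (forall x, 0 <= F x) -> (forall x, 0 <= G x) -> {ae mu, forall x, F x = G x} ->
  \int[mu]_x G x = \int[mu]_x F x.
Proof.
move=> mF F0 G0 aeFG; apply/eqP; rewrite eq_le; apply/andP; split.
  rewrite [leLHS]ge0_integralTE//; apply: ge_ereal_sup => /= _ [h hG <-].
  rewrite -integralT_nnsfun; apply: ae_ge0_le_integral => //.
  - by move=> x _; rewrite lee_fin fun_ge0.
  - exact/measurable_EFinP.
  - by apply: (ae_imp _ aeFG) => x -> _; exact: hG.
case: aeFG => N [mN N0 subN].
have NFG x : ~ N x -> F x = G x.
  by move=> Nx; apply: contrapT => FG; exact/Nx/subN.
have -> : \int[mu]_x F x = \int[mu]_x (F \_ (~` N)) x.
  apply: ge0_ae_eq_integral => //.
  - by apply/(measurable_restrictT _ (measurableC mN)); exact: measurable_funTS.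
  - by move=> x _; apply: erestrict_ge0 => y _.
  - exists N; split => // x /= /not_implyP[_]; apply: contra_notP => Nx.
    by rewrite patchE mem_set.
rewrite !ge0_integralTE//; last by move=> x; apply: erestrict_ge0.
apply: ereal_sup_le => /= _ [h hF <-].
exists h => // x; apply: (le_trans (hF x)).
by rewrite patchE; case: ifPn => // /set_mem /NFG ->.
Qed.

Lemma ae_eq_lower_integral (F G : R -> \bar R) : measurable_fun [set: R] F ->
  {ae mu, forall x, F x = G x} -> \int[mu]_x G x = \int[mu]_x F x.
Proof.
move=> mF FG; rewrite integralE [RHS]integralE; congr (_ - _).
- apply: ge0_ae_eq_lower_integral => //; first exact: measurable_funepos.
  by apply: (ae_imp _ FG) => x FGx; rewrite !funeposE FGx.
- apply: ge0_ae_eq_lower_integral => //; first exact: measurable_funeneg.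
  by apply: (ae_imp _ FG) => x FGx; rewrite !funenegE FGx.
Qed.

End NonMeasurable.

(** * The weighted unit ball, cell norms and covers by cells *)

Section WeightedBall.
Context {R : realType}.
Local Notation mu := (@lebesgue_measure R).
Variables (lam a : R).
Hypotheses (lam_gt0 : 0 < lam) (a_gt0 : 0 < a).
Local Notation w := (weight lam a).

Lemma weight_gt0 x : 0 < w x.
Proof. exact: expR_gt0. Qed.

Lemma weight_ge0 x : 0 <= w x.
Proof. exact/ltW/weight_gt0. Qed.

Lemma weight_le1 x : w x <= 1.
Proof. by rewrite expR_le1 mulNr oppr_le0 mulr_ge0 ?powR_ge0 ?ltW. Qed.

Lemma weightN x : w (- x) = w x.
Proof. by rewrite /weight normrN. Qed.

Lemma le_weight x y : `|x| <= `|y| -> w y <= w x.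
Proof.
move=> xy; rewrite ler_expR !mulNr lerN2 ler_pM2l//.
by apply: ge0_ler_powR; rewrite ?nnegrE// ltW.
Qed.

Lemma measurable_weight : measurable_fun [set: R] w.
Proof.
apply: measurableT_comp => //; apply: measurable_funM => //.
by apply: (measurableT_comp (measurable_powR lam)).
Qed.

(** The condition that the weighted norm be at most 1, with the root removed. For p = +oo it holds
    at every point, the elements of the space being continuous. *)
Definition weighted_ball (p : \bar R) (g : R -> R) : Prop :=
  if p is x%:E then (\int[mu]_t (`|g t * w t| `^ x)%:E <= 1)%E
  else forall t, `|g t * w t| <= 1.

Lemma measurable_weighted_powR (g : R -> R) (x : R) : measurable_fun [set: R] g ->
  measurable_fun [set: R] (fun t => (`|g t * w t| `^ x)%:E).
Proof.
move=> mg; apply/measurable_EFinP.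
apply: (measurableT_comp (measurable_powR x)).
apply: measurableT_comp => //.
by apply: measurable_funM => //; exact: measurable_weight.
Qed.

Lemma poweR_inv_le1 (u : \bar R) (x : R) : 0 < x -> (0 <= u)%E ->
  (u `^ x^-1 <= 1)%E -> (u <= 1)%E.
Proof.
move=> x0 u0 h.
have -> : u = ((u `^ x^-1) `^ x)%E by rewrite -poweRrM mulVf ?gt_eqF// poweRe1.
rewrite -[leRHS](@poweR1r _ x).
apply: gt0_ler_poweR; rewrite ?in_itv/= ?leey ?poweR_ge0 ?lee01//.
exact: ltW.
Qed.

(** Replaces a Lebesgue measurable derivative by a Borel representative; lower integrals do not see
    the null set of disagreement. *)
Lemma wnorm_weighted_ball p (D : R -> R) : (1 <= p)%E ->
  wLspace lam a p D -> (wnorm lam a p D <= 1)%E ->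
  exists g : R -> R, [/\ measurable_fun [set: R] g, g = D %[ae mu], weighted_ball p g &
    (if p is _%:E then True else continuous g)].
Proof.
case: p => [x| |]//; rewrite ?lee_fin => x1 [] /= hD _.
- move: (hD) => [g mg Dg]; rewrite ifT; last exact/asboolP.
  move=> nD; have x0 : 0 < x by lra.
  exists g; split=> //.
    by apply: (ae_imp _ Dg) => t Dgt _; rewrite Dgt.
  rewrite -(ge0_ae_eq_lower_integral (measurable_weighted_powR x mg)
    (G := fun t => (`|D t * w t| `^ x)%:E)).
  - apply: (poweR_inv_le1 x0); first by apply: integral_ge0 => t _; rewrite lee_fin powR_ge0.
    move: nD; rewrite unlock => nD; apply: le_trans nD.
    by apply: le_of_eq.
  - by move=> t; rewrite lee_fin powR_ge0.
  - by move=> t; rewrite lee_fin powR_ge0.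
  - by apply: (ae_imp _ Dg) => t ->.
- move=> nD; exists D; split => //; first exact: continuous_measurable_fun.
    by exists set0; split; [exact: measurable0|exact: measure0|move=> x /= []].
  move=> t; rewrite -lee_fin; apply: le_trans nD.
  by apply: ereal_sup_ubound; exists t.
Qed.

Lemma sobolev_norm_ge p r (D : nat -> R -> R) k : (1 <= p)%E -> (k <= r)%N ->
  (sobolev_norm lam a r p D <= 1)%E -> (forall j, 0 <= wnorm lam a p (D j))%E ->
  (wnorm lam a p (D k) <= 1)%E.
Proof.
case: p => [x| |]//= p1 kr nD D0; rewrite ?lee_fin in p1.
- have x0 : 0 < x by lra.
  have x0' : 0 < x^-1 by rewrite invr_gt0.
  have {}nD := poweR_inv_le1 x0 _ nD.
  have h : (wnorm lam a x%:E (D k) `^ x <= 1)%E.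
    apply: le_trans (nD _); last by apply: sume_ge0 => i _; exact: poweR_ge0.
    rewrite (bigD1 (Ordinal (n := r.+1) kr))//= leeDl//.
    by apply: sume_ge0 => i _; exact: poweR_ge0.
  apply: (poweR_inv_le1 x0' (D0 k)); by rewrite invrK.
- apply: le_trans nD.
  exact: (le_bigmax _ (fun i : 'I_r.+1 => wnorm lam a +oo%E (D i)) (Ordinal (n := r.+1) kr)).
Qed.

Lemma wnorm_ge0 p f : (1 <= p)%E -> (0 <= wnorm lam a p f)%E.
Proof.
case: p => [x| |]//= _.
- by case: ifP => // _; exact: Lnorm_ge0.
- apply: (@le_trans _ _ (`|f 0 * w 0|%:E)); first by rewrite lee_fin.
  by apply: ereal_sup_ubound; exists 0.
Qed.

Lemma weighted_ball_integrable p (g : R -> R) (u v : R) : (1 <= p)%E ->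
  measurable_fun [set: R] g -> weighted_ball p g ->
  mu.-integrable `[u, v] (EFin \o g).
Proof.
move=> p1 mg gp.
(* The weight is even and nonincreasing in the modulus, so on [u, v] it is at least the smaller of
   its values at the ends. *)
pose W := Num.min (w u) (w v).
have W0 : 0 < W by rewrite lt_min !weight_gt0.
have Ww t : u <= t <= v -> W <= w t.
  move=> /andP[ut tv]; have [tt|tt] := leP 0 t.
    have h : w v <= w t by apply: le_weight; rewrite !ger0_norm//; lra.
    by rewrite /W ge_min; apply/orP; right.
  have h : w u <= w t by apply: le_weight; rewrite ltr0_norm// ler0_norm; lra.
  by rewrite ge_min h.
have gW t : u <= t <= v -> `|g t| <= W^-1 * `|g t * w t|.
  move=> /Ww tW; rewrite normrM [X in _ * (_ * X)]gtr0_norm ?weight_gt0//.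
  by rewrite mulrC -mulrA ler_peMr// ler_pdivlMr// mul1r.
have finI : (mu `[u, v] < +oo)%E.
  by rewrite /= lebesgue_measure_itv/=; case: ifP => _; rewrite ?ltry.
have mI : measurable_fun `[u, v] (EFin \o g).
  by apply/measurable_EFinP; exact: measurable_funTS.
case: p p1 gp => [x| |]//= p1; rewrite ?lee_fin in p1.
- move=> gp; apply/integrableP; split => //.
  apply: (@le_lt_trans _ _ (\int[mu]_(t in `[u, v]) (W^-1%:E * (1 + (`|g t * w t| `^ x)%:E)))%E).
    apply: ge0_le_integral => //=.
    + by apply/measurable_EFinP; apply: measurableT_comp => //; exact: measurable_funTS.
    + apply: measurable_funTS; apply: emeasurable_funM => //.
      by apply: emeasurable_funD => //; exact: measurable_weighted_powR.
    + move=> t; rewrite in_itv/= => tI; rewrite -EFinD -EFinM lee_fin.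
      apply: (le_trans (gW _ tI)); rewrite ler_wpM2l ?invr_ge0 ?(ltW W0)//.
      set y := `|_|; have [y1|y1] := leP y 1; first by have := powR_ge0 y x; lra.
      by have := le1r_powR (ltW y1) p1; lra.
  have mwI : measurable_fun `[u, v] (fun t => (`|g t * w t| `^ x)%:E).
    by apply: measurable_funTS; exact: measurable_weighted_powR.
  rewrite ge0_integralZl//=; last 3 first.
  + by apply: emeasurable_funD => //.
  + by move=> t _; rewrite -EFinD lee_fin addr_ge0// powR_ge0.
  + by rewrite lee_fin invr_ge0 ltW.
  have -> : (\int[mu]_(t in `[u, v]) (1 + (`|g t * w t| `^ x)%:E) =
    \int[mu]_(t in `[u, v]) 1 + \int[mu]_(t in `[u, v]) (`|g t * w t| `^ x)%:E)%E.
    by apply: ge0_integralD => //= t _; rewrite lee_fin powR_ge0.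
  apply: lte_mul_pinfty; rewrite ?lee_fin ?invr_ge0 ?(ltW W0)//.
  apply: lte_add_pinfty.
    by rewrite integral_cst// mul1e.
  apply: le_lt_trans (ltry 1); apply: le_trans gp.
  by apply: ge0_subset_integral => //; exact: measurable_weighted_powR.
- move=> gp; apply: measurable_bounded_integrable => //.
  + exact: measurable_funTS.
  + exists W^-1; split; first by rewrite num_real.
    move=> y Wy t /=; rewrite in_itv/= => tI.
    apply: le_trans (ltW Wy); apply: (le_trans (gW _ tI)).
    by rewrite ler_piMr ?invr_ge0 ?(ltW W0).
Qed.

(** All that the upper bound uses of the unit ball: f and its derivative of order r, the latter in a
    Borel version g. Changing it on a null set alters no integral against a test function. *)
Lemma sobolev_ball_data p r f : (1 <= p)%E -> sobolev_ball lam a r p f ->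
  exists g : R -> R, [/\ continuous f, measurable_fun [set: R] g, weak_derivative r f g,
    weighted_ball p f & weighted_ball p g].
Proof.
move=> p1 [D [cf D0 HD] nD].
have n0 j : (0 <= wnorm lam a p (D j))%E by exact: wnorm_ge0.
have [_ wD0] := HD 0%N (leq0n _).
have [wr wDr] := HD r (leqnn _).
have b0 := sobolev_norm_ge p1 (leq0n r) nD n0.
have br := sobolev_norm_ge p1 (leqnn r) nD n0.
have [g [mg gD gb _]] := wnorm_weighted_ball p1 wDr br.
exists g; split => //.
- move=> phi tphi; rewrite wr//; congr (_ * _); rewrite /Rintegral; congr fine.
  apply: ae_eq_lower_integral.
    apply/measurable_EFinP; apply: measurable_funM => //.
    apply: continuous_measurable_fun => x.
    by apply/differentiable_continuous/derivable1_diffP; exact: (tphi.1 0%N).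
  by apply: (ae_imp _ gD) => x ->.
- move: wD0 b0; rewrite D0 => w0 b0.
  case: p p1 {nD n0 wDr br gb HD} w0 b0 => [x| |]//= p1 [/= lf _]; rewrite ?lee_fin in p1.
    rewrite ifT; last exact/asboolP.
    have x0 : 0 < x by lra.
    move=> nf; apply: (poweR_inv_le1 x0).
      by apply: integral_ge0 => t _; rewrite lee_fin powR_ge0.
    move: nf; rewrite unlock => nf; apply: le_trans nf.
    by apply: le_of_eq.
  move=> nf t; rewrite -lee_fin; apply: le_trans nf.
  by apply: ereal_sup_ubound; exists t.
Qed.

(** For p = +oo the constant 1, which bounds every local supremum on the unit ball, stands for the
    local norm. *)
Definition cell_norm (p : \bar R) (g : R -> R) (u v : R) : R :=
  if p is x%:E then fine (\int[mu]_(t in `[u, v]) (`|g t * w t| `^ x)%:E) `^ x^-1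
  else 1.

Lemma cell_norm_ge0 p g u v : 0 <= cell_norm p g u v.
Proof. by case: p => [x| |]//=; exact: powR_ge0. Qed.

Lemma cell_integral_fin (x : R) (g : R -> R) (D : set R) : measurable_fun [set: R] g ->
  weighted_ball x%:E g -> measurable D ->
  (0 <= \int[mu]_(t in D) (`|g t * w t| `^ x)%:E <= 1)%E.
Proof.
move=> mg /= gp mD; rewrite integral_ge0/=; last by move=> t _; rewrite lee_fin powR_ge0.
apply: le_trans gp; apply: ge0_subset_integral => //.
exact: measurable_weighted_powR.
Qed.

Lemma cell_norm_bounded p (g : R -> R) (y : nat -> R) : (1 <= p)%E ->
  measurable_fun [set: R] g -> weighted_ball p g ->
  (forall i, y i <= y i.+1) ->
  lp_bounded p (fun i => cell_norm p g (y i) (y i.+1)) 1.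
Proof.
case: p => [x| |]//= p1 mg gp yy N; rewrite lee_fin in p1.
rewrite powR1.
pose I i := (\int[mu]_(t in `[y i, y i.+1]) (`|g t * w t| `^ x)%:E)%E.
have mgw := measurable_weighted_powR x mg.
have Ifin i : I i = (fine (I i))%:E.
  rewrite fineK// ge0_fin_numE.
    by apply: le_lt_trans (ltry 1); have /andP[] := cell_integral_fin mg gp (measurable_itv `[y i, y i.+1]).
  by have /andP[] := cell_integral_fin mg gp (measurable_itv `[y i, y i.+1]).
have -> : \sum_(i < N) (fine (I i) `^ x^-1) `^ x = \sum_(i < N) fine (I i).
  apply: eq_bigr => i _; rewrite -powRrM mulVf ?powRr1//; last by apply/eqP; lra.
  rewrite -lee_fin -Ifin.
  by have /andP[] := cell_integral_fin mg gp (measurable_itv `[y i, y i.+1]).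
rewrite -lee_fin -sumEFin.
(* The closed cells share endpoints, which are null; half-open cells make the unions disjoint. *)
have -> : (\sum_(i < N) (fine (I i))%:E =
    \int[mu]_(t in `[y 0%N, y N[) (`|g t * w t| `^ x)%:E)%E.
  elim: N => [|N IH].
    by rewrite big_ord0 set_itvE integral_set0.
  have y0N : y 0%N <= y N.
    elim: N {IH} => [//|N IH]; exact: le_trans IH (yy N).
  rewrite big_ord_recr/= IH -Ifin /I -integral_itv_bndo_bndc; last exact: measurable_funTS.
  rewrite -ge0_integral_setU//=.
  - congr (integral _ _ _); rewrite -itv_bndbnd_setU// bnd_simp//.
  - exact: measurable_funTS.
  - by rewrite disj_set2E; apply/eqP/seteqP; split => // t []/=; rewrite !in_itv/=; lra.
by have /andP[] := cell_integral_fin mg gp (measurable_itv `[y 0%N, y N[).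
Qed.

(* Hoelder's inequality up to the factor [2], from [t <= k + k^(1-p) t^p] with the
   optimal [k]. *)
Lemma cell_holder p (g : R -> R) (u v W : R) : (1 <= p)%E ->
  measurable_fun [set: R] g -> weighted_ball p g -> u <= v -> 0 < W ->
  (forall t, u <= t <= v -> W <= w t) ->
  \int[mu]_(t in `[u, v]) `|g t| <=
    2 * ((v - u) `^ (1 - inve p) * (W^-1 * cell_norm p g u v)).
Proof.
move=> p1 mg gp uv W0 Ww.
have ig := integrable_norm (weighted_ball_integrable u v p1 mg gp).
have gW t : u <= t <= v -> `|g t| <= W^-1 * `|g t * w t|.
  move=> /Ww tW; rewrite normrM [X in _ * (_ * X)]gtr0_norm ?weight_gt0//.
  by rewrite mulrC -mulrA ler_peMr// ler_pdivlMr// mul1r.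
move: uv; rewrite le_eqVlt => /predU1P[uv|uv].
  rewrite uv set_itv1 Rintegral_set1 !mulr_ge0 ?powR_ge0 ?invr_ge0 ?cell_norm_ge0//.
  exact: ltW.
have L0 : 0 < v - u by rewrite subr_gt0.
have icst k : mu.-integrable `[u, v] (EFin \o (fun=> k : R)).
  by apply: continuous_integrable => t; exact: cvg_cst.
case: p p1 gp => [x| |]//= p1; rewrite ?lee_fin in p1; last first.
  move=> gp; apply: (@le_trans _ _ (\int[mu]_(t in `[u, v]) W^-1)).
    apply: le_Rintegral => //.
    move=> t /=; rewrite in_itv/= => tI; apply: (le_trans (gW _ tI)).
    by rewrite ler_piMr ?invr_ge0 ?(ltW W0).
  rewrite Rintegral_cst// measure_segment ?(ltW uv)// subr0 powRr1 ?(ltW L0)// mulr1.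
  by rewrite mulrC; have := mulr_gt0 L0 (_ : 0 < W^-1); rewrite invr_gt0 => /(_ W0); lra.
move=> gp; have x0 : 0 < x by lra.
have mgw := measurable_weighted_powR x mg.
have /andP[I0 I1] := cell_integral_fin mg gp (measurable_itv `[u, v]).
pose J := \int[mu]_(t in `[u, v]) (`|g t * w t| `^ x).
have J0 : 0 <= J by apply: Rintegral_ge0 => t _; exact: powR_ge0.
have igx : mu.-integrable `[u, v] (EFin \o (fun t => `|g t * w t| `^ x)).
  apply/integrableP; split; first exact: measurable_funTS.
  apply: le_lt_trans (ltry 1); apply: le_trans I1.
  by under eq_integral do rewrite gee0_abs ?lee_fin ?powR_ge0//.
have key k : 0 < k -> \int[mu]_(t in `[u, v]) `|g t| <=
    W^-1 * (k * (v - u) + k `^ (1 - x) * J).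
  move=> k0.
  have i1 : mu.-integrable `[u, v] (EFin \o (fun t => k `^ (1 - x) * `|g t * w t| `^ x)).
    exact: (integrableZl _ (k `^ (1 - x)) igx).
  have i2 : mu.-integrable `[u, v] (EFin \o (fun t => k + k `^ (1 - x) * `|g t * w t| `^ x)).
    exact: (integrableD _ (icst k) i1).
  have i3 : mu.-integrable `[u, v]
      (EFin \o (fun t => W^-1 * (k + k `^ (1 - x) * `|g t * w t| `^ x))).
    exact: (integrableZl _ W^-1 i2).
  apply: (@le_trans _ _ (\int[mu]_(t in `[u, v])
      (W^-1 * (k + k `^ (1 - x) * `|g t * w t| `^ x)))).
    apply: le_Rintegral => //.
    move=> t /=; rewrite in_itv/= => tI; apply: (le_trans (gW _ tI)).
    rewrite ler_wpM2l ?invr_ge0 ?(ltW W0)//.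
    set s := `|_|; have s0 : 0 <= s by exact: normr_ge0.
    have [sk|ks] := leP s k.
      by rewrite (le_trans sk)// lerDl mulr_ge0 ?powR_ge0.
    have s00 : 0 < s by exact: lt_trans ks.
    apply: (@le_trans _ _ (k `^ (1 - x) * s `^ x)); last by rewrite lerDr (ltW k0).
    rewrite [leLHS](_ : s = s `^ (1 - x) * s `^ x); last first.
      by rewrite -powRD ?subrK ?powRr1//; apply/implyP => _; rewrite gt_eqF.
    rewrite ler_wpM2r ?powR_ge0//.
    have -> : 1 - x = - (x - 1) by ring.
    rewrite !powRN lef_pV2 ?posrE ?powR_gt0//.
    by apply: ge0_ler_powR; rewrite ?nnegrE ?(ltW k0) ?(ltW ks)//; lra.
  rewrite RintegralZl// RintegralD//.
  by rewrite RintegralZl// Rintegral_cst// measure_segment ?(ltW uv).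
have -> : fine (\int[mu]_(t in `[u, v]) (`|g t * w t| `^ x)%:E) = J by [].
(* If J = 0 the optimal k would be 0, which is excluded; a k proportional to an arbitrary e > 0 is
   taken instead. *)
move: J0; rewrite le_eqVlt => /predU1P[J0|J0].
  rewrite -J0 powR0 ?invr_eq0 ?gt_eqF// !mulr0.
  apply/ler_addgt0Pr => e e0; rewrite add0r.
  pose k := e * W / (v - u).
  have k0 : 0 < k by rewrite divr_gt0// mulr_gt0.
  apply: (le_trans (key k k0)); rewrite -J0 mulr0 addr0 /k.
  by apply: le_of_eq; field; rewrite !gt_eqF.
pose d := J `^ x^-1; have d0 : 0 < d by exact: powR_gt0.
pose Lx := (v - u) `^ x^-1; have Lx0 : 0 < Lx by exact: powR_gt0.
have JE : J = d `^ x by rewrite /d -powRrM mulVf ?powRr1 ?gt_eqF// ltW.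
have LE : v - u = Lx `^ x by rewrite /Lx -powRrM mulVf ?powRr1 ?gt_eqF// ltW.
(* The choice k = (J / (v - u))^(1/x) makes the two terms of [key] equal, whence the factor 2. *)
have dLx : 0 < d / Lx by rewrite divr_gt0.
apply: (le_trans (key _ dLx)).
have LE1 : (v - u) `^ (1 - x^-1) = (v - u) / Lx.
  rewrite gt0_powRB//.
  by rewrite powRr1 ?(ltW L0).
rewrite LE1 -/d.
have LV : Lx^-1 `^ x = (v - u)^-1.
  by rewrite LE -powRN -mulN1r powRrM powR_inv1 ?(ltW Lx0).
have -> : (d / Lx) `^ (1 - x) * J = d * ((v - u) / Lx).
  rewrite gt0_powRB//.
  rewrite powRr1 ?(ltW dLx)// powRM ?invr_ge0 ?(ltW Lx0) ?(ltW d0)//.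
  rewrite LV -JE.
  by field; rewrite !gt_eqF.
by apply: le_of_eq; field; rewrite !gt_eqF.
Qed.

(** Several families of cells are allowed, so that one cover can consist of a centre and two tails.
    For finite q = y the integrand is dominated by the sum of all the steps u^y on the cells, so
    overlaps are harmless, and the root turns B K^y into at most B K. *)
Lemma wnorm_le_cells q (B : nat) (F : R -> R) (l r u : nat -> nat -> R) (K : R) :
  (1 <= q)%E -> measurable_fun [set: R] F -> 0 <= K -> (0 < B)%N ->
  (forall b i, l b i <= r b i) -> (forall b i, 0 <= u b i) ->
  (forall x, exists b i, [/\ (b < B)%N, l b i <= x <= r b i & `|F x * w x| <= u b i]) ->
  (forall b, (b < B)%N ->
    lp_bounded q (fun i => (r b i - l b i) `^ inve q * u b i) K) ->
  (wnorm lam a q F <= (B%:R * K)%:E)%E.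
Proof.
move=> q1 mF K0 B0 lr u0 cover uK.
have B1 : 1 <= B%:R :> R by rewrite ler1n.
case: q q1 uK => [y| |]//= q1 uK; rewrite ?lee_fin in q1; last first.
  apply: ge_ereal_sup => /= _ [x _ <-]; rewrite lee_fin.
  have [b [i [bB _ Fu]]] := cover x.
  apply: (le_trans Fu); have := uK b bB i; rewrite powRr0 mul1r => h.
  by apply: (le_trans h); rewrite ler_peMl.
have y0 : 0 < y by lra.
rewrite ifT; last first.
  by apply/asboolP; exact: measurable_lebesgue.
rewrite unlock.
pose T b i x := ((u b i `^ y)%:E * (\1_(`[l b i, r b i]%classic) x)%:E)%E.
have T0 b i x : (0 <= T b i x)%E by rewrite mule_ge0// lee_fin ?powR_ge0.
have mT b i : measurable_fun [set: R] (T b i).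
  apply: emeasurable_funM => //; apply/measurable_EFinP.
  exact: measurable_indic.
have IT b i : (\int[mu]_x T b i x = (u b i `^ y * (r b i - l b i))%:E)%E.
  rewrite ge0_integralZl//=.
  - rewrite integral_indic// setIT EFinM; congr (_ * _)%E.
    rewrite -[LHS]fineK ?measure_segment//.
    by rewrite /= lebesgue_measure_itv/=; case: ifP.
  - by apply/measurable_EFinP; exact: measurable_indic.
  - by rewrite lee_fin powR_ge0.
have mS b : measurable_fun [set: R] (fun x => \sum_(i <oo) T b i x)%E.
  by apply: ge0_emeasurable_sum => //.
have S0 b x : (0 <= \sum_(i <oo) T b i x)%E by apply: nneseries_ge0.
have h : (\int[mu]_x `|(F x * w x)%:E| `^ y <= \sum_(b < B) (K `^ y)%:E)%E.
  apply: (@le_trans _ _ (\int[mu]_x (\sum_(b < B) \sum_(i <oo) T b i x)%E)%E).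
    apply: ge0_le_integral => //.
    - by move=> x _; exact: poweR_ge0.
    - exact: (measurable_weighted_powR y mF).
    - by apply: emeasurable_sum => b; exact: mS.
    - move=> x _; have [b [i [bB lxr Fu]]] := cover x.
      apply: (@le_trans _ _ (T b i x)).
        rewrite /T indicE mem_set/= ?in_itv//= mule1 lee_fin.
        by apply: ge0_ler_powR; rewrite ?nnegrE//; lra.
      apply: (@le_trans _ _ (\sum_(i <oo) T b i x)%E).
        apply: le_trans (nneseries_lim_ge i.+1 _) => //.
        by rewrite big_nat_recr//= leeDr// sume_ge0.
      by rewrite (bigD1 (Ordinal bB))//= leeDl// sume_ge0.
  have -> : (\int[mu]_x (\sum_(b < B) \sum_(i <oo) T b i x) =
      \sum_(b < B) \int[mu]_x (\sum_(i <oo) T b i x))%E.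
    by apply: ge0_integral_sum => //= b; exact: mS.
  apply: lee_sum => b _.
  rewrite integral_nneseries//; last by move=> n; exact: mT.
  apply: lime_le; first by apply: is_cvg_nneseries => n _ _; apply: integral_ge0 => x _.
  apply: nearW => N; rewrite big_mkord.
  under eq_bigr do rewrite IT.
  rewrite sumEFin lee_fin; apply: le_trans (uK b (ltn_ord b) N).
  apply: le_of_eq; apply: eq_bigr => i _.
  rewrite powRM ?powR_ge0// -powRrM mulVf ?gt_eqF// powRr1 ?subr_ge0//.
  exact: mulrC.
apply: (@le_trans _ _ ((\sum_(b < B) (K `^ y)%:E) `^ y^-1)%E).
  apply: gt0_ler_poweR; rewrite ?in_itv/= ?leey ?andbT ?invr_ge0 ?(ltW y0)//.
  - by apply: integral_ge0 => x _; rewrite lee_fin powR_ge0.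
  - by apply: sume_ge0 => b _; rewrite lee_fin powR_ge0.
rewrite sumEFin poweR_EFin lee_fin sumr_const card_ord -[K `^ y *+ B]mulr_natl.
rewrite powRM ?powR_ge0// -powRrM mulfV ?gt_eqF// powRr1// ler_wpM2r//.
by apply: ler1_powR => //; rewrite invf_le1//; lra.
Qed.

End WeightedBall.

(** * Kernels of the spline operators *)

Section LatticeKernels.
Context {R : realType}.
Implicit Types (f : R -> R) (x : R).

Lemma continuous_bigsum (I : Type) (r : seq I) (F : I -> R -> R) :
  (forall i, continuous (F i)) -> continuous (fun x => \sum_(i <- r) F i x).
Proof.
move=> cF; elim: r => [|i r IH].
  have -> : (fun x => \sum_(i <- [::]) F i x) = cst 0 by apply/funext => x; rewrite big_nil.
  by move=> x; exact: cvg_cst.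
have -> : (fun x => \sum_(j <- i :: r) F j x) = (fun x => F i x + \sum_(j <- r) F j x).
  by apply/funext => x; rewrite big_cons.
by move=> x; apply: cvgD; [exact: cF|exact: IH].
Qed.

(** Contains every integer within n of x, and possibly one more at either end. Cutting sums to an
    explicit list allows any larger n, so that sums of different ranges can be merged. *)
Definition lattice_near x (n : nat) : seq int :=
  [seq Num.floor x - n%:Z + i%:Z | i <- iota 0 (2 * n + 2)].

Lemma lattice_near_uniq x n : uniq (lattice_near x n).
Proof. by rewrite map_inj_uniq ?iota_uniq// => i j /addrI[]. Qed.

Lemma size_lattice_near x n : size (lattice_near x n) = (2 * n + 2)%N.
Proof. by rewrite size_map size_iota. Qed.

Lemma mem_lattice_near x n (i : int) : `|i%:~R - x| <= n%:R -> i \in lattice_near x n.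
Proof.
move=> ix; apply/mapP; exists (absz (i - (Num.floor x - n%:Z))%R); last first.
  rewrite gez0_abs; first by rewrite addrC subrK.
  have /andP[f1 f2] := floor_itv x; move: ix; rewrite ler_norml => /andP[i1 i2].
  have : (Num.floor x - n%:Z - 1 < i)%R.
    by rewrite -(ltr_int R) !rmorphB/= -pmulrn; lra.
  lia.
rewrite mem_iota add0n leq0n/=.
have /andP[f1 f2] := floor_itv x; move: ix; rewrite ler_norml => /andP[i1 i2].
have h1 : (Num.floor x - n%:Z - 1 < i)%R.
  by rewrite -(ltr_int R) !rmorphB/= -pmulrn; lra.
have h2 : (i < Num.floor x + n%:Z + 1)%R.
  by move: f2; rewrite -(ltr_int R) !rmorphD/= -pmulrn; lra.
lia.
Qed.

Lemma lattice_sumE (r : seq int) (F : int -> R) : uniq r ->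
  (forall i, F i != 0 -> i \in r) ->
  \sum_(i \in [set: int]) F i = \sum_(i <- r) F i.
Proof.
move=> ur Fr; transitivity (\sum_(i <- r | predT i) F i); last by [].
rewrite (@bigfs _ _ _ _ r predT F ur)//; last first.
  by move=> i _; apply: contraNeq; exact: Fr.
by apply: eq_fsbigl; apply/seteqP; split.
Qed.

Lemma lattice_sum_near x n (F : int -> R) :
  (forall i, F i != 0 -> `|i%:~R - x| <= n%:R) ->
  \sum_(i \in [set: int]) F i = \sum_(i <- lattice_near x n) F i.
Proof.
move=> FN; apply: lattice_sumE; first exact: lattice_near_uniq.
by move=> i /FN; exact: mem_lattice_near.
Qed.

(* The operator [f |-> sum_i f(i) (k i)]. A kernel [k i] lives within distance [N]
   of [i], and on [-m, m] only the nodes [|i| <= m + K] are used. *)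
Definition has_kernel (A : (R -> R) -> R -> R) (k : int -> R -> R) (N K : nat) (C : R) :=
  [/\ forall f x, A f x = \sum_(i \in [set: int]) f i%:~R * k i x,
      forall i x, k i x != 0 -> `|i%:~R - x| <= N%:R,
      forall (m : nat) i x, `|x| <= m%:R -> k i x != 0 -> (`|i| <= m + K)%N,
      forall i, continuous (k i) &
      0 <= C /\ forall i x, `|k i x| <= C].

Lemma has_kernel_near A k N K C f x n : has_kernel A k N K C -> (N <= n)%N ->
  A f x = \sum_(i <- lattice_near x n) f i%:~R * k i x.
Proof.
move=> [-> kN _ _ _] Nn; apply: lattice_sum_near => i.
rewrite mulf_eq0 negb_or => /andP[_ /kN h].
by apply: (le_trans h); rewrite ler_nat.
Qed.

Lemma has_kernelD A1 A2 k1 k2 N1 N2 K1 K2 C1 C2 (a b : R) :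
  has_kernel A1 k1 N1 K1 C1 -> has_kernel A2 k2 N2 K2 C2 ->
  has_kernel (fun f x => a * A1 f x + b * A2 f x)
    (fun i x => a * k1 i x + b * k2 i x) (N1 + N2) (maxn K1 K2) (`|a| * C1 + `|b| * C2).
Proof.
move=> H1 H2.
have [_ n1 m1 c1 [C10 b1]] := H1; have [_ n2 m2 c2 [C20 b2]] := H2.
have nz i x : a * k1 i x + b * k2 i x != 0 -> (k1 i x != 0) \/ (k2 i x != 0).
  case: (eqVneq (k1 i x) 0) => [e1|]; last by left.
  by move=> h; right; apply: contra_neq h => e2; rewrite e1 e2 !mulr0 addr0.
have near i x : a * k1 i x + b * k2 i x != 0 -> `|i%:~R - x| <= (N1 + N2)%:R.
  by move=> /nz[/n1|/n2] h; apply: (le_trans h); rewrite ler_nat ?leq_addr ?leq_addl.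
split.
- move=> f x; rewrite (has_kernel_near f x H1 (leq_addr N2 N1)).
  rewrite (has_kernel_near f x H2 (leq_addl N1 N2)).
  rewrite !mulr_sumr -big_split/= (@lattice_sum_near x (N1 + N2)).
    by apply: eq_bigr => i _; ring.
  by move=> i; rewrite mulf_eq0 negb_or => /andP[_ /near].
- exact: near.
- by move=> m i x xm /nz[/(m1 _ _ _ xm)|/(m2 _ _ _ xm)] h; rewrite (leq_trans h)// leq_add2l ?leq_maxl ?leq_maxr.
- move=> i x; apply: cvgD; apply: cvgM; try exact: cvg_cst; [exact: c1|exact: c2].
- split; first by rewrite addr_ge0 ?mulr_ge0.
  move=> i x; apply: (le_trans (ler_normD _ _)).
  by apply: lerD; rewrite normrM ler_wpM2l.
Qed.

(** The outer operator samples the inner one only at integers s with |s| <= m + K1, where the inner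
    one uses nodes up to m + K1 + K2; thus both the ranges and the margins add up. *)
Lemma has_kernel_comp A1 A2 k1 k2 N1 N2 K1 K2 C1 C2 :
  has_kernel A1 k1 N1 K1 C1 -> has_kernel A2 k2 N2 K2 C2 ->
  has_kernel (fun f => A1 (A2 f))
    (fun i x => \sum_(s <- lattice_near i%:~R N2) k2 i s%:~R * k1 s x)
    (N1 + N2) (K1 + K2) ((2 * N2 + 2)%:R * (C2 * C1)).
Proof.
move=> H1 H2.
have [_ n1 m1 c1 [C10 b1]] := H1; have [_ n2 m2 c2 [C20 b2]] := H2.
have nz i x : \sum_(s <- lattice_near i%:~R N2) k2 i s%:~R * k1 s x != 0 ->
    exists s : int, k2 i s%:~R != 0 /\ k1 s x != 0.
  move=> h; apply: contrapT => h'; move/eqP: h; apply; apply: big1 => s _.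
  apply/eqP; apply: contrapT => /negP; rewrite mulf_eq0 negb_or => /andP[h1 h2].
  by apply: h'; exists s.
have near i x : \sum_(s <- lattice_near i%:~R N2) k2 i s%:~R * k1 s x != 0 ->
    `|i%:~R - x| <= (N1 + N2)%:R.
  move=> /nz[s [/n2 h2 /n1 h1]].
  have -> : i%:~R - x = (s%:~R - x) + (i%:~R - s%:~R) by ring.
  by rewrite natrD; apply: (le_trans (ler_normD _ _)); exact: lerD.
split.
- move=> f x; rewrite (has_kernel_near (A2 f) x H1 (leqnn N1)).
  rewrite (@lattice_sum_near x (N1 + N2)); last first.
    by move=> i; rewrite mulf_eq0 negb_or => /andP[_ /near].
  transitivity (\sum_(s <- lattice_near x N1) \sum_(i <- lattice_near x (N1 + N2))
      f i%:~R * (k2 i s%:~R * k1 s x)).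
    apply: eq_bigr => s _; case: (eqVneq (k1 s x) 0) => [->|k10].
      by rewrite mulr0 big1// => i _; rewrite mulr0 mulr0.
    have sx := n1 _ _ k10.
    have [-> _ _ _ _] := H2.
    rewrite (@lattice_sumE (lattice_near x (N1 + N2))).
    + by rewrite mulr_suml; apply: eq_bigr => i _; rewrite mulrA.
    + exact: lattice_near_uniq.
    + move=> i; rewrite mulf_eq0 negb_or => /andP[_ /n2 h2].
      apply: mem_lattice_near.
      have -> : i%:~R - x = (s%:~R - x) + (i%:~R - s%:~R) by ring.
      by rewrite natrD; apply: (le_trans (ler_normD _ _)); exact: lerD.
  rewrite exchange_big/=; apply: eq_bigr => i _; rewrite -mulr_sumr; congr (_ * _).
  have E : \sum_(s \in [set: int]) k2 i s%:~R * k1 s x =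
           \sum_(s <- lattice_near x N1) k2 i s%:~R * k1 s x.
    by apply: lattice_sum_near => s; rewrite mulf_eq0 negb_or => /andP[_ /n1].
  rewrite -E; apply: lattice_sum_near => s; rewrite mulf_eq0 negb_or => /andP[/n2 h _].
  by rewrite distrC.
- exact: near.
- move=> m i x xm /nz[s [h2 /(m1 _ _ _ xm) h1]].
  have sm : `|s%:~R : R| <= (m + K1)%:R by rewrite -intr_norm -(ler_nat R) in h1 *.
  by have := m2 _ _ _ sm h2; rewrite addnA.
- move=> i; apply: continuous_bigsum => s x.
  by apply: cvgM; [exact: cvg_cst|exact: c1].
- split; first by rewrite !mulr_ge0.
  move=> i x; apply: (le_trans (ler_norm_sum _ _ _)).
  apply: (@le_trans _ _ (\sum_(s <- lattice_near i%:~R N2) C2 * C1)).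
    by apply: ler_sum => s _; rewrite normrM ler_pM.
  by rewrite big_const_seq count_predT size_lattice_near iter_addr_0 mulr_natl.
Qed.

End LatticeKernels.

(** * B-splines and the kernels of the operators Q, R and P *)

Section BSplineKernels.
Context {R : realType}.

Lemma alternating_binomialS (F : nat -> R) n :
  \sum_(k < n.+2) (- 1) ^+ k * 'C(n.+1, k)%:R * F k =
  \sum_(k < n.+1) (- 1) ^+ k * 'C(n, k)%:R * (F k - F k.+1).
Proof.
have E : \sum_(k < n.+1) (- 1) ^+ k * 'C(n, k)%:R * F k =
    F 0%N + \sum_(k < n.+1) (- 1) ^+ k.+1 * 'C(n, k.+1)%:R * F k.+1.
  transitivity (\sum_(k < n.+2) (- 1) ^+ k * 'C(n, k)%:R * F k).
    by rewrite [RHS]big_ord_recr/= bin_small// mulr0 mul0r addr0.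
  by rewrite big_ord_recl/= bin0 mul1r mul1r.
rewrite big_ord_recl/= bin0 !mul1r.
under [RHS]eq_bigr do rewrite mulrBr.
rewrite sumrB E -addrA; congr (_ + _); rewrite -sumrB; apply: eq_bigr => i _.
by rewrite /bump/= add1n binS natrD exprS; ring.
Qed.

Lemma alternating_binomial_horner n (p : {poly R}) (y : R) : (size p <= n)%N ->
  \sum_(k < n.+1) (- 1) ^+ k * 'C(n, k)%:R * p.[y - k%:R] = 0.
Proof.
elim: n p y => [|n IH] p y pn.
  move: pn; rewrite leqn0 size_poly_eq0 => /eqP ->.
  by rewrite big1// => k _; rewrite horner0 mulr0.
rewrite (alternating_binomialS (fun k => p.[y - k%:R])).
(* The backward difference of p has degree one less, since the leading terms of X^i and (X - 1)^i
   cancel. *)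
pose q := p - (p \Po ('X - 1%:P)).
have -> : \sum_(k < n.+1) (- 1) ^+ k * 'C(n, k)%:R * (p.[y - k%:R] - p.[y - k.+1%:R]) =
    \sum_(k < n.+1) (- 1) ^+ k * 'C(n, k)%:R * q.[y - k%:R].
  apply: eq_bigr => k _; rewrite /q hornerD hornerN horner_comp hornerXsubC.
  by rewrite -natr1 opprD addrA.
apply: IH; rewrite /q.
have -> : p - (p \Po ('X - 1%:P)) = \sum_(i < size p) p`_i *: ('X^i - ('X - 1%:P) ^+ i).
  rewrite -{1}[p]coefK poly_def comp_polyE -sumrB.
  by apply: eq_bigr => i _; rewrite scalerBr.
apply: (leq_trans (size_sum _ _ _)); apply/bigmax_leqP => i _.
apply: (leq_trans (size_scale_leq _ _)).
rewrite subrXX opprB addrC subrK mul1r.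
apply: (leq_trans (size_sum _ _ _)); apply/bigmax_leqP => j _.
apply: (leq_trans (size_polyMleq _ _)).
rewrite size_polyXn size_exp_XsubC.
have := ltn_ord i; have := ltn_ord j; lia.
Qed.

Variable l : nat.
Hypothesis l_gt0 : (0 < l)%N.
Local Notation M := (@bspline R l).

(** To the left all truncated powers vanish. To the right all of them are genuine powers, and the
    sum is a difference of order 2l of a polynomial of degree 2l - 1. The strict inequality later
    saves one node on either side. *)
Lemma bspline_support (x : R) : M x != 0 -> `|x| < l%:R.
Proof.
apply: contraNT; rewrite -leNgt => lx; apply/eqP; rewrite /bspline.
have d0 : ((2 * l).-1 == 0)%N = false by lia.
have [x0|x0] := leP 0 x.
  rewrite ger0_norm// in lx.
  apply/eqP; rewrite mulf_eq0; apply/orP; right; apply/eqP.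
  rewrite -[RHS](@alternating_binomial_horner (2 * l) 'X^((2 * l).-1) (x + l%:R)); last first.
    by rewrite size_polyXn; lia.
  apply: eq_bigr => k _; rewrite hornerXn; congr (_ * _ ^+ _).
  have kl : (k%:R : R) <= (2 * l)%:R by rewrite ler_nat -ltnS.
  rewrite max_r; first by ring.
  by move: kl; rewrite natrM; lra.
rewrite ltr0_norm// in lx.
rewrite big1 ?mulr0// => k _.
have k0 : 0 <= (k%:R : R) by [].
by rewrite max_l ?expr0n ?d0 ?mulr0//; lra.
Qed.

Lemma continuous_bspline : continuous M.
Proof.
have cT (k : 'I_(2 * l).+1) : continuous (fun x : R => (- 1) ^+ k * 'C(2 * l, k)%:R *
    Num.max 0 (x - k%:R + l%:R) ^+ (2 * l).-1).
  move=> x; apply: cvgM; first exact: cvg_cst.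
  apply: (@continuous_comp _ _ _ (fun x : R => Num.max 0 (x - k%:R + l%:R))
     (fun y => y ^+ (2 * l).-1)); last exact: exprn_continuous.
  have -> : (fun x : R => Num.max 0 (x - k%:R + l%:R)) =
      (fun x => 2^-1 * ((x - k%:R + l%:R) + `|x - k%:R + l%:R|)).
    apply/funext => y; have [y0|y0] := leP 0 (y - k%:R + l%:R).
      by rewrite ger0_norm//; lra.
    by rewrite ltr0_norm//; lra.
  have cA : continuous (fun x : R => x - k%:R + l%:R).
    move=> y; apply: cvgD; last exact: cvg_cst.
    by apply: cvgB; [exact: cvg_id|exact: cvg_cst].
  apply: cvgM; first exact: cvg_cst.
  by apply: cvgD; [exact: cA|apply: cvg_norm; exact: cA].
move=> x; apply: cvgM; first exact: cvg_cst.
exact: (@continuous_bigsum _ _ _ _ cT x).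
Qed.

Lemma bspline_bounded : exists2 B : R, 0 <= B & forall x, `|M x| <= B.
Proof.
have cn : {within `[- l%:R, l%:R : R], continuous (fun s => `|M s|)}.
  apply: continuous_subspaceT => x.
  exact: (cvg_norm (@continuous_bspline x)).
have ll : - l%:R <= l%:R :> R by have : 0 <= (l%:R : R) by []; lra.
have [c _ cmax] := EVT_max ll cn.
exists `|M c| => // x; have [->|/bspline_support xl] := eqVneq (M x) 0.
  by rewrite normr0.
by apply: cmax; rewrite in_itv/= -ler_norml ltW.
Qed.

Lemma has_kernel_spline_interp0 : exists C : R, has_kernel (@spline_interp0 R l)
  (fun i x => (M 0)^-1 * M (2 ^ @kappa R l * (x - i%:~R))) 1 0 C.
Proof.
have [B B0 HB] := bspline_bounded.
(* The integer kappa is the least one above log2 (2 l) - 1 = log2 l. Hence each dilated B-spline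
   vanishes at distance 1 from its centre, which gives radius 1 and margin 0. *)
have kl : l%:R <= 2 ^ @kappa R l :> R.
  rewrite -powR_intmul// /powR ifF; last by rewrite pnatr_eq0.
  have ln2 : 0 < ln (2 : R) by rewrite ln_gt0// ltr1n.
  have l0 : 0 < l%:R :> R by rewrite ltr0n.
  rewrite -[leLHS]lnK ?posrE// ler_expR.
  have := ceil_ge (ln (2 * l)%:R / ln 2 - 1 : R); rewrite -/(@kappa R l).
  rewrite natrM lnM ?posrE// mulrDl divff ?gt_eqF// addrAC subrr add0r.
  by rewrite ler_pdivrMr.
have k0 : 0 < 2 ^ @kappa R l :> R by exact: exprz_gt0.
have supp (i : int) (x : R) : (M 0)^-1 * M (2 ^ @kappa R l * (x - i%:~R)) != 0 ->
    `|i%:~R - x| < 1.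
  rewrite mulf_eq0 negb_or => /andP[_ /bspline_support].
  rewrite normrM (gtr0_norm k0) distrC => h.
  have l0 : 0 < l%:R :> R by rewrite ltr0n.
  rewrite ltNge; apply/negP => h1.
  have : l%:R * 1 <= 2 ^ @kappa R l * `|i%:~R - x| by apply: ler_pM.
  by rewrite mulr1 leNgt h.
exists (`|(M 0)^-1| * B); split.
- move=> f x; rewrite /spline_interp0 mulr_fsumr.
  by apply: eq_fsbigr => i _; rewrite mulrCA.
- by move=> i x /supp /ltW.
- move=> m i x xm /supp h; rewrite addn0.
  have : `|i|%:~R < (m%:Z + 1)%:~R :> R.
    rewrite intr_norm rmorphD/= -pmulrn.
    have -> : i%:~R = (i%:~R - x) + x :> R by ring.
    by apply: le_lt_trans (ler_normD _ _) _; rewrite addrC ler_ltD.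
  by rewrite ltr_int; lia.
- move=> i x; apply: cvgM; first exact: cvg_cst.
  apply: (@continuous_comp _ _ _ (fun x : R => 2 ^ @kappa R l * (x - i%:~R)) M).
    apply: cvgM; first exact: cvg_cst.
    by apply: cvgB; [exact: cvg_id|exact: cvg_cst].
  exact: continuous_bspline.
- split; first by rewrite mulr_ge0.
  by move=> i x; rewrite normrM ler_wpM2l.
Qed.

(** The kernel at i is nonzero at x only if |i - x| < l + j0 strictly, so the margin is K = l + j0 -
    1. This gives 2 (m + K) + 1 = 2 (m + l + j0) - 1 nodes, exactly the budget in [mesh_index]. *)
Lemma has_kernel_quasi_interp j0 (c : int -> R) : exists k, exists C : R,
  has_kernel (quasi_interp l j0 c) k (l + j0) (l + j0).-1 C.
Proof.
have [B B0 HB] := bspline_bounded.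
pose J := [seq j <- lattice_near (0 : R) j0 | `|j| <= j0%:Z].
have uJ : uniq J by rewrite filter_uniq// lattice_near_uniq.
have memJ (j : int) : (j \in J) = (`|j| <= j0%:Z).
  rewrite mem_filter andb_idr// => jj0; apply: mem_lattice_near.
  by rewrite subr0 -intr_norm pmulrn ler_int.
have near (i j : int) (x : R) : j \in J -> M (x - (i + j)%:~R) != 0 ->
    `|i%:~R - x| < (l + j0)%:R.
  rewrite memJ => jj0 /bspline_support h.
  have -> : i%:~R - x = - ((x - (i + j)%:~R) + j%:~R) by rewrite rmorphD/=; ring.
  rewrite normrN natrD; apply: le_lt_trans (ler_normD _ _) _; rewrite ltr_leD//.
  by rewrite -intr_norm pmulrn ler_int.
exists (fun i x => \sum_(j <- J) c j * M (x - (i + j)%:~R)).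
exists (\sum_(j <- J) `|c j| * B).
have nz (i : int) (x : R) : \sum_(j <- J) c j * M (x - (i + j)%:~R) != 0 ->
    `|i%:~R - x| < (l + j0)%:R.
  move=> h; apply: contrapT => h'; move/eqP: h; apply.
  rewrite big_seq big1// => j jJ; apply/eqP; rewrite mulf_eq0; apply/orP; right.
  by apply/negPn/negP => /(near _ _ _ jJ).
split.
- move=> f x; rewrite /quasi_interp.
  transitivity (\sum_(s \in [set: int]) \sum_(j <- J) c j * f (s - j)%:~R * M (x - s%:~R)).
    apply: eq_fsbigr => s _; rewrite [RHS]fsbig_seq//; apply: eq_fsbigl.
    by apply/seteqP; split => j /=; rewrite memJ.
  rewrite (@lattice_sum_near _ x l); last first.
    move=> s; apply: contraNT => h; apply/eqP; apply: big1 => j _.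
    apply/eqP; rewrite mulf_eq0; apply/orP; right; apply/negPn/negP => /bspline_support.
    by move=> /ltW; rewrite distrC => h'; move: h; rewrite h'.
  rewrite exchange_big/=.
  transitivity (\sum_(j <- J) \sum_(i <- lattice_near x (l + j0))
      f i%:~R * (c j * M (x - (i + j)%:~R))); last first.
    rewrite exchange_big/= (@lattice_sum_near _ x (l + j0)).
      by apply: eq_bigr => i _; rewrite mulr_sumr.
    by move=> i; rewrite mulf_eq0 negb_or => /andP[_ /nz/ltW].
  apply: eq_big_seq => j jJ.
  rewrite -(@lattice_sum_near _ x l (fun s => c j * f (s - j)%:~R * M (x - s%:~R))); last first.
    by move=> s; rewrite mulf_eq0 negb_or => /andP[_ /bspline_support/ltW]; rewrite distrC.
  rewrite (reindex_fsbigT (fun i : int => i + j)); last first.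
    by exists (fun i => i - j) => i; rewrite ?addrK ?subrK.
  rewrite -(@lattice_sum_near _ x (l + j0)); last first.
    move=> i; rewrite mulf_eq0 negb_or => /andP[_].
    rewrite mulf_eq0 negb_or => /andP[_ h]; apply: ltW; exact: near jJ h.
  by apply: eq_fsbigr => i _; rewrite addrK; ring.
- by move=> i x /nz/ltW.
- move=> m i x xm /nz h.
  have : `|i|%:~R < (m%:Z + (l + j0)%:Z)%:~R :> R.
    rewrite intr_norm rmorphD/= -!pmulrn.
    have -> : i%:~R = (i%:~R - x) + x :> R by ring.
    by apply: le_lt_trans (ler_normD _ _) _; rewrite addrC ler_ltD.
  by rewrite ltr_int; lia.
- move=> i; apply: continuous_bigsum => j x; apply: cvgM; first exact: cvg_cst.
  apply: (@continuous_comp _ _ _ (fun x : R => x - (i + j)%:~R) M).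
    by apply: cvgB; [exact: cvg_id|exact: cvg_cst].
  exact: continuous_bspline.
- split; first by apply: sumr_ge0 => j _; rewrite mulr_ge0.
  move=> i x; apply: (le_trans (ler_norm_sum _ _ _)); apply: ler_sum => j _.
  by rewrite normrM ler_wpM2l.
Qed.

(** As R has margin 0, neither R nor R Q reaches beyond the nodes of Q, and P has the same sampling
    budget as Q. *)
Lemma has_kernel_spline_interp j0 (c : int -> R) : exists k, exists N, exists C : R,
  has_kernel (spline_interp l j0 c) k N (l + j0).-1 C.
Proof.
have [CR HR] := has_kernel_spline_interp0.
have [kQ [CQ HQ]] := has_kernel_quasi_interp j0 c.
have HRQ := has_kernel_comp HR HQ.
have H1 := has_kernelD 1 (- 1) HQ HRQ.
have H2 := has_kernelD 1 1 HR H1.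
rewrite max0n add0n maxnn in H2.
eexists; eexists; eexists.
have -> : spline_interp l j0 c = (fun f x => 1 * @spline_interp0 R l f x +
    1 * (1 * quasi_interp l j0 c f x + -1 * @spline_interp0 R l (quasi_interp l j0 c f) x)).
  by apply/funext => f; apply/funext => x; rewrite /spline_interp; ring.
exact: H2.
Qed.

End BSplineKernels.

(** * The central part of the error *)

Section PowerInequalities.
Context {R : realType}.

(** For s > 0, ln s >= 1 - 1/s and exp u >= 1 + u bound s^(lam - 1) from below; multiplication by s
    gives the claim. *)
Lemma bernoulli_powR (s lam : R) : 0 <= s -> 1 <= lam -> 1 + lam * (s - 1) <= s `^ lam.
Proof.
move=> s0 lam1; move: s0; rewrite le_eqVlt => /predU1P[<-|s0].
  by rewrite powR0; lra.
have -> : s `^ lam = s * s `^ (lam - 1).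
  by rewrite mulr_powRB1//; [exact: ltW|lra].
have lns : 1 - s^-1 <= ln s.
  have := @le_ln1Dx R (s^-1 - 1); rewrite (_ : 1 + (s^-1 - 1) = s^-1); last by ring.
  rewrite lnV ?posrE// => h.
  have : - ln s <= s^-1 - 1 by apply: h; rewrite ltrBrDl subrr invr_gt0.
  by lra.
have h : 1 + (lam - 1) * (1 - s^-1) <= s `^ (lam - 1).
  apply: (@le_trans _ _ (1 + (lam - 1) * ln s)).
    by rewrite lerD2l ler_wpM2l//; lra.
  by rewrite /powR gt_eqF//; exact: expR_ge1Dx.
apply: (@le_trans _ _ (s * (1 + (lam - 1) * (1 - s^-1)))); last by rewrite ler_wpM2l// ltW.
by apply: le_of_eq; field; rewrite gt_eqF.
Qed.

Lemma powR_sub_le (x y lam : R) : 0 <= x -> x <= y -> 1 <= lam ->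
  y `^ lam - x `^ lam <= lam * y `^ (lam - 1) * (y - x).
Proof.
move=> x0 xy lam1; have y0 : 0 <= y by exact: le_trans xy.
move: (y0); rewrite le_eqVlt => /predU1P[yE|{}y0].
  have xE : x = 0 by apply/eqP; rewrite eq_le x0 yE xy.
  by rewrite -yE xE !subrr mulr0.
have yE : y `^ lam = y * y `^ (lam - 1).
  by rewrite mulr_powRB1//; [exact: ltW|lra].
have := @bernoulli_powR (x / y) lam _ lam1; rewrite divr_ge0 ?(ltW y0)// => /(_ isT) h.
have -> : x `^ lam = y `^ lam * (x / y) `^ lam.
  by rewrite -powRM ?divr_ge0 ?(ltW y0)// mulrCA divff ?mulr1// gt_eqF.
have -> : lam * y `^ (lam - 1) * (y - x) = y `^ lam * (1 - (1 + lam * (x / y - 1))).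
  by rewrite yE; field; rewrite gt_eqF.
rewrite -[X in X - _]mulr1 -mulrBr ler_wpM2l ?powR_ge0//.
by lra.
Qed.

(** Only a move away from the origin lowers the weight, and a move by at most L raises |x|^lam by at
    most lam (T + L)^(lam - 1) L. Where T^(lam - 1) L stays bounded, the weight changes by a bounded
    factor. *)
Lemma weight_ratio (lam a T L x t : R) : 1 <= lam -> 0 < a -> 0 <= L ->
  `|x| <= T -> `|t| <= `|x| + L ->
  weight lam a x * expR (- (a * (lam * (T + L) `^ (lam - 1) * L))) <= weight lam a t.
Proof.
move=> lam1 a0 L0 xT tx; rewrite /weight -expRD ler_expR !mulNr -opprD lerN2 -mulrDr.
rewrite ler_pM2l//.
have xL : 0 <= `|x| + L by rewrite addr_ge0.
apply: (@le_trans _ _ ((`|x| + L) `^ lam)).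
  by apply: ge0_ler_powR; rewrite ?nnegrE//; lra.
rewrite -lerBlDl; apply: (le_trans (powR_sub_le _ _ lam1)) => //; first by rewrite lerDl.
rewrite [X in _ * X <= _](_ : _ = L); last by ring.
rewrite ler_wpM2r// ler_wpM2l//; first lra.
by apply: ge0_ler_powR; rewrite ?nnegrE//; lra.
Qed.

(** Brings the two cases of delta to one shape: the first term is what h^E yields, the second is the
    loss in passing from l_p to l_q. *)
Lemma rate_exponentE (lam : R) p q r : rate_exponent lam p q r =
  (1 - lam^-1) * (r%:R - inve p + inve q)
  - (if (p <= q)%E then 0 else inve q - inve p).
Proof. by rewrite /rate_exponent /delta_exponent; case: ifP => _; ring. Qed.

End PowerInequalities.

(** * The local error and its summation over the central cells *)

Section CentralEstimate.
Context {R : realType}.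
Local Notation mu := (@lebesgue_measure R).

Lemma Rintegral_le_cells (g : R -> R) (y : nat -> R) (n s : nat) (u v : R) :
  (forall a b, mu.-integrable `[a, b] (EFin \o g)) ->
  (forall i, y i <= y i.+1) -> y s <= u -> v <= y (s + n)%N ->
  \int[mu]_(t in `[u, v]) `|g t| <=
  \sum_(j < n) \int[mu]_(t in `[y (s + j)%N, y (s + j).+1]) `|g t|.
Proof.
move=> ig yy su vn.
have ig1 a b : mu.-integrable `[a, b] (EFin \o (fun t => `|g t|)).
  exact: (integrable_norm (ig a b)).
have pos a b : 0 <= \int[mu]_(t in `[a, b]) `|g t| by apply: Rintegral_ge0.
apply: (@le_trans _ _ (\int[mu]_(t in `[y s, y (s + n)%N]) `|g t|)).
  have sub : `[u, v] `<=` `[y s, y (s + n)%N].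
    by move=> t /=; rewrite !in_itv/= => /andP[ut tv]; apply/andP; split; lra.
  rewrite /Rintegral fine_le//; [exact: integrable_fin_num (ig1 _ _)..|].
  by apply: ge0_subset_integral => //; exact: measurable_int (ig1 _ _).
elim: n {vn} => [|n IH].
  by rewrite addn0 big_ord0 set_itv1 Rintegral_set1.
have yn : y s <= y (s + n)%N.
  by elim: n {IH} => [|n IH]; rewrite ?addn0// addnS; exact: le_trans IH (yy _).
rewrite addnS big_ord_recr/=; apply: le_trans (lerD IH (lexx _)).
have := @Rintegral_itvB _ (fun t => `|g t|) (BLeft (y s)) (BRight (y (s + n).+1)) (y (s + n)%N)
  (ig1 _ _).
rewrite !bnd_simp yn yy => /(_ isT isT) h.
have h2 : \int[mu]_(t in `]y (s + n)%N, y (s + n).+1]) `|g t| =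
          \int[mu]_(t in `[y (s + n)%N, y (s + n).+1]) `|g t|.
  apply: Rintegral_itv_obnd_cbnd; apply: integrableS (ig1 (y (s + n)%N) (y (s + n).+1)) => //.
  by apply: subset_itvr; rewrite bnd_simp.
by rewrite -h2 -h addrC subrK.
Qed.

Lemma mem_lattice_nearW (x : R) n (i : int) : i \in lattice_near x n ->
  `|i%:~R - x| <= n.+1%:R.
Proof.
move=> /mapP[j]; rewrite mem_iota add0n => /andP[_ jn] ->.
have /andP[f1 f2] := floor_itv x.
rewrite !rmorphD/= in f2 *; rewrite rmorphN/= -!pmulrn.
have jn' : (j%:R : R) <= (2 * n + 1)%:R by rewrite ler_nat; lia.
move: jn'; rewrite natrD natrM -natr1 => jn'.
have j0 : 0 <= (j%:R : R) by [].
by rewrite ler_norml; apply/andP; split; lra.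
Qed.

Definition reproduces (A : (R -> R) -> R -> R) (n : nat) :=
  forall P : {poly R}, (size P <= n)%N -> A (horner P) = horner P.

Variables (lam a : R) (p q : \bar R) (d : nat).
Hypotheses (lam_gt1 : 1 < lam) (a_gt0 : 0 < a) (p_ge1 : (1 <= p)%E) (q_ge1 : (1 <= q)%E).
Local Notation w := (weight lam a).

Lemma local_error A k N K C (h x : R) f g : has_kernel A k N K C ->
  reproduces A d.+1 -> 0 < h -> continuous f ->
  (forall a b, mu.-integrable `[a, b] (EFin \o g)) -> weak_derivative d.+1 f g ->
  `|f x - scaled_op A h f x| <= (1 + (2 * N + 2)%:R * C) *
    ((2 * N + 3)%:R * h) ^+ d *
    \int[mu]_(t in `[x - N.+1%:R * h, x + N.+2%:R * h]) `|g t|.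
Proof.
move=> HA repA h0 cf ig wfg.
have [_ kN _ _ [C0 kC]] := HA.
(* The functional f |-> f x - (A_h f) x. Its nodes lie within (N + 1) h of x, as the list may
   contain integers slightly farther than N; one more h is the smoothing room of [peano_bound]. *)
pose L := (1, x) :: [seq (- k i (x / h), i%:~R * h) | i <- lattice_near (x / h) N].
have LE F : lin_apply L F = F x - A (fun y => F (y * h)) (x / h).
  rewrite (has_kernel_near _ _ HA (leqnn N)) /lin_apply big_cons/= mul1r; congr (_ + _).
  rewrite big_map -sumrN; apply: eq_bigr => i _ /=; ring.
have LC : lin_mass L <= 1 + (2 * N + 2)%:R * C.
  rewrite /lin_mass big_cons/= normr1 lerD2l big_map.
  apply: (@le_trans _ _ (\sum_(i <- lattice_near (x / h) N) C)).
    by apply: ler_sum => i _; rewrite normrN.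
  by rewrite big_const_seq count_predT size_lattice_near iter_addr_0 mulr_natl.
have -> : f x - scaled_op A h f x = lin_apply L f.
  rewrite LE /scaled_op/= /dilation; congr (_ - A _ _).
  by apply/funext => y; rewrite invrK.
have Lpoly (P : {poly R}) : (size P <= d.+1)%N -> lin_apply L (horner P) = 0.
  move=> sP; rewrite LE.
  have -> : (fun y => P.[y * h]) = horner (P \Po (h *: 'X)).
    by apply/funext => y; rewrite horner_comp hornerZ hornerX mulrC.
  rewrite repA; first by rewrite horner_comp hornerZ hornerX mulrC divfK ?subrr// gt_eqF.
  have := size_comp_poly_leq P (h *: 'X).
  by rewrite size_scale ?gt_eqF// size_polyX; lia.
have Lnode c : c \in L -> x - N.+1%:R * h <= c.2 <= x + N.+1%:R * h.
  have Nh : 0 <= N.+1%:R * h by rewrite mulr_ge0// ltW.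
  rewrite inE => /orP[/eqP ->/=|/mapP[i /mem_lattice_nearW ix ->]/=].
    by apply/andP; split; lra.
  rewrite -lerBlDl -[X in X && _]lerBDl -ler_norml.
  have -> : i%:~R * h - x = (i%:~R - x / h) * h by field; rewrite gt_eqF.
  by rewrite normrM (gtr0_norm h0) ler_pM2r.
have lohi : x - N.+1%:R * h <= x + N.+1%:R * h.
  have : 0 <= N.+1%:R * h by rewrite mulr_ge0// ltW.
  by lra.
have := peano_bound cf ig wfg Lpoly Lnode lohi h0.
have -> : x + N.+1%:R * h + h = x + N.+2%:R * h.
  by rewrite -[N.+2%:R]natr1; ring.
have -> : x + N.+1%:R * h - (x - N.+1%:R * h) + h = (2 * N + 3)%:R * h.
  by rewrite natrD natrM -natr1; ring.
move=> H; apply: (le_trans H).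
rewrite -mulrA -[leRHS]mulrA ler_wpM2r//.
by rewrite mulr_ge0 ?exprn_ge0 ?mulr_ge0 ?(ltW h0)// Rintegral_ge0.
Qed.

Lemma central_estimate A k N K C (c0 : R) : has_kernel A k N K C ->
  reproduces A d.+1 -> 0 < c0 ->
  exists2 Cst : R, 0 < Cst & forall (m : nat) f, (0 < m)%N ->
    sobolev_ball lam a d.+1 p f ->
    let T := c0 * m%:R `^ lam^-1 in let h := T / m%:R in
    exists u : nat -> R, [/\ forall i, 0 <= u i,
      forall i x, (i < 2 * m)%N -> - T + i%:R * h <= x <= - T + i.+1%:R * h ->
        `|f x - scaled_op A h f x| * w x <= u i &
      lp_bounded q (fun i => h `^ inve q * u i)
        (Cst * m%:R `^ (- rate_exponent lam p q d.+1))].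
Proof.
move=> HA repA c00.
have [_ _ _ _ [C0 _]] := HA.
(* The windows [x - (N + 1) h, x + (N + 2) h], for x in one cell, are covered by n cells of the grid
   y below, which starts N + 2 steps before -T to keep all indices nonnegative. *)
pose n := (2 * N + 5)%N.
(* With L = n h and T + n h <= (1 + n) T, the exponent in [weight_ratio] is at most a D, because
   T^(lam - 1) h = T^lam / m = c0^lam. *)
pose D := lam * (1 + n%:R) `^ (lam - 1) * n%:R * c0 `^ lam.
pose E := d.+1%:R - inve p + inve q.
have [C2 C20 HC2] := @lp_bounded_window R p n p_ge1.
pose MC := (1 + (2 * N + 2)%:R * C) * (2 * N + 3)%:R ^+ d * (2 * expR (a * D)).
have MC0 : 0 < MC.
  rewrite !mulr_gt0 ?expR_gt0 ?exprn_gt0 ?ltr0n//; last by rewrite addn3.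
  by rewrite ltr_pwDl// mulr_ge0.
pose sg := if (p <= q)%E then 0 else inve q - inve p.
exists (MC * c0 `^ E * (2 * (2 `^ sg * C2))).
  by rewrite (mulr_gt0 (mulr_gt0 MC0 (powR_gt0 _ c00)))// mulr_gt0// mulr_gt0// powR_gt0.
move=> m f m0 fB T h.
have M0 : 0 < m%:R :> R by rewrite ltr0n.
have M1 : 1 <= m%:R :> R by rewrite ler1n.
have T0 : 0 < T by rewrite mulr_gt0 ?powR_gt0.
have h0 : 0 < h by rewrite divr_gt0.
have hT : h <= T by rewrite ler_pdivrMr// ler_peMr// ltW.
have lam1 : 1 <= lam by exact: ltW.
have lam0 : 0 < lam by exact: lt_trans lam_gt1.
have Th : T = m%:R * h by rewrite /h mulrCA mulfV ?mulr1// gt_eqF.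
have [g [cf mg wfg _ bg]] := sobolev_ball_data p_ge1 fB.
have ig u v := weighted_ball_integrable lam0 a_gt0 u v p_ge1 mg bg.
pose y (j : nat) := - T - N.+2%:R * h + j%:R * h.
have yS i : y i.+1 = y i + h by rewrite /y -natr1; ring.
have yy i : y i <= y i.+1 by rewrite yS; lra.
have ymon i j : y (i + j)%N = y i + j%:R * h by rewrite /y natrD; ring.
pose dd j := cell_norm lam a p g (y j) (y j.+1).
have dd0 j : 0 <= dd j by exact: cell_norm_ge0.
have ddB : lp_bounded p dd 1 by exact: cell_norm_bounded.
pose V i := \sum_(j < n) dd (i + j)%N.
have V0 i : 0 <= V i by exact: sumr_ge0.
have VB : lp_bounded p V C2 by have := HC2 dd 1 ler01 dd0 ddB; rewrite mulr1.
pose u (i : nat) := MC * (h ^+ d * h `^ (1 - inve p)) * ((i < 2 * m)%:R * V i).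
exists u; split.
- move=> i; rewrite /u (mulr_ge0 (mulr_ge0 (ltW MC0) _))//; last exact: mulr_ge0.
  by rewrite mulr_ge0 ?exprn_ge0 ?powR_ge0 ?(ltW h0).
- move=> i x im /andP[x1 x2]; rewrite /u im mul1r.
  have iM : i.+1%:R <= (2 * m)%:R :> R by rewrite ler_nat.
  have i0 : 0 <= i%:R * h by rewrite mulr_ge0// ltW.
  have xT : `|x| <= T.
    rewrite ler_norml; apply/andP; split; first lra.
    apply: (le_trans x2); rewrite -lerBrDl opprK.
    have -> : T + T = (2 * m)%:R * h by rewrite Th natrM; ring.
    by rewrite ler_wpM2r// ltW.
  have TL : T `^ lam = c0 `^ lam * m%:R.
    by rewrite /T powRM ?powR_ge0 ?(ltW c00)// -powRrM mulVf ?powRr1 ?gt_eqF.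
  have win t : y i <= t <= y (i + n)%N -> w x * expR (- (a * D)) <= w t.
    move=> /andP[t1 t2]; rewrite ymon in t2.
    have yi : y i <= x.
      have : 0 <= N.+2%:R * h by rewrite mulr_ge0// ltW.
      by rewrite /y; lra.
    have xi : x <= y i + n%:R * h.
      apply: (le_trans x2); rewrite /y -natr1 /n natrD natrM -addn2 natrD.
      have : 0 <= N%:R * h by rewrite mulr_ge0// ltW.
      by lra.
    have txn : `|t| <= `|x| + n%:R * h.
      rewrite addrC -lerBlDr; apply: (le_trans (lerB_dist _ _)).
      by rewrite ler_norml; apply/andP; split; lra.
    have L0 : 0 <= n%:R * h by rewrite mulr_ge0// ltW.
    apply: le_trans (weight_ratio lam1 a_gt0 L0 xT txn).
    rewrite ler_wpM2l ?weight_ge0// ler_expR lerN2 ler_pM2l//.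
    have DE : D = lam * ((1 + n%:R) * T) `^ (lam - 1) * (n%:R * h).
      rewrite powRM ?addr_ge0 ?(ltW T0)//.
      have : T `^ (lam - 1) * h = c0 `^ lam.
        rewrite /h mulrA; have -> : T `^ (lam - 1) * T = T `^ lam.
          by rewrite mulrC mulr_powRB1// ltW.
        by rewrite TL mulfK// gt_eqF.
      by rewrite /D => <-; ring.
    rewrite DE ler_wpM2r// ler_wpM2l ?(ltW lam0)//.
    have TT : T + n%:R * h <= (1 + n%:R) * T by rewrite mulrDl mul1r lerD2l ler_wpM2l.
    have T0' := ltW T0.
    by apply: ge0_ler_powR; rewrite ?nnegrE//; lra.
  have W0 : 0 < w x * expR (- (a * D)) by rewrite mulr_gt0 ?expR_gt0 ?weight_gt0.
  have cellb j : (j < n)%N -> \int[mu]_(t in `[y (i + j)%N, y (i + j).+1]) `|g t| <=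
      2 * (h `^ (1 - inve p) * ((w x * expR (- (a * D)))^-1 * dd (i + j)%N)).
    move=> jn; have -> : h = y (i + j).+1 - y (i + j)%N by rewrite yS; ring.
    apply: cell_holder => // t /andP[t1 t2]; apply: win; apply/andP; split.
      apply: le_trans t1; rewrite ymon lerDl mulr_ge0// ltW//.
    apply: (le_trans t2); rewrite -addnS !ymon lerD2l ler_wpM2r ?(ltW h0)// ler_nat//.
  have LE := @local_error A k N K C h x f g HA repA h0 cf ig wfg.
  have Xs : y i <= x - N.+1%:R * h.
    by rewrite /y -[N.+2%:R]natr1; have := h0; lra.
  have Xn : x + N.+2%:R * h <= y (i + n)%N.
    rewrite ymon /y; apply: (@le_trans _ _ (- T + i.+1%:R * h + N.+2%:R * h)).
      by rewrite lerD2r.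
    by rewrite /n -natr1 natrD natrM -[N.+2]addn2 natrD; lra.
  have IC := Rintegral_le_cells ig yy Xs Xn.
  have {}IC := le_trans IC (ler_sum _ (fun (j : 'I_n) _ => cellb j (ltn_ord j))).
  have c1 : 0 <= (1 + (2 * N + 2)%:R * C) * ((2 * N + 3)%:R * h) ^+ d.
    have k1 : 0 <= (2 * N + 2)%:R * C by exact: mulr_ge0.
    by rewrite mulr_ge0 ?exprn_ge0 ?(mulr_ge0 _ (ltW h0))// addr_ge0.
  have {}LE := le_trans LE (ler_wpM2l c1 IC).
  apply: (le_trans (ler_wpM2r (ltW (weight_gt0 lam a x)) LE)).
  apply: le_of_eq.
  rewrite -!mulr_sumr -/(V i) exprMn expRN invfM invrK /MC.
  by field; rewrite gt_eqF ?weight_gt0.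
- have -> : (fun i => h `^ inve q * u i) =
      (fun i => (MC * h `^ E) * ((i < 2 * m)%:R * V i)).
    apply/funext => i; rewrite /u mulrA; congr (_ * _).
    have -> : h `^ E = h `^ inve q * (h ^+ d * h `^ (1 - inve p)).
      rewrite -powR_mulrn ?(ltW h0)// -!powRD; try by apply/implyP => _; rewrite gt_eqF.
      by congr (_ `^ _); rewrite /E -natr1; ring.
    by ring.
  have m2 : (0 < 2 * m)%N by rewrite muln_gt0.
  have := lp_boundedZ q_ge1 (_ : 0 <= MC * h `^ E) _ _
    (lp_bounded_block p_ge1 q_ge1 m2 C20 V0 VB).
  rewrite -/sg.
  have -> : MC * h `^ E * (2 * ((2 * m)%:R `^ sg * C2)) =
    MC * c0 `^ E * (2 * (2 `^ sg * C2)) * m%:R `^ (- rate_exponent lam p q d.+1).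
    have hE : h `^ E = c0 `^ E * m%:R `^ (- ((1 - lam^-1) * E)).
      have -> : h = c0 * m%:R `^ (lam^-1 - 1).
        rewrite /h /T -mulrA; congr (_ * _).
        rewrite gt0_powRB//.
        by rewrite powRr1 ?ler0n.
      rewrite powRM ?powR_ge0 ?(ltW c00)// -powRrM; congr (_ * _ `^ _); ring.
    have -> : (2 * m)%:R `^ sg = 2 `^ sg * m%:R `^ sg by rewrite natrM powRM.
    rewrite hE rate_exponentE -/E -/sg.
    have -> : m%:R `^ (- ((1 - lam^-1) * E - sg)) =
        m%:R `^ (- ((1 - lam^-1) * E)) * m%:R `^ sg.
      rewrite -gt0_powRD//.
      by congr (_ `^ _); ring.
    by ring.
  apply.
  + by rewrite mulr_ge0 ?powR_ge0 ?(ltW MC0).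
  + by rewrite !mulr_ge0 ?powR_ge0 ?(ltW C20).
  + by move=> i; rewrite mulr_ge0.
Qed.

End CentralEstimate.

(** * The tails *)

Section Interpolation.
Context {R : realType}.
Local Notation mu := (@lebesgue_measure R).

Lemma lagrange_interpolation (d : nat) (z : nat -> R) (x sep D : R) : 0 < sep ->
  (forall i k, (i <= d)%N -> (k <= d)%N -> i != k -> sep <= `|z i - z k|) ->
  (forall i, (i <= d)%N -> `|x - z i| <= D) ->
  exists2 L : nat -> R, (forall i, (i <= d)%N -> `|L i| <= (D / sep) ^+ d) &
    forall P : {poly R}, (size P <= d.+1)%N -> P.[x] = \sum_(i < d.+1) L i * P.[z i].
Proof.
move=> sep0 zsep xD.
have nz i k : (i <= d)%N -> (k <= d)%N -> i != k -> z i - z k != 0.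
  by move=> id kd ik; rewrite -normr_gt0; exact: lt_le_trans sep0 (zsep _ _ id kd ik).
pose l (i : 'I_d.+1) : {poly R} :=
  \prod_(k < d.+1 | k != i) ((z i - z k)^-1 *: ('X - (z k)%:P)).
have lE (i : 'I_d.+1) t : (l i).[t] = \prod_(k < d.+1 | k != i) ((z i - z k)^-1 * (t - z k)).
  by rewrite horner_prod; apply: eq_bigr => k _; rewrite hornerZ hornerXsubC.
have cardP (i : 'I_d.+1) : #|[pred k | k != i]| = d by rewrite cardC1 card_ord.
have sl i : (size (l i) <= d.+1)%N.
  apply: (leq_trans (size_poly_prod_leq _ _)); rewrite leq_subLR cardP.
  apply: (@leq_trans (\sum_(k < d.+1 | k != i) 2).+1).
    rewrite ltnS; apply: leq_sum => k _.
    by apply: (leq_trans (size_scale_leq _ _)); rewrite size_XsubC.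
  by rewrite sum_nat_const cardP; lia.
have ll (i k : 'I_d.+1) : (l i).[z k] = (k == i)%:R.
  rewrite lE; have [->|ki] := eqVneq k i.
    apply: big1 => j ji; rewrite mulVf// nz// -1?ltnS//.
    by rewrite eq_sym.
  by rewrite (bigD1 k)//= subrr mulr0 mul0r.
pose L (i : nat) := if insub i is Some j then (l j).[x] else 0.
have LE (i : 'I_d.+1) : L i = (l i).[x].
  by rewrite /L valK.
exists L.
  move=> i id; rewrite -ltnS in id; rewrite -[i]/(val (Ordinal id)) LE lE normr_prod.
  apply: (@le_trans _ _ (\prod_(k < d.+1 | k != Ordinal id) (D / sep))).
    apply: ler_prod => k ki; rewrite normr_ge0 normrM normfV mulrC.
    have kd : (k <= d)%N by rewrite -ltnS.
    have := zsep i k id kd; rewrite eq_sym => /(_ ki) h.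
    have := xD k kd => h2; have h0 := normr_ge0 (x - z k).
    rewrite ler_pM ?invr_ge0// lef_pV2// posrE; exact: lt_le_trans h.
  by rewrite prodr_const cardP.
move=> P sP.
suff E : P = \sum_(i < d.+1) P.[z i] *: l i.
  rewrite {1}E horner_sum; apply: eq_bigr => i _.
  by rewrite hornerZ LE mulrC.
apply/eqP; rewrite -subr_eq0; apply/eqP.
apply: (@roots_geq_poly_eq0 _ _ [seq z i | i <- iota 0 d.+1]).
- apply/allP => t /mapP[k]; rewrite mem_iota add0n => /andP[_ kd] ->.
  rewrite rootE hornerD hornerN horner_sum subr_eq0 (bigD1 (Ordinal kd))//= big1.
    by rewrite hornerZ -[z k]/(z (Ordinal kd)) ll eqxx mulr1 addr0.
  by move=> i ik; rewrite hornerZ -[z k]/(z (Ordinal kd)) ll eq_sym (negbTE ik) mulr0.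
- rewrite map_inj_in_uniq ?iota_uniq// => i k; rewrite !mem_iota add0n !ltnS => /andP[_ id] /andP[_ kd] zik.
  by apply/eqP/negPn/negP => ik; have := nz _ _ id kd ik; rewrite zik subrr eqxx.
rewrite size_map size_iota; apply: (leq_trans (size_polyD _ _)).
rewrite geq_max sP size_polyN; apply: (leq_trans (size_sum _ _ _)).
by apply/bigmax_leqP => i _; apply: leq_trans (size_scale_leq _ _) (sl i).
Qed.

Lemma separated_nodes d (z : nat -> R) s :
  (forall i k, (i <= d)%N -> (k <= d)%N -> (i < k)%N -> s <= z k - z i) ->
  forall i k, (i <= d)%N -> (k <= d)%N -> i != k -> s <= `|z i - z k|.
Proof.
move=> zs i k id kd; rewrite neq_ltn => /orP[ik|ki]; last first.
  by rewrite (le_trans (zs k i kd id ki))// ler_norm.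
by rewrite distrC (le_trans (zs i k id kd ik))// ler_norm.
Qed.

(** Peano's bound for the error functional of Lagrange interpolation at the d + 1 nodes z; ka
    dominates the sum of the moduli of the Lagrange coefficients at x, also when x lies outside the
    hull of the nodes. *)
Lemma interpolation_bound d f g (z : nat -> R) (x lo hi e sep B ka : R) : continuous f ->
  (forall a b, mu.-integrable `[a, b] (EFin \o g)) -> weak_derivative d.+1 f g ->
  0 < sep -> 0 < e -> lo <= x <= hi ->
  (forall i k, (i <= d)%N -> (k <= d)%N -> i != k -> sep <= `|z i - z k|) ->
  (forall i, (i <= d)%N -> lo <= z i <= hi) ->
  (forall i, (i <= d)%N -> `|f (z i)| <= B) ->
  d.+1%:R * ((hi - lo) / sep) ^+ d <= ka ->
  `|f x| <= ka * B + (1 + ka) * (hi - lo + e) ^+ d * \int[mu]_(t in `[lo, hi + e]) `|g t|.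
Proof.
move=> cf ig wfg sep0 e0 /andP[lx xh] zsep zI fB kaE.
have xD i : (i <= d)%N -> `|x - z i| <= hi - lo.
  by move=> /zI /andP[? ?]; rewrite ler_norml; apply/andP; split; lra.
have [L LB LP] := lagrange_interpolation sep0 zsep xD.
pose A := (1, x) :: [seq (- L i, z i) | i : 'I_d.+1 <- index_enum 'I_d.+1].
have AE F : lin_apply A F = F x - \sum_(i < d.+1) L i * F (z i).
  rewrite /lin_apply big_cons/= mul1r; congr (_ + _).
  rewrite big_map -sumrN.
  by apply: eq_bigr => i _ /=; rewrite mulNr.
have lohi : lo <= hi by lra.
have B0 : 0 <= B by apply: le_trans (fB 0%N _).
have Lka : \sum_(i < d.+1) `|L i| <= ka.
  apply: (@le_trans _ _ (\sum_(i < d.+1) ((hi - lo) / sep) ^+ d)).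
    by apply: ler_sum => i _; apply: LB; rewrite -ltnS.
  by apply: le_trans kaE; rewrite sumr_const card_ord mulr_natl.
have AM : lin_mass A <= 1 + ka.
  rewrite /lin_mass big_cons/= normr1 lerD2l big_map.
  by apply: le_trans Lka; apply: ler_sum => i _ /=; rewrite normrN.
have := @peano_bound _ d f g A lo hi e cf ig wfg _ _ lohi e0.
have h1 (P : {poly R}) : (size P <= d.+1)%N -> lin_apply A (horner P) = 0.
  by move=> sP; rewrite AE -LP// subrr.
have h2 (c : R * R) : c \in A -> lo <= c.2 <= hi.
  rewrite inE => /orP[/eqP ->/=|/mapP[i _ ->]/=]; first by rewrite lx.
  by apply: zI; rewrite -ltnS.
move=> /(_ h1 h2); rewrite AE => h.
have h3 : `|\sum_(i < d.+1) L i * f (z i)| <= ka * B.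
  apply: le_trans (ler_norm_sum _ _ _) _.
  apply: (@le_trans _ _ (\sum_(i < d.+1) `|L i| * B)).
    by apply: ler_sum => i _; rewrite normrM ler_wpM2l// fB// -ltnS.
  by rewrite -mulr_suml ler_wpM2r.
have h4 : lin_mass A * (hi - lo + e) ^+ d * \int[mu]_(t in `[lo, hi + e]) `|g t| <=
    (1 + ka) * (hi - lo + e) ^+ d * \int[mu]_(t in `[lo, hi + e]) `|g t|.
  rewrite ler_wpM2r ?Rintegral_ge0// ler_wpM2r// exprn_ge0//; lra.
have := ler_normD (f x - \sum_(i < d.+1) L i * f (z i)) (\sum_(i < d.+1) L i * f (z i)).
rewrite subrK => h5; apply: (le_trans h5); rewrite addrC; apply: (lerD h3).
exact: le_trans h h4.
Qed.

(** The added 1 leaves strict room for the argument by contradiction, so the mean value need not be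
    attained. *)
Lemma exists_le_mean (f : R -> R) (u v B : R) : continuous f -> u < v ->
  \int[mu]_(t in `[u, v]) `|f t| <= B ->
  exists2 t, u <= t <= v & `|f t| <= B / (v - u) + 1.
Proof.
move=> cf uv fB; have uv0 : 0 < v - u by rewrite subr_gt0.
apply: contrapT => nex; move: fB; apply/negP; rewrite -ltNge.
have cst k : mu.-integrable `[u, v] (EFin \o (fun=> k : R)).
  by apply: continuous_integrable => t; exact: cvg_cst.
apply: (@lt_le_trans _ _ (\int[mu]_(t in `[u, v]) (B / (v - u) + 1))).
  rewrite Rintegral_cst// measure_segment ?(ltW uv)// mulrDl mul1r divfK ?gt_eqF//.
  by lra.
apply: le_Rintegral => //; first exact: integrable_norm (continuous_integrable _ _ cf).
move=> t /=; rewrite in_itv/= => tI; rewrite leNgt; apply/negP => h.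
by apply: nex; exists t => //; exact: ltW.
Qed.

End Interpolation.

(** * The tail mesh, the contractive recursion and the tail bound *)

Section TailEstimate.
Context {R : realType}.
Local Notation mu := (@lebesgue_measure R).
Variables (lam : R).
Hypothesis (lam_gt1 : 1 < lam).

Let lam_gt0 : 0 < lam.
Proof. exact: lt_trans lam_gt1. Qed.

Let om_ge0 : 0 <= 1 - lam^-1.
Proof. by rewrite subr_ge0 invf_le1// ltW. Qed.

(* The mesh makes the weight decay by the constant factor [expR (- (a * La))] from
   one node to the next; see [weight_tail_mesh]. *)
Definition tail_mesh (La : R) (j : nat) : R := (La * j%:R) `^ lam^-1.

(* A nonincreasing sequence comparable to the increments of [tail_mesh La]. *)
Definition tail_step (La : R) (j : nat) : R := La `^ lam^-1 * j.+1%:R `^ (lam^-1 - 1).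

Section Mesh.
Variable La : R.
Hypothesis La_gt0 : 0 < La.
Local Notation x := (tail_mesh La).
Local Notation m := (tail_step La).

Lemma tail_step_gt0 j : 0 < m j.
Proof. by rewrite mulr_gt0 ?powR_gt0. Qed.

Lemma tail_mesh_ge0 j : 0 <= x j.
Proof. exact: powR_ge0. Qed.

Lemma tail_mesh0 : x 0%N = 0.
Proof. by rewrite /tail_mesh mulr0 powR0// invr_neq0// gt_eqF. Qed.

Lemma tail_mesh_powR j : x j `^ lam = La * j%:R.
Proof.
rewrite /tail_mesh -powRrM mulVf ?powRr1// ?mulr_ge0 ?(ltW La_gt0)//.
by rewrite gt_eqF.
Qed.

Lemma tail_meshE j : x j = La `^ lam^-1 * (j%:R * j%:R `^ (lam^-1 - 1)).
Proof.
rewrite /tail_mesh powRM ?(ltW La_gt0)//; congr (_ * _).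
by rewrite mulr_powRB1// invr_gt0.
Qed.

Lemma tail_step_nonincreasing j : m j.+1 <= m j.
Proof.
rewrite ler_wpM2l ?powR_ge0//.
have -> : lam^-1 - 1 = - (1 - lam^-1) by ring.
rewrite !powRN lef_pV2 ?posrE ?powR_gt0//.
apply: ge0_ler_powR; rewrite ?nnegrE// ?ler_nat//.
Qed.

Lemma tail_step_le2 j : m j <= 2 * m j.+1.
Proof.
rewrite mulrCA ler_wpM2l ?powR_ge0//.
have -> : lam^-1 - 1 = - (1 - lam^-1) by ring.
rewrite !powRN ler_pdivlMr ?powR_gt0// mulrC ler_pdivrMr ?powR_gt0//.
apply: (@le_trans _ _ ((2 * j.+1%:R) `^ (1 - lam^-1))).
  apply: ge0_ler_powR; rewrite ?nnegrE//.
  by rewrite -natrM ler_nat; lia.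
rewrite powRM// ler_wpM2r ?powR_ge0//.
rewrite -[leRHS](powRr1 (ler0n R 2)).
by rewrite ler_powR ?ler1n// lerBlDr lerDl invr_ge0 ltW.
Qed.

Lemma tail_mesh_lt j : x j < x j.+1.
Proof.
have h : x j `^ lam < x j.+1 `^ lam by rewrite !tail_mesh_powR ltr_pM2l// ltr_nat.
rewrite ltNge; apply/negP => xx; move: h; rewrite ltNge => /negP; apply.
by apply: ge0_ler_powR; rewrite ?nnegrE ?tail_mesh_ge0// ltW.
Qed.

Lemma tail_mesh_step_le j : x j.+1 - x j <= m j.
Proof.
rewrite !tail_meshE -mulrBr ler_wpM2l ?powR_ge0//.
rewrite -natr1 mulrDl mul1r natr1 lerBlDr addrC lerD2l.
case: j => [|j]; first by rewrite !mul0r.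
rewrite ler_wpM2l//.
have := tail_step_nonincreasing j.
by rewrite /tail_step ler_pM2l ?powR_gt0.
Qed.

(** By construction x_(j+1)^lam - x_j^lam = La, which is at most lam x_(j+1)^(lam - 1) times the
    increment, while m_j x_(j+1)^(lam - 1) = La exactly. *)
Lemma tail_step_le_mesh j : m j <= lam * (x j.+1 - x j).
Proof.
have h := powR_sub_le (tail_mesh_ge0 j) (ltW (tail_mesh_lt j)) (ltW lam_gt1).
rewrite !tail_mesh_powR -mulrBr -natr1 addrAC subrr add0r mulr1 in h.
have y0 : 0 < x j.+1 `^ (lam - 1).
  by rewrite powR_gt0// (le_lt_trans (tail_mesh_ge0 j) (tail_mesh_lt j)).
rewrite -(ler_pM2r y0); apply: (@le_trans _ _ La); last by apply: (le_trans h); rewrite mulrAC.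
apply: le_of_eq.
rewrite /tail_mesh -powRrM powRM ?(ltW La_gt0)// /tail_step mulrACA -!powRD.
- rewrite (_ : lam^-1 + lam^-1 * (lam - 1) = 1); last by field; rewrite ?gt_eqF.
  rewrite (_ : lam^-1 - 1 + lam^-1 * (lam - 1) = 0); last by field; rewrite ?gt_eqF.
  by rewrite powRr0 powRr1 ?mulr1// ltW.
- by apply/implyP => _; rewrite gt_eqF.
- by apply/implyP => _; rewrite gt_eqF.
Qed.

End Mesh.

Variables (a : R) (p : \bar R) (d : nat).
Hypotheses (a_gt0 : 0 < a) (p_ge1 : (1 <= p)%E).
Local Notation w := (weight lam a).

Lemma weight_tail_mesh La j : 0 < La -> w (tail_mesh La j) = expR (- (a * (La * j%:R))).
Proof.
move=> La0; rewrite /weight ger0_norm ?tail_mesh_ge0// tail_mesh_powR// mulNr//.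
Qed.

(** The start of the recursion. The weighted p-norm bounds the means of |f|, so on each of d + 1
    separated subintervals some point has a controlled value; interpolation at these points controls
    f on the whole cell. *)
Lemma first_cell_bound La : 0 < La -> exists2 K : R, 0 < K & forall f g,
  continuous f -> measurable_fun [set: R] g -> weak_derivative d.+1 f g ->
  weighted_ball lam a p f -> weighted_ball lam a p g ->
  forall t, 0 <= t <= tail_mesh La 1 -> `|f t| <= K.
Proof.
move=> La0; pose X := tail_mesh La 1.
have X0 : 0 < X by rewrite -[0](tail_mesh0 La); exact: tail_mesh_lt.
(* Of the 2 (d + 1) pieces of length s every second one is used, so that points chosen in different
   pieces are at least s apart. *)
pose s := X / (2 * d.+1%:R).
have d0 : 0 < 2 * d.+1%:R :> R by rewrite mulr_gt0.
have s0 : 0 < s by rewrite divr_gt0.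
(* Hoelder's bound for intervals of length L inside [0, 2 X]; the remainder of the interpolation is
   integrated up to 2 X because its smoothing room is X. *)
pose H L := 2 * (L `^ (1 - inve p) * ((w (2 * X))^-1 * 1)).
have H0 L : 0 <= H L by rewrite !mulr_ge0 ?powR_ge0 ?invr_ge0 ?weight_ge0.
have HB (g : R -> R) u v : measurable_fun [set: R] g -> weighted_ball lam a p g ->
    0 <= u -> u <= v -> v <= 2 * X -> \int[mu]_(t in `[u, v]) `|g t| <= H (v - u).
  move=> mg gb u0 uv vX.
  have cn : cell_norm lam a p g u v <= 1.
    pose y (i : nat) := if i is 0%N then u else v.
    have yy i : y i <= y i.+1 by case: i => [|[]]/=.
    have := lp_bounded_le 0 p_ge1 ler01 (fun i => cell_norm_ge0 lam a p g (y i) (y i.+1))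
      (cell_norm_bounded p_ge1 mg gb yy).
    by [].
  have wl t : u <= t <= v -> w (2 * X) <= w t.
    move=> /andP[ut tv]; apply: le_weight => //.
    by rewrite !ger0_norm; lra.
  apply: (le_trans (cell_holder lam_gt0 a_gt0 p_ge1 mg gb uv (weight_gt0 _ _ _) wl)).
  by rewrite !ler_wpM2l ?powR_ge0 ?invr_ge0 ?weight_ge0.
pose B := H s / s + 1.
pose ka := d.+1%:R * ((X - 0) / s) ^+ d.
exists (ka * B + (1 + ka) * (X - 0 + X) ^+ d * H (X + X - 0)).
  have ka0 : 0 < ka by rewrite mulr_gt0// exprn_gt0// divr_gt0// subr0.
  have B0 : 0 < B by rewrite ltr_wpDl// divr_ge0// ltW.
  apply: ltr_pwDl; first exact: mulr_gt0.
  by rewrite mulr_ge0// mulr_ge0 ?exprn_ge0 ?addr_ge0 ?subr0 ?(ltW ka0) ?(ltW X0).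
move=> f g cf mg wfg fb gb t tI.
have mf : measurable_fun [set: R] f by exact: continuous_measurable_fun.
have dE : X = d.+1%:R * (2 * s).
  have sE : s * (2 * d.+1%:R) = X by rewrite /s divfK// gt_eqF.
  by rewrite -sE; ring.
have pick i : (i <= d)%N -> exists2 t, (2 * i)%:R * s <= t <= (2 * i)%:R * s + s & `|f t| <= B.
  move=> id; pose u := (2 * i)%:R * s.
  have u0 : 0 <= u by rewrite mulr_ge0// ltW.
  have uX : u + s <= X.
    have : i%:R <= d%:R :> R by rewrite ler_nat.
    rewrite dE /u natrM -natr1 => h; have := ler_wpM2r (ltW s0) h; lra.
  have us : u < u + s by lra.
  have uX2 : u + s <= 2 * X by lra.
  have [t' t'I ft'] := exists_le_mean cf us (HB f u (u + s) mf fb u0 (ltW us) uX2).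
  by exists t' => //; apply: (le_trans ft'); rewrite /B [u + s - u]addrC addKr.
have [z zP] : exists z : nat -> R, forall i, (i <= d)%N ->
    (2 * i)%:R * s <= z i <= (2 * i)%:R * s + s /\ `|f (z i)| <= B.
  have h i : exists t, (i <= d)%N -> (2 * i)%:R * s <= t <= (2 * i)%:R * s + s /\ `|f t| <= B.
    have [id|id] := boolP (i <= d)%N; last by exists 0.
    by have [t' t'1 t'2] := pick i id; exists t'.
  by have [z zP] := choice h; exists z.
have ig u v := weighted_ball_integrable lam_gt0 a_gt0 u v p_ge1 mg gb.
have zsep i k : (i <= d)%N -> (k <= d)%N -> i != k -> s <= `|z i - z k|.
  apply: separated_nodes => {}i {}k id kd ik; have [/andP[_ h1] _] := zP i id; have [/andP[h2 _] _] := zP k kd.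
  have : (i.+1)%:R <= k%:R :> R by rewrite ler_nat.
  rewrite -natr1 => h3; have := ler_wpM2r (ltW s0) h3.
  rewrite !natrM in h1 h2 => h4.
  by lra.
have zI i : (i <= d)%N -> 0 <= z i <= X.
  move=> id; have [/andP[h1 h2] _] := zP i id.
  have : i%:R <= d%:R :> R by rewrite ler_nat.
  move=> h; have := ler_wpM2r (ltW s0) h.
  have : 0 <= i%:R * s by rewrite mulr_ge0// ltW.
  by rewrite dE -natr1; rewrite !natrM in h1 h2; lra.
have := interpolation_bound cf ig wfg s0 X0 tI zsep zI (fun i id => (zP i id).2) (lexx ka).
move=> h; apply: (le_trans h); rewrite lerD2l ler_wpM2l//; last first.
  by apply: HB => //; rewrite -/X; lra.
have ka0 : 0 <= ka by rewrite mulr_ge0// exprn_ge0// divr_ge0 ?subr0 ?(ltW X0) ?(ltW s0).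
by rewrite mulr_ge0 ?exprn_ge0 ?addr_ge0 ?subr0 -/X ?(ltW X0).
Qed.

(** The recursion of [lp_bounded_recursion] with equality, used as a majorant. *)
Fixpoint half_recursion (V0 : R) (v : nat -> R) (j : nat) : R :=
  if j is i.+1 then 2^-1 * half_recursion V0 v i + v i else V0.

Lemma tail_cell_bound : exists La : R, exists C : R, [/\ 0 < La, 0 < C &
  forall f g, continuous f -> measurable_fun [set: R] g -> weak_derivative d.+1 f g ->
  weighted_ball lam a p f -> weighted_ball lam a p g ->
  exists V : nat -> R, [/\ forall j, 0 <= V j, lp_bounded p V C &
    forall j t, tail_mesh La j <= t <= tail_mesh La j.+1 ->
      `|f t| * w (tail_mesh La j) <= tail_step La j `^ (d.+1%:R - inve p) * V j]].
Proof.
(* Bounds the extrapolation from d + 1 equidistant nodes in cell j to cell j + 1. The second cell is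
   at most lam times as long as the first, since x_(j+2) - x_(j+1) <= m_(j+1) <= m_j <= lam (x_(j+1)
   - x_j); hence La does not enter. *)
pose ka : R := d.+1%:R * ((1 + lam) * d.+1%:R) ^+ d.
have lam2 : 0 < 1 + lam by rewrite addr_gt0.
have ka0 : 0 < ka by rewrite mulr_gt0// exprn_gt0// mulr_gt0.
(* The price of renormalising from m_j to m_(j+1): consecutive steps differ by a factor at most 2,
   and the power is at most d + 1. *)
pose rho : R := 2 ^+ d.+1.
have rho0 : 0 < rho by rewrite exprn_gt0.
(* Then exp (a La) >= 1 + a La exceeds 2 rho ka, so one step of the recursion contracts by 1/2. *)
pose La := (2 * rho * ka) / a.
have La0 : 0 < La by rewrite divr_gt0// mulr_gt0// mulr_gt0.
have decay : rho * (ka * expR (- (a * La))) <= 2^-1.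
  rewrite expRN mulrA ler_pdivrMr ?expR_gt0// ler_pdivlMl// mulrA.
  apply: le_trans (expR_ge1Dx _).
  by rewrite /La [a * _]mulrC divfK ?gt_eqF// lerDr.
(* Factors of the remainder: 1 + ka for the mass of the functional, 3^d for a window of three cells
   of length at most m_j, 2 from Hoelder's inequality, and the ratio of the weights at x_(j+1) and
   x_(j+3). *)
pose C5 := rho * ((1 + ka) * 3 ^+ d * (2 * expR (2 * (a * La)))).
have C50 : 0 < C5.
  by rewrite mulr_gt0// mulr_gt0 ?exprn_gt0// ?mulr_gt0 ?expR_gt0 ?exprn_gt0// addr_gt0.
have [C2 C20 HC2] := @lp_bounded_window R p 3 p_ge1.
have [K0 K00 HK0] := first_cell_bound La0.
pose x := tail_mesh La; pose m := tail_step La.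
pose th : R := d.+1%:R - inve p.
have /andP[ip0 ip1] := inv_exponent_le1 p_ge1.
have th0 : 0 <= th by rewrite subr_ge0 (le_trans ip1)// ler1n.
pose V0 := K0 / m 0%N `^ th.
have m0 j : 0 < m j by exact: tail_step_gt0.
have mth j : 0 < m j `^ th by rewrite powR_gt0.
have V00 : 0 < V0 by rewrite divr_gt0.
have K0' : 0 < V0 + C5 * C2 by rewrite addr_gt0// mulr_gt0.
exists La, (24 * (V0 + C5 * C2)); split => //; first by rewrite mulr_gt0.
move=> f g cf mg wfg fb gb.
have ig u v := weighted_ball_integrable lam_gt0 a_gt0 u v p_ge1 mg gb.
have xx j : x j <= x j.+1 by apply: ltW; exact: tail_mesh_lt.
pose dd j := cell_norm lam a p g (x j) (x j.+1).
have dd0 j : 0 <= dd j by exact: cell_norm_ge0.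
have ddB : lp_bounded p dd 1 by exact: cell_norm_bounded.
pose v j := C5 * \sum_(s < 3) dd (j + s)%N.
have v0 j : 0 <= v j by rewrite mulr_ge0 ?(ltW C50) ?sumr_ge0.
pose V := half_recursion V0 v.
have Vge j : 0 <= V j.
  by elim: j => [|j IH] /=; [exact: ltW|rewrite addr_ge0// mulr_ge0].
exists V; split => //.
  apply: (@lp_bounded_recursion _ _ _ v) => //.
  - exact: ltW.
  - by rewrite lerDl mulr_ge0 ?(ltW C50) ?(ltW C20).
  have vb : lp_bounded p v (C5 * (C2 * 1)).
    apply: lp_boundedZ => //; [exact: ltW|by rewrite mulr1 ltW|by move=> j; exact: sumr_ge0|].
    exact: HC2.
  apply: lp_boundedW vb => //; first by rewrite mulr1 mulr_ge0 ?(ltW C50) ?(ltW C20).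
  by rewrite mulr1 lerDr ltW.
have wE j s : w (x (j + s)%N) = w (x j) * expR (- (a * La)) ^+ s.
  rewrite !weight_tail_mesh// -expRM_natl -expRD; congr expR.
  by rewrite natrD; ring.
elim=> [|j IH] t tI.
  rewrite [leRHS](_ : _ = K0); last first.
    by rewrite [V 0%N]/= /V0 -/th -/(m 0%N) mulrC divfK ?gt_eqF.
  have tI' : 0 <= t <= x 1%N by move: tI; rewrite tail_mesh0.
  apply: le_trans (HK0 f g cf mg wfg fb gb t tI').
  by rewrite ler_piMr// weight_le1.
pose et := x j.+1 - x j.
have et0 : 0 < et by rewrite subr_gt0; exact: tail_mesh_lt.
pose s := et / d.+1%:R.
have s0 : 0 < s by rewrite divr_gt0.
have sE : d.+1%:R * s = et by rewrite mulrC divfK.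
pose z i := x j + i%:R * s.
have zb i : (i <= d)%N -> x j <= z i <= x j.+1.
  move=> id; rewrite lerDl mulr_ge0 ?(ltW s0)//= /z -lerBrDl -/et -sE ler_pM2r// ler_nat.
  exact: leqW.
have zI i : (i <= d)%N -> x j <= z i <= x j.+2.
  by move=> /zb /andP[-> h]/=; apply: (le_trans h).
have zsep i k : (i <= d)%N -> (k <= d)%N -> i != k -> s <= `|z i - z k|.
  apply: separated_nodes => {}i {}k id kd ik.
  have h : (i.+1)%:R <= k%:R :> R by rewrite ler_nat.
  have := ler_wpM2r (ltW s0) h; rewrite -natr1 => h'.
  by rewrite /z; lra.
have e0 : 0 < x j.+3 - x j.+2 by rewrite subr_gt0; exact: tail_mesh_lt.
have etm i : x i.+1 - x i <= m i by exact: tail_mesh_step_le.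
have mS i : m i.+1 <= m i by exact: tail_step_nonincreasing.
have ratio : d.+1%:R * ((x j.+2 - x j) / s) ^+ d <= ka.
  rewrite ler_pM2l// lerXn2r ?nnegrE//.
  - by rewrite divr_ge0 ?(ltW s0)// subr_ge0 (le_trans (xx j)).
  - by rewrite mulr_ge0// ltW.
  rewrite ler_pdivrMr// -mulrA sE.
  have h1 := tail_step_le_mesh La0 j.
  have h2 := etm j.+1; have h3 := mS j.
  have -> : x j.+2 - x j = (x j.+2 - x j.+1) + et by rewrite /et; ring.
  rewrite mulrDl mul1r addrC lerD2l; apply: (le_trans h2); exact: le_trans h3 h1.
have wj0 : 0 < w (x j) by exact: weight_gt0.
have fz i : (i <= d)%N -> `|f (z i)| <= m j `^ th * V j / w (x j).
  by move=> id; rewrite ler_pdivlMr//; apply: IH; exact: zb.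
have tI2 : x j <= t <= x j.+2.
  by move: tI => /andP[h ->]; rewrite andbT; apply: le_trans h.
have := interpolation_bound cf ig wfg s0 e0 tI2 zsep zI fz ratio.
rewrite (_ : x j.+2 + (x j.+3 - x j.+2) = x j.+3); last by ring.
rewrite (_ : x j.+2 - x j + (x j.+3 - x j.+2) = x j.+3 - x j); last by ring.
have := Rintegral_le_cells (s := j) (n := 3) ig xx (lexx _) (lexx _).
rewrite [(j + 3)%N]addnC/= -/(x j.+3) => IC ft.
have w30 : 0 < w (x j.+3) by exact: weight_gt0.
have cellb (i : 'I_3) : \int[mu]_(t in `[x (j + i)%N, x (j + i).+1]) `|g t| <=
    2 * (m j `^ (1 - inve p) * ((w (x j.+3))^-1 * dd (j + i)%N)).
  have wl t' : x (j + i)%N <= t' <= x (j + i).+1 -> w (x j.+3) <= w t'.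
    move=> /andP[h1 h2]; apply: le_weight => //.
    have t0 : 0 <= t' by apply: le_trans h1; exact: tail_mesh_ge0.
    rewrite !ger0_norm ?tail_mesh_ge0//; apply: (le_trans h2).
    case: i {h1 h2} => [[|[|[|//]]]] /= _; rewrite ?addn0 ?addn1 ?addn2//.
      by apply: (le_trans (xx _)).
  apply: (le_trans (cell_holder lam_gt0 a_gt0 p_ge1 mg gb (xx _) w30 wl)).
  rewrite ler_pM2l// ler_wpM2r ?mulr_ge0 ?invr_ge0 ?(ltW w30) ?cell_norm_ge0//.
  apply: ge0_ler_powR; rewrite ?nnegrE ?subr_ge0 ?(ltW (m0 _))//.
  apply: (le_trans (etm _)).
  case: i {wl} => [[|[|[|//]]]] /= _; rewrite ?addn0 ?addn1 ?addn2//.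
  by apply: (le_trans (mS _)).
have {}IC := le_trans IC (ler_sum _ (fun i _ => cellb i)).
rewrite -!mulr_sumr in IC.
set Sg := \sum_(i < 3) dd (j + i)%N in IC.
have Sg0 : 0 <= Sg by exact: sumr_ge0.
have len : (x j.+3 - x j) ^+ d <= (3 * m j) ^+ d.
  have h1 := etm j; have h2 := etm j.+1; have h3 := etm j.+2; have h4 := mS j; have h5 := mS j.+1.
  have xj3 : x j <= x j.+3 by rewrite (le_trans (xx _))// (le_trans (xx _)).
  rewrite lerXn2r ?nnegrE ?subr_ge0 ?(mulr_ge0 _ (ltW (m0 _)))//.
  by clear -h1 h2 h3 h4 h5; lra.
pose G := m j `^ th * (ka * expR (- (a * La)) * V j +
  (1 + ka) * 3 ^+ d * (2 * expR (2 * (a * La))) * Sg).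
have fG : `|f t| * w (x j.+1) <= G.
  have IC2 : (1 + ka) * (x j.+3 - x j) ^+ d * \int[mu]_(t in `[x j, x j.+3]) `|g t| <=
      (1 + ka) * (3 * m j) ^+ d *
      (2 * (m j `^ (1 - inve p) * ((w (x j.+3))^-1 * Sg))).
    have k0 : 0 <= 1 + ka by rewrite addr_ge0// ltW.
    have xj3 : x j <= x j.+3 by rewrite (le_trans (xx _))// (le_trans (xx _)).
    apply: ler_pM => //; first by rewrite mulr_ge0// exprn_ge0// subr_ge0.
      exact: Rintegral_ge0.
    by rewrite ler_wpM2l.
  apply: (le_trans (ler_wpM2r (ltW (weight_gt0 lam a (x j.+1))) (le_trans ft (lerD (lexx _) IC2)))).
  apply: le_of_eq.
  have thE : m j `^ th = m j ^+ d * m j `^ (1 - inve p).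
    rewrite -powR_mulrn ?(ltW (m0 _))// -gt0_powRD//.
    by rewrite /th -natr1; congr (_ `^ _); ring.
  have w1 := wE j 1%N; rewrite addn1 expr1 in w1.
  have w3 := wE j 3%N; rewrite addn3 in w3.
  have E0 : expR (- (a * La)) != 0 by rewrite gt_eqF ?expR_gt0.
  rewrite /G; have -> : expR (2 * (a * La)) = (expR (- (a * La)) ^+ 2)^-1.
    by rewrite -expRM_natl -expRN; congr expR; ring.
  rewrite w1 w3 thE [(3 * m j) ^+ d]exprMn; set E := expR _ in E0 *.
  have field_id (A B W V1 D S k : R) : W != 0 -> (k * (A * B * V1 / W) + (1 + k) * (D * A) *
      (2 * (B * ((W * E ^+ 3)^-1 * S)))) * (W * E) =
      A * B * (k * E * V1 + (1 + k) * D * (2 / E ^+ 2) * S).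
    by move=> W0; field; rewrite W0 E0.
  exact: field_id (lt0r_neq0 wj0).
apply: (le_trans fG); rewrite -/th -/m.
have mm : m j `^ th <= rho * m j.+1 `^ th.
  apply: (@le_trans _ _ ((2 * m j.+1) `^ th)).
    apply: ge0_ler_powR; rewrite ?nnegrE ?(mulr_ge0 _ (ltW (m0 _))) ?(ltW (m0 _))//.
    exact: tail_step_le2.
  rewrite powRM ?(ltW (m0 _))// ler_wpM2r ?(ltW (mth _))//.
  by rewrite /rho -powR_mulrn// ler_powR ?ler1n// lerBlDr lerDl.
have G0 : 0 <= ka * expR (- (a * La)) * V j +
    (1 + ka) * 3 ^+ d * (2 * expR (2 * (a * La))) * Sg.
  have k1 : 0 <= 1 + ka by rewrite addr_ge0// ltW.
  have h3 : 0 <= 3 ^+ d :> R by rewrite exprn_ge0.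
  have h2 : 0 <= 2 * expR (2 * (a * La)) by rewrite mulr_ge0// expR_ge0.
  apply: addr_ge0; last exact: mulr_ge0 (mulr_ge0 (mulr_ge0 k1 h3) h2) Sg0.
  exact: mulr_ge0 (mulr_ge0 (ltW ka0) (expR_ge0 _)) (Vge j).
apply: (le_trans (ler_wpM2r G0 mm)).
rewrite [rho * _]mulrC -[leLHS]mulrA; apply: (ler_wpM2l (ltW (mth _))).
rewrite mulrDr [V j.+1]/=; apply: lerD.
  by rewrite mulrA; apply: (ler_wpM2r (Vge j)).
by rewrite /v [leLHS]mulrA.
Qed.

(** With the length to the power 1/q, cell j carries m_j^E = La^(E/lam) (j + 1)^(-om E), to which
    [lp_bounded_tail] applies. The start J is free: 0 gives the embedding into L_q, and J of order m
    gives the rate. *)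
Lemma tail_estimate q : (1 <= q)%E -> 0 < rate_exponent lam p q d.+1 ->
  exists La : R, exists C : R, [/\ 0 < La, 0 < C &
  forall f g, continuous f -> measurable_fun [set: R] g -> weak_derivative d.+1 f g ->
  weighted_ball lam a p f -> weighted_ball lam a p g ->
  exists U : nat -> R, [/\ forall j, 0 <= U j,
    forall j t, tail_mesh La j <= t <= tail_mesh La j.+1 -> `|f t| * w t <= U j &
    forall J, lp_bounded q
      (fun i => (tail_mesh La (J + i).+1 - tail_mesh La (J + i)%N) `^ inve q *
                U (J + i)%N)
      (C * J.+1%:R `^ (- rate_exponent lam p q d.+1))]].
Proof.
move=> q1; rewrite rate_exponentE.
set E : R := d.+1%:R - inve p + inve q.
set sg := (if (p <= q)%E then _ else _) => rate0.
have [La [C [La0 C0 H]]] := tail_cell_bound.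
have /andP[ip0 ip1] := inv_exponent_le1 p_ge1.
have /andP[iq0 iq1] := inv_exponent_le1 q1.
have th0 : 0 <= d.+1%:R - inve p by rewrite subr_ge0 (le_trans ip1)// ler1n.
have E0 : 0 <= E by rewrite addr_ge0.
have omE0 : 0 <= (1 - lam^-1) * E by rewrite mulr_ge0.
(* For q < p the positive rate is exactly the summability of the weights. *)
have cond : (q < p)%E -> 1 < (1 - lam^-1) * E * (inve q - inve p)^-1.
  move=> qp; move: rate0; rewrite /sg leNgt qp/= => h.
  by rewrite ltr_pdivlMr ?subr_gt0 ?inv_exponent_lt// mul1r; lra.
have [C1 C10 H1] := lp_bounded_tail p_ge1 q1 omE0 cond.
exists La, (La `^ (lam^-1 * E) * (C1 * C)); split => //.
  by rewrite mulr_gt0 ?powR_gt0// mulr_gt0.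
move=> f g cf mg wfg fb gb; have [V [V0 VC fV]] := H f g cf mg wfg fb gb.
pose m := tail_step La.
have m0 j : 0 < m j by exact: tail_step_gt0.
exists (fun j => m j `^ (d.+1%:R - inve p) * V j); split.
- by move=> j; rewrite mulr_ge0 ?powR_ge0.
- move=> j t tI; apply: le_trans (fV j t tI); rewrite ler_wpM2l//.
  move: tI => /andP[xt _]; apply: le_weight => //.
  by rewrite !ger0_norm ?tail_mesh_ge0//; apply: le_trans xt; exact: tail_mesh_ge0.
move=> J; pose v i := (J + i).+1%:R `^ (- ((1 - lam^-1) * E)) * V (J + i)%N.
have v0 i : 0 <= v i by rewrite mulr_ge0 ?powR_ge0.
apply: (@le_lp_bounded _ _ (fun i => La `^ (lam^-1 * E) * v i)) => //.
  move=> i; set j := (J + i)%N.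
  have et0 : 0 <= tail_mesh La j.+1 - tail_mesh La j by rewrite subr_ge0 ltW// tail_mesh_lt.
  rewrite mulr_ge0 ?powR_ge0 ?mulr_ge0 ?powR_ge0//= mulrA /v -/j [leRHS]mulrA.
  rewrite ler_wpM2r//; apply: (@le_trans _ _ (m j `^ E)).
    rewrite /E [_ + inve q]addrC [leRHS]gt0_powRD//.
    rewrite ler_wpM2r ?powR_ge0//.
    apply: ge0_ler_powR; rewrite ?nnegrE ?(ltW (m0 _))//.
    exact: tail_mesh_step_le.
  rewrite /m /tail_step powRM ?powR_ge0// -!powRrM.
  by apply: le_of_eq; congr (_ * _ `^ _); ring.
rewrite -!mulrA; apply: lp_boundedZ => //; rewrite ?powR_ge0//.
  by rewrite mulr_ge0 ?(ltW C10)// mulr_ge0 ?powR_ge0 ?(ltW C0).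
rewrite [C * _]mulrC mulrA; have := H1 J V C C0 V0 VC.
by rewrite /sg; case: ifP => _; rewrite ?subr0.
Qed.

End TailEstimate.

(** * Upper bound *)

Section Reflection.
Context {R : realType}.
Local Notation mu := (@lebesgue_measure R).

Lemma measurable_reflect d (T : measurableType d) (F : R -> T) :
  measurable_fun [set: R] F -> measurable_fun [set: R] (fun x => F (- x)).
Proof. by move=> mF; exact: (measurableT_comp mF). Qed.

Lemma ge0_integral_reflect (F : R -> \bar R) : measurable_fun [set: R] F ->
  (forall x, 0 <= F x)%E -> (\int[mu]_x F (- x)%R = \int[mu]_x F x)%E.
Proof.
move=> mF F0.
rewrite -[RHS](_ : \int[pushforward mu (-%R : _ -> measurableTypeR R)]_x F x = _)%E; last first.
  by apply: eq_measure_integral => A mA _; exact: lebesgue_measureN.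
by rewrite ge0_integral_pushforward// preimage_setT.
Qed.

Lemma Rintegral_reflect (F : R -> R) : measurable_fun [set: R] F ->
  \int[mu]_x F (- x) = \int[mu]_x F x.
Proof.
move=> mF; rewrite /Rintegral; congr fine; rewrite integralE [RHS]integralE.
have mF' : measurable_fun [set: R] (EFin \o F) by exact/measurable_EFinP.
congr (_ - _)%E.
- rewrite -[RHS]ge0_integral_reflect//.
    by apply: eq_integral => x _; rewrite !funeposE.
  exact: measurable_funepos.
- rewrite -[RHS]ge0_integral_reflect//.
    by apply: eq_integral => x _; rewrite !funenegE.
  exact: measurable_funeneg.
Qed.

(** Only a sign is pulled out, so no integrability is required: negation swaps the positive and
    negative parts. *)
Lemma Rintegral_sign k (F : R -> R) :
  \int[mu]_x ((- 1) ^+ k * F x) = (- 1) ^+ k * \int[mu]_x F x.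
Proof.
rewrite -signr_odd; case: (odd k); last first.
  by rewrite expr0 mul1r; apply: eq_Rintegral => x _; rewrite mul1r.
rewrite expr1 mulN1r; under eq_Rintegral do rewrite mulN1r.
rewrite /Rintegral integralE [in RHS]integralE.
have -> : ((fun x => (- F x)%:E)^\+ = (fun x => (F x)%:E)^\-)%E.
  by apply/funext => x; rewrite funeposE funenegE.
have -> : ((fun x => (- F x)%:E)^\- = (fun x => (F x)%:E)^\+)%E.
  by apply/funext => x; rewrite funeposE funenegE -EFinN opprK.
case: (integral _ _ _) => [u| |]; case: (integral _ _ _) => [v| |] //=; rewrite ?oppr0//.
by rewrite opprB.
Qed.

Lemma test_function_reflect (phi : R -> R) : test_function phi ->
  test_function (fun x => phi (- x)).
Proof.
move=> [sphi [A HA]]; split; last by exists A => x Ax; apply: HA; rewrite normrN.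
have := @smooth_affine R phi (- 1) 0 sphi; rewrite /smooth.
by under eq_fun do rewrite mulN1r addr0.
Qed.

Lemma weak_derivative_reflect k (f g : R -> R) : measurable_fun [set: R] f ->
  measurable_fun [set: R] g -> weak_derivative k f g ->
  weak_derivative k (fun x => f (- x)) (fun x => (- 1) ^+ k * g (- x)).
Proof.
move=> mf mg wfg phi tphi.
have [sphi _] := tphi.
have mphi j : measurable_fun [set: R] (derive1n j phi).
  by apply: continuous_measurable_fun; exact: smooth_continuous.
have tphi' := test_function_reflect tphi.
have dphi' x : derive1n k (fun x => phi (- x)) x = (- 1) ^+ k * derive1n k phi (- x).
  have := @derive1n_affine R phi (- 1) 0 k sphi => /(congr1 (fun F => F x)).
  by under eq_fun do rewrite mulN1r addr0; rewrite mulN1r addr0.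
have e1 : \int[mu]_x (f (- x) * derive1n k phi x) =
    \int[mu]_x (f x * derive1n k phi (- x)).
  rewrite -(@Rintegral_reflect (fun x => f (- x) * derive1n k phi x)).
    by apply: eq_Rintegral => x _; rewrite opprK.
  apply: measurable_funM; [exact: measurable_reflect|exact: mphi].
have e2 : \int[mu]_x ((- 1) ^+ k * g (- x) * phi x) =
    \int[mu]_x ((- 1) ^+ k * (g x * phi (- x))).
  rewrite -(@Rintegral_reflect (fun x => (- 1) ^+ k * g (- x) * phi x)).
    by apply: eq_Rintegral => x _; rewrite opprK mulrA.
  apply: measurable_funM; last exact: (mphi 0%N).
  by apply: measurable_funM => //; exact: measurable_reflect.
rewrite e1 e2 !Rintegral_sign.
have := wfg _ tphi'.
under [LHS]eq_Rintegral do rewrite dphi' mulrCA.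
rewrite Rintegral_sign => h.
rewrite -h signrMK.
by [].
Qed.
End Reflection.

(** * Both half-lines together, and the error of the truncated operators *)

Section TwoSided.
Context {R : realType}.
Local Notation mu := (@lebesgue_measure R).
Variables (lam a : R) (p q : \bar R) (d : nat).
Hypotheses (lam_gt1 : 1 < lam) (a_gt0 : 0 < a) (p_ge1 : (1 <= p)%E) (q_ge1 : (1 <= q)%E).
Hypothesis rate_gt0 : 0 < rate_exponent lam p q d.+1.
Local Notation w := (weight lam a).
Local Notation rate := (rate_exponent lam p q d.+1).

Let lam_gt0 : 0 < lam.
Proof. exact: lt_trans lam_gt1. Qed.

Lemma weighted_ball_reflect (g : R -> R) k : measurable_fun [set: R] g ->
  weighted_ball lam a p g -> weighted_ball lam a p (fun x => (- 1) ^+ k * g (- x)).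
Proof.
have gw t : `|(- 1) ^+ k * g (- t) * w t| = `|g (- t) * w (- t)|.
  by rewrite -mulrA normrMsign weightN.
move=> mg; rewrite /weighted_ball; case: p => [x| |]; last 2 first.
- by move=> h t; rewrite gw.
- by move=> h t; rewrite gw.
rewrite -(ge0_integral_reflect (F := fun t => (`|g t * w t| `^ x)%:E)).
- by move=> h; under eq_integral do rewrite gw.
- exact: measurable_weighted_powR.
- by move=> t; rewrite lee_fin powR_ge0.
Qed.

Lemma mem_some_cell (y : nat -> R) n (x : R) : (0 < n)%N -> y 0%N <= x <= y n ->
  exists2 i, (i < n)%N & y i <= x <= y i.+1.
Proof.
elim: n => [//|n IH] _ /andP[x0 xn].
case: n => [|n] in IH xn *; first by exists 0%N => //; rewrite x0.
have [xy|yx] := leP x (y n.+1); last by exists n.+1 => //; rewrite (ltW yx).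
have [|i im xi] := IH (ltn0Sn n); first by rewrite x0.
by exists i => //; exact: leqW.
Qed.

Lemma mem_tail_cell La J (x : R) : 0 < La -> tail_mesh lam La J <= x ->
  exists i, tail_mesh lam La (J + i)%N <= x <= tail_mesh lam La (J + i).+1.
Proof.
move=> La0 Jx.
have x0 : 0 <= x by apply: le_trans Jx; exact: tail_mesh_ge0.
pose n := (Num.truncn (x `^ lam / La)).+1.
have xn : x <= tail_mesh lam La (J + n)%N.
  have xE : x = (x `^ lam) `^ lam^-1 by rewrite -powRrM mulfV ?powRr1 ?gt_eqF.
  rewrite xE; apply: ge0_ler_powR; rewrite ?nnegrE ?invr_ge0 ?powR_ge0 ?mulr_ge0 ?(ltW La0) ?(ltW lam_gt0)//.
  rewrite mulrC -ler_pdivrMr//; apply: ltW.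
  apply: (lt_le_trans (truncnS_gt _)); rewrite ler_nat -/n; lia.
have [|i _ xi] := @mem_some_cell (fun i => tail_mesh lam La (J + i)%N) n x isT.
  by rewrite addn0 Jx.
by exists i; rewrite addnS in xi.
Qed.

Lemma two_sided_tail : exists La : R, exists C : R, [/\ 0 < La, 0 < C &
  forall f, sobolev_ball lam a d.+1 p f ->
  exists U : bool -> nat -> R, [/\ forall b j, 0 <= U b j,
    forall (b : bool) j t, tail_mesh lam La j <= t <= tail_mesh lam La j.+1 ->
      `|f ((- 1) ^+ b * t)| * w t <= U b j &
    forall b J, lp_bounded q
      (fun i => (tail_mesh lam La (J + i).+1 - tail_mesh lam La (J + i)%N) `^ inve q *
                U b (J + i)%N) (C * J.+1%:R `^ (- rate))]].
Proof.
have [La [C [La0 C0 H]]] := tail_estimate lam_gt1 a_gt0 p_ge1 q_ge1 rate_gt0.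
exists La, C; split => // f fB.
have [g [cf mg wfg fb gb]] := sobolev_ball_data p_ge1 fB.
have mf : measurable_fun [set: R] f by exact: continuous_measurable_fun.
have [U1 [U10 fU1 U1b]] := H f g cf mg wfg fb gb.
have cf' : continuous (fun x => f (- x)).
  by move=> x; apply: continuous_comp; [exact: oppr_continuous|exact: cf].
have [||||U2 [U20 fU2 U2b]] := H (fun x => f (- x)) (fun x => (- 1) ^+ d.+1 * g (- x)) cf'.
- by apply: measurable_funM => //; exact: measurable_reflect.
- exact: weak_derivative_reflect.
- by have := weighted_ball_reflect 0 mf fb; under eq_fun do rewrite expr0 mul1r.
- exact: weighted_ball_reflect.
exists (fun b => if b then U2 else U1); split => -[]//= j t tI.
- by rewrite expr1 mulN1r; exact: fU2.
- by rewrite expr0 mul1r; exact: fU1.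
Qed.

(** Bounds the error of the zero algorithm, which settles the widths for those n with no admissible
    m. *)
Lemma sobolev_ball_wnorm_bounded : exists2 C : R, 0 < C &
  forall f, sobolev_ball lam a d.+1 p f -> (wnorm lam a q f <= C%:E)%E.
Proof.
have [La [C [La0 C0 H]]] := two_sided_tail.
exists (2%:R * C); first by rewrite mulr_gt0.
move=> f fB; have [U [U0 fU UB]] := H f fB.
have [g [cf _ _ _ _]] := sobolev_ball_data p_ge1 fB.
have mf : measurable_fun [set: R] f by exact: continuous_measurable_fun.
pose x := tail_mesh lam La.
have xx j : x j <= x j.+1 by apply: ltW; exact: tail_mesh_lt.
pose l (b i : nat) := if b == 0%N then x i else - x i.+1.
pose r (b i : nat) := if b == 0%N then x i.+1 else - x i.
apply: (@wnorm_le_cells _ lam a q 2 f l r (fun b => U (b != 0%N))) => //.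
- exact: ltW.
- by move=> b i; rewrite /l /r; case: ifP => // _; rewrite lerN2.
- move=> t; have [t0|t0] := leP 0 t.
    have [|i] := @mem_tail_cell La 0%N t La0; first by rewrite tail_mesh0.
    rewrite add0n => ti.
    exists 0%N, i; split => //; rewrite normrM (gtr0_norm (weight_gt0 _ _ _)).
    by have := fU false i t ti; rewrite expr0 mul1r.
  have [|i] := @mem_tail_cell La 0%N (- t) La0; first by rewrite tail_mesh0// oppr_ge0 ltW.
  rewrite add0n => ti.
  exists 1%N, i; split => //.
    by move: ti => /andP[h1 h2]; rewrite /l /r/=; apply/andP; split; rewrite -[t]opprK lerN2.
  rewrite normrM (gtr0_norm (weight_gt0 _ _ _)).
  by have := fU true i (- t) ti; rewrite expr1 mulN1r opprK weightN.
- move=> b b2; have := UB (b != 0%N) 0%N.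
  rewrite powR1 mulr1 => h; move: h; congr (lp_bounded q _ _).
  apply/funext => i; rewrite add0n; congr (_ `^ _ * _).
  by rewrite /l /r; case: ifP => // _; rewrite /x; ring.
Qed.

Definition truncated_node K (h : R) (m : nat) (j : nat) : R := (j%:Z - (m + K)%:Z)%:~R * h.

Definition truncated_weight (k : int -> R -> R) (K : nat) (T h : R) (m : nat) (j : nat) (x : R) : R :=
  (`|x| <= T)%R%:R * k (j%:Z - (m + K)%:Z : int) (x / h).

Lemma truncated_opE A k N K C rho (m : nat) f x : has_kernel A k N K C -> (0 < m)%N ->
  0 < rho * MRS_const lam ->
  truncated_op A lam rho m f x = \sum_(j < (2 * (m + K)).+1)
    f (truncated_node K (mesh lam rho m) m j) *
    truncated_weight k K (rho * MRS_number lam m) (mesh lam rho m) m j x.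
Proof.
move=> [AE _ kK _ _] m0 c0; rewrite /truncated_op /truncated_weight.
have M0 : 0 < m%:R :> R by rewrite ltr0n.
set T := rho * _; set h := mesh _ _ _.
have T0 : 0 < T by rewrite /T /MRS_number mulrA mulr_gt0// powR_gt0.
have hE : h = T / m%:R by [].
have h0 : 0 < h by rewrite hE divr_gt0.
case: ifPn => xT; last by rewrite big1// => j _; rewrite mul0r mulr0.
have xm : `|x / h| <= m%:R.
  by rewrite normrM normfV (gtr0_norm h0) ler_pdivrMr// hE mulrC divfK ?gt_eqF.
rewrite /scaled_op/= /dilation AE.
rewrite (@lattice_sumE _ [seq j%:Z - (m + K)%:Z | j <- index_iota 0 (2 * (m + K)).+1]).
- rewrite big_map big_mkord; apply: eq_bigr => j _; rewrite mul1r invrK.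
  by rewrite /truncated_node.
- by rewrite map_inj_uniq ?iota_uniq// => i j /eqP; rewrite (inj_eq (addIr _)) => /eqP[].
move=> i; rewrite mulf_eq0 negb_or => /andP[_ ki].
have := kK m i _ xm ki => iK.
have nE : (absz (i + (m + K)%:Z))%:Z = i + (m + K)%:Z by clear -iK; lia.
apply/mapP; exists (absz (i + (m + K)%:Z)); last by rewrite nE addrK.
by rewrite mem_index_iota; clear -iK; lia.
Qed.

Lemma measurable_truncated_op A k N K C rho (m : nat) f : has_kernel A k N K C -> (0 < m)%N ->
  0 < rho * MRS_const lam -> measurable_fun [set: R] (truncated_op A lam rho m f).
Proof.
move=> HA m0 c0.
rewrite (funext (fun x => truncated_opE f x HA m0 c0)).
have [_ _ _ kc _] := HA.
apply: measurable_sum => j; apply: measurable_funM => //.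
apply: measurable_funM.
  rewrite (_ : (fun x => _) = \1_(`[- (rho * MRS_number lam m), rho * MRS_number lam m]%classic)).
    exact: measurable_indic.
  apply/funext => x; rewrite indicE; congr (nat_of_bool _)%:R.
  by rewrite mem_setE in_itv/= ler_norml.
apply: (measurableT_comp (continuous_measurable_fun (kc _))).
exact: measurable_funM.
Qed.

Lemma truncated_error A k N K C rho : has_kernel A k N K C -> reproduces A d.+1 ->
  0 < rho * MRS_const lam ->
  exists2 Cst : R, 0 < Cst & forall (m : nat) f, (0 < m)%N ->
    sobolev_ball lam a d.+1 p f ->
    (wnorm lam a q (f \- truncated_op A lam rho m f)%R <= (Cst * m%:R `^ (- rate))%:E)%E.
Proof.
move=> HA repA; set c0 := rho * _ => c00.
have [La [C1 [La0 C10 H1]]] := two_sided_tail.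
have [C2 C20 H2] := central_estimate lam_gt1 a_gt0 p_ge1 q_ge1 HA repA c00.
pose b0 := c0 `^ lam / La.
have b00 : 0 < b0 by rewrite divr_gt0// powR_gt0.
pose C3 := C1 * b0 `^ (- rate).
have C30 : 0 < C3 by rewrite mulr_gt0// powR_gt0.
exists (3%:R * (C2 + C3)); first by rewrite mulr_gt0// addr_gt0.
move=> m f m0 fB.
have M0 : 0 < m%:R :> R by rewrite ltr0n.
have [g [cf _ _ _ _]] := sobolev_ball_data p_ge1 fB.
have [U [U0 fU UB]] := H1 f fB.
have [u [u0 fu uB]] := H2 m f m0 fB.
pose T := c0 * m%:R `^ lam^-1; pose h := T / m%:R.
rewrite -/T -/h in fu uB.
have TE : rho * MRS_number lam m = T by rewrite /T /MRS_number mulrA.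
have hE : mesh lam rho m = h by rewrite /mesh TE.
have T0 : 0 < T by rewrite mulr_gt0// powR_gt0.
have h0 : 0 < h by rewrite divr_gt0.
have hm : m%:R * h = T by rewrite /h mulrC divfK ?gt_eqF.
have TL : T `^ lam = c0 `^ lam * m%:R.
  by rewrite /T powRM ?powR_ge0 ?(ltW c00)// -powRrM mulVf ?powRr1 ?gt_eqF.
pose x := tail_mesh lam La.
have xx j : x j <= x j.+1 by apply: ltW; exact: tail_mesh_lt.
(* The last tail node x_J not beyond T: the tail cells from J on cover everything outside [-T, T],
   where the error is f itself. As T^lam is proportional to m, J + 1 is at least b0 m. *)
pose J := Num.truncn (T `^ lam / La).
have TLa0 : 0 <= T `^ lam / La by rewrite divr_ge0 ?powR_ge0 ?(ltW La0).
have /andP[J1 J2] := truncn_itv TLa0; rewrite -/J in J1 J2.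
have xJ : x J <= T.
  rewrite [leRHS](_ : T = (T `^ lam) `^ lam^-1); last first.
    by rewrite -powRrM mulfV ?powRr1 ?gt_eqF// ltW.
  apply: ge0_ler_powR; rewrite ?nnegrE ?invr_ge0 ?powR_ge0 ?mulr_ge0 ?(ltW La0) ?(ltW lam_gt0)//.
  by rewrite mulrC -ler_pdivlMr.
have Jm : b0 * m%:R <= J.+1%:R.
  by rewrite /b0 mulrAC -TL; exact: ltW.
have Jrate : C1 * J.+1%:R `^ (- rate) <= C3 * m%:R `^ (- rate).
  rewrite /C3 -mulrA ler_pM2l// -powRM ?(ltW b00)// !powRN.
  rewrite lef_pV2 ?posrE ?powR_gt0 ?(mulr_gt0 b00 M0)//.
  by apply: ge0_ler_powR; rewrite ?nnegrE ?(ltW (mulr_gt0 b00 M0)) ?(ltW rate_gt0).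
(* Family 0 is the centre, 1 the right tail, 2 the left tail. *)
pose l (b i : nat) :=
  match b with 0%N => - T + i%:R * h | 1%N => x (J + i)%N | _ => - x (J + i).+1 end.
pose r (b i : nat) :=
  match b with 0%N => - T + i.+1%:R * h | 1%N => x (J + i).+1 | _ => - x (J + i)%N end.
pose v (b i : nat) :=
  match b with 0%N => u i | 1%N => U false (J + i)%N | _ => U true (J + i)%N end.
rewrite -mulrA; apply: (@wnorm_le_cells _ lam a q 3 _ l r v) => //.
- apply: measurable_funB; first exact: continuous_measurable_fun.
  exact: measurable_truncated_op HA m0 c00.
- by rewrite mulr_ge0 ?powR_ge0 ?addr_ge0 ?ltW.
- case=> [|[|b]] i; rewrite /l /r ?lerN2//.
  by rewrite lerD2l ler_wpM2r ?(ltW h0)// ler_nat.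
- by case=> [|[|b]] i; [exact: u0|exact: U0|exact: U0].
- move=> t; rewrite normrM (gtr0_norm (weight_gt0 _ _ _))/= /truncated_op TE hE.
  case: ifPn => tT.
    have [||i im ti] := @mem_some_cell (fun i => - T + i%:R * h) (2 * m) t.
    + by rewrite muln_gt0.
    + move: tT; rewrite ler_norml mul0r addr0 => /andP[-> tT]/=.
      by rewrite natrM -mulrA hm [leRHS](_ : _ = T)//; ring.
    by exists 0%N, i; split => //; exact: fu.
  rewrite subr0; move: tT; rewrite -ltNge => tT.
  have [t0|t0] := leP 0 t.
    rewrite (ger0_norm t0) in tT.
    have [|i ti] := @mem_tail_cell La J t La0; first exact: le_trans xJ (ltW tT).
    exists 1%N, i; split => //.
    by have := fU false _ t ti; rewrite expr0 mul1r.
  rewrite (ltr0_norm t0) in tT.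
  have [|i ti] := @mem_tail_cell La J (- t) La0; first exact: le_trans xJ (ltW tT).
  exists 2%N, i; split => //.
    by move: ti => /andP[h1 h2]; rewrite /l /r/=; apply/andP; split; rewrite -[t]opprK lerN2.
  by have := fU true _ (- t) ti; rewrite expr1 mulN1r opprK weightN.
have Cb C' i : 0 < C' -> C' <= C2 + C3 -> 0 <= C' * m%:R `^ (- rate) <= (C2 + C3) * m%:R `^ (- rate).
  by move=> C'0 C'C; rewrite mulr_ge0 ?powR_ge0 ?(ltW C'0)// ler_wpM2r ?powR_ge0.
have tailb b : lp_bounded q (fun i => (x (J + i).+1 - x (J + i)%N) `^ inve q *
    U b (J + i)%N) ((C2 + C3) * m%:R `^ (- rate)).
  apply: lp_boundedW (UB b J) => //; first by rewrite mulr_ge0 ?powR_ge0 ?ltW.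
  by apply: (le_trans Jrate); rewrite ler_wpM2r ?powR_ge0// lerDr ltW.
case=> [|[|[|//]]] _.
- have cE i : r 0%N i - l 0%N i = h by rewrite /r /l -natr1; ring.
  under [X in lp_bounded q X]eq_fun do rewrite cE.
  apply: lp_boundedW uB => //; first by rewrite mulr_ge0 ?powR_ge0 ?ltW.
  by rewrite ler_wpM2r ?powR_ge0// lerDl ltW.
- exact: tailb.
- have cE i : r 2%N i - l 2%N i = x (J + i).+1 - x (J + i)%N by rewrite /r /l; ring.
  under [X in lp_bounded q X]eq_fun do rewrite cE.
  exact: tailb.
Qed.

End TwoSided.

(** * Lower bound *)

Section SmoothWeakDerivatives.
Context {R : realType}.
Local Notation mu := (@lebesgue_measure R).

Lemma derive1n_supported (phi : R -> R) A k : (forall x, A < `|x| -> phi x = 0) ->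
  forall x, A < `|x| -> derive1n k phi x = 0.
Proof.
move=> phi0 x Ax; rewrite (@derive1n_eq_on _ [set x | A < `|x|] _ (horner 0))//.
- by rewrite derive1n_horner linear0 horner0.
- have -> : [set x : R | A < `|x|] = (fun x => `|x|) @^-1` [set y | A < y] by [].
  by apply: open_comp => // y _; exact: norm_continuous.
- by move=> y /= Ay; rewrite phi0// horner0.
Qed.

Lemma integration_by_parts_smooth (f phi : R -> R) : smooth f -> test_function phi ->
  \int[mu]_x (f x * derive1 phi x) = - \int[mu]_x (derive1 f x * phi x).
Proof.
move=> sf [sphi [A phi0]].
pose B := `|A| + 1; have A0 := ler_norm A; have A1 := normr_ge0 A.
have out x : x < - B \/ B < x -> A < `|x|.
  by rewrite /B ltr_normr => -[h|h]; apply/orP; [right|left]; lra.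
have phi1 : forall x, A < `|x| -> derive1 phi x = 0 := derive1n_supported 1 phi0.
have cM (u v : R -> R) : continuous u -> continuous v -> continuous (fun x => u x * v x).
  by move=> cu cv x; exact: cvgM (cu x) (cv x).
have cf k := @smooth_continuous _ f k sf; have cphi k := @smooth_continuous _ phi k sphi.
have c1 : continuous (fun x => derive1 f x * phi x) by exact: cM (cf 1%N) (cphi 0%N).
have c2 : continuous (fun x => f x * derive1 phi x) by exact: cM (cf 0%N) (cphi 1%N).
have := @Rintegral_ftc _ (fun x => f x * phi x) (fun x => derive1 f x * phi x + f x * derive1 phi x)
  (- B) B.
rewrite [phi B]phi0 ?[phi (- B)]phi0 ?normrN ?(ger0_norm (addr_ge0 A1 ler01)); last 2 first.
- by rewrite /B; lra.
- by rewrite /B; lra.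
rewrite !mulr0 subrr => ftc.
have {ftc} : \int[mu]_(x in `[- B, B]) (derive1 f x * phi x + f x * derive1 phi x) = 0.
  apply: ftc; first by rewrite /B; lra.
    by move=> x; apply: (@cvgD _ R _ _ _ (fun x => derive1 f x * phi x)
      (fun x => f x * derive1 phi x)); [exact: c1|exact: c2].
  move=> x; apply: is_derive_eq.
    exact: is_deriveM (smooth_is_derive x sf) (smooth_is_derive x sphi).
  by rewrite /GRing.scale/= addrC mulrC.
rewrite RintegralD//; [|exact: continuous_integrable..].
rewrite -(Rintegral_supported (f := fun x => derive1 f x * phi x)); last first.
  by move=> x /out Ax; rewrite phi0// mulr0.
rewrite -(Rintegral_supported (f := fun x => f x * derive1 phi x)); last first.
  by move=> x /out Ax; rewrite phi1// mulr0.
by move=> h; lra.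
Qed.

Lemma test_function_derive1 (phi : R -> R) : test_function phi -> test_function (derive1 phi).
Proof.
move=> [sphi [A phi0]]; split; first exact: (@smoothW _ phi 1 sphi).
by exists A => x Ax; exact: (derive1n_supported 1 phi0).
Qed.

Lemma weak_derivative_smooth k (f : R -> R) : smooth f -> weak_derivative k f (derive1n k f).
Proof.
elim: k => [|k IH] sf phi tphi; first by rewrite expr0 mul1r.
rewrite (derive1Sn phi).
rewrite (IH sf _ (test_function_derive1 tphi)) integration_by_parts_smooth//; last exact: smoothW.
by rewrite exprS mulN1r mulNr mulrN.
Qed.

(** It lives on [1/4, 3/4]; the margin inside [0, 1] makes all derivatives vanish up to and
    including the ends of a cell. *)
Definition bump (s : R) : R := flat_exp 1 (1 * s + - 4^-1) * flat_exp 1 (- 1 * s + 3 / 4).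

Lemma smooth_bump : smooth bump.
Proof. by apply: smoothM; apply: smooth_affine; exact: smooth_flat_exp. Qed.

Lemma flat_exp_le0 p (s : R) : s <= 0 -> flat_exp p s = 0.
Proof. by rewrite /flat_exp => ->. Qed.

Lemma bump0 k (s : R) : s <= 0 \/ 1 <= s -> derive1n k bump s = 0.
Proof.
move=> s01.
have aux (U : set R) : open U -> U s -> (forall x, U x -> bump x = 0) -> derive1n k bump s = 0.
  move=> oU Us U0; rewrite (@derive1n_eq_on _ U _ (horner 0))//.
    by rewrite derive1n_horner linear0 horner0.
  by move=> x /U0 ->; rewrite horner0.
case: s01 => s01.
  apply: (aux [set x | x < 4^-1]) => /=; [exact: open_lt|by lra|].
  by move=> x /= x4; rewrite /bump flat_exp_le0 ?mul0r//; lra.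
apply: (aux [set x | 3 / 4 < x]) => /=; [exact: open_gt|by lra|].
by move=> x /= x4; rewrite /bump [X in _ * X]flat_exp_le0 ?mulr0//; lra.
Qed.

Lemma bump_bounded r : exists2 M : R, 0 < M &
  forall k s, (k <= r)%N -> `|derive1n k bump s| <= M.
Proof.
have bnd k : exists2 M : R, 0 <= M & forall s, `|derive1n k bump s| <= M.
  have cn : {within `[(0:R), 1], continuous (fun s => `|derive1n k bump s|)}.
    apply: continuous_subspaceT => x.
    exact: (cvg_norm (@smooth_continuous _ bump k smooth_bump x)).
  have [c _ cmax] := EVT_max ler01 cn.
  exists `|derive1n k bump c| => // s.
  have [s0|s0] := leP s 0; first by rewrite bump0 ?normr0//; left.
  have [s1|s1] := leP s 1; first by apply: cmax; rewrite in_itv/= (ltW s0).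
  by rewrite bump0 ?normr0//; right; exact: ltW.
elim: r => [|r [M M0 HM]].
  have [M M0 HM] := bnd 0%N; exists (M + 1); first by rewrite ltr_wpDl.
  by move=> k s; rewrite leqn0 => /eqP ->; apply: (le_trans (HM s)); rewrite lerDl.
have [M' M'0 HM'] := bnd r.+1; exists (M + M'); first by rewrite ltr_pwDl.
move=> k s; rewrite leq_eqVlt ltnS => /orP[/eqP ->|kr].
  by apply: (le_trans (HM' s)); rewrite lerDr ltW.
by apply: (le_trans (HM k s kr)); rewrite lerDl.
Qed.

Lemma flat_exp1_ge (s t : R) : 0 < t -> t <= s -> expR (- t^-1) <= flat_exp 1 s.
Proof.
move=> t0 ts; have s0 : 0 < s by exact: lt_le_trans ts.
by rewrite /flat_exp [s <= 0]leNgt s0/= hornerC mul1r ler_expR lerN2 lef_pV2.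
Qed.

Lemma bump_ge (s : R) : 3 / 8 <= s <= 5 / 8 -> expR (- 8^-1^-1) ^+ 2 <= bump s.
Proof.
move=> /andP[s1 s2]; rewrite expr2 /bump; apply: ler_pM; rewrite ?expR_ge0//.
  by apply: flat_exp1_ge; lra.
by apply: flat_exp1_ge; lra.
Qed.

Lemma wnorm_ge_cells (lam a : R) (q : \bar R) (F : R -> R) (G : seq R) (h ka : R) :
  (1 <= q)%E -> measurable_fun [set: R] F -> uniq G -> (0 < size G)%N -> 0 < h -> 0 < ka ->
  (forall x y t, x \in G -> y \in G -> x <= t <= x + h -> y <= t <= y + h -> x = y) ->
  (forall x t, x \in G -> x <= t <= x + h -> ka <= `|F t * weight lam a t|) ->
  ((((size G)%:R * h) `^ inve q * ka)%:E <= wnorm lam a q F)%E.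
Proof.
move=> q1 mF uG G0 h0 ka0 disj FG.
case: q q1 => [y| |]//= q1; rewrite ?lee_fin in q1; last first.
  rewrite powRr0 mul1r; case: G G0 FG {uG disj} => [//|x G] _ FG.
  apply: (@le_trans _ _ `|F x * weight lam a x|%:E).
    by rewrite lee_fin; apply: (FG x); rewrite ?mem_head// lexx lerDl ltW.
  by apply: ereal_sup_ubound; exists x.
have y0 : 0 < y by lra.
case: ifP => _; last by rewrite leey.
rewrite unlock.
have -> : (((size G)%:R * h) `^ y^-1 * ka)%:E = (((ka `^ y) * ((size G)%:R * h))%:E `^ y^-1)%E.
  rewrite poweR_EFin [X in _ = X%:E]powRM ?mulr_ge0 ?powR_ge0 ?(ltW h0)// -powRrM mulfV ?gt_eqF//.
  by rewrite powRr1 ?(ltW ka0)// mulrC.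
have -> : (\int[mu]_x `|(F x * weight lam a x)%:E| `^ y = \int[mu]_x (`|F x * weight lam a x| `^ y)%:E)%E.
  by [].
apply: gt0_ler_poweR; rewrite ?in_itv/= ?leey ?andbT ?invr_ge0 ?(ltW y0)//.
- by rewrite lee_fin mulr_ge0 ?powR_ge0 ?mulr_ge0 ?(ltW h0).
- by apply: integral_ge0 => t _; rewrite lee_fin powR_ge0.
pose T x t := ((ka `^ y)%:E * (\1_(`[x, x + h]%classic) t)%:E)%E.
have T0 x t : (0 <= T x t)%E by rewrite mule_ge0// lee_fin ?powR_ge0.
have mT x : measurable_fun [set: R] (T x).
  apply: emeasurable_funM => //; apply/measurable_EFinP.
  exact: measurable_indic.
have IT x : (\int[mu]_t T x t = (ka `^ y * h)%:E)%E.
  rewrite ge0_integralZl//=.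
  - rewrite integral_indic// setIT EFinM; congr (_ * _)%E.
    by rewrite /= lebesgue_measure_itv/= lte_fin ltrDl h0 -EFinD addrAC subrr add0r.
  - by apply/measurable_EFinP; exact: measurable_indic.
  - by rewrite lee_fin powR_ge0.
have -> : (ka `^ y * ((size G)%:R * h))%:E = (\int[mu]_t (\sum_(x <- G) T x t))%E.
  rewrite ge0_integral_sum//.
  under [RHS]eq_bigr do rewrite IT.
  rewrite sumEFin; congr (_%:E).
  by rewrite big_const_seq count_predT iter_addr_0 -mulr_natr; ring.
apply: ge0_le_integral => //.
- by move=> t _; exact: sume_ge0.
- by apply: emeasurable_sum => x; exact: mT.
- by apply: measurable_weighted_powR.
move=> t _.
have [/hasP[x xG xt]|nG] := boolP (has (fun x => x <= t <= x + h) G).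
  rewrite (bigD1_seq x)//= big1_seq ?adde0.
    rewrite /T indicE mem_setE in_itv/= xt mule1 lee_fin.
    apply: ge0_ler_powR; rewrite ?nnegrE ?(ltW ka0) ?(ltW y0)//.
    exact: FG xt.
  move=> x' /andP[x'x x'G]; rewrite /T indicE mem_setE in_itv/=.
  have [x't|_] := boolP (x' <= t <= x' + h); last by rewrite mule0.
  move: x'x; rewrite (disj _ _ _ x'G xG x't xt) eqxx//.
rewrite big1_seq; first by rewrite lee_fin powR_ge0.
move=> x /= xG; rewrite /T indicE mem_setE in_itv/=.
by rewrite (negbTE (hasPn nG x xG)) mule0.
Qed.

End SmoothWeakDerivatives.

(** * Sums of bumps in the cells free of sampling points *)

Section FoolingFunction.
Context {R : realType}.
Local Notation mu := (@lebesgue_measure R).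
Variables (lam a : R) (p : \bar R) (r : nat).
Hypotheses (lam_gt1 : 1 < lam) (a_gt0 : 0 < a) (p_ge1 : (1 <= p)%E).
Local Notation w := (weight lam a).

Let lam_gt0 : 0 < lam.
Proof. exact: lt_trans lam_gt1. Qed.

Lemma sobolev_norm_le1 (D : nat -> R -> R) :
  (forall k, (k <= r)%N -> (wnorm lam a p (D k) <= (r.+1%:R^-1)%:E)%E) ->
  (sobolev_norm lam a r p D <= 1)%E.
Proof.
have r1 : r.+1%:R^-1 <= 1 :> R by rewrite invf_le1// ler1n.
have r0 : 0 <= r.+1%:R^-1 :> R by rewrite invr_ge0.
case: p p_ge1 => [x| |]//= x1 HD; rewrite ?lee_fin in x1; last first.
  apply: bigmax_le => // i _; apply: (le_trans (HD i _)); first by rewrite -ltnS.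
  by rewrite lee_fin.
have x0 : 0 < x by lra.
apply: (@le_trans _ _ (1 `^ x^-1)%E); last by rewrite poweR1r.
apply: gt0_ler_poweR; rewrite ?in_itv/= ?leey ?andbT ?lee01 ?invr_ge0 ?(ltW x0)//.
  by apply: sume_ge0 => i _; exact: poweR_ge0.
apply: (@le_trans _ _ (\sum_(i < r.+1) (r.+1%:R^-1)%:E)%E); last first.
  by rewrite sumEFin sumr_const card_ord -[_ *+ _]mulr_natr mulVf.
apply: lee_sum => i _; apply: (@le_trans _ _ ((r.+1%:R^-1)%:E `^ x)%E).
  apply: gt0_ler_poweR; rewrite ?in_itv/= ?leey ?andbT ?(ltW x0) ?lee_fin//.
    by apply: (@wnorm_ge0 _ lam a x%:E) => //; rewrite lee_fin.
  by apply: HD; rewrite -ltnS.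
rewrite poweR_EFin lee_fin -[leRHS](powRr1 r0).
by apply: ger_powR; rewrite // r1 andbT invr_gt0.
Qed.

Section Bumps.
Variables (T h A : R) (G : seq nat).
Hypotheses (T_ge0 : 0 <= T) (h_gt0 : 0 < h) (A_gt0 : 0 < A) (G_uniq : uniq G).

Definition fool_node (k : nat) : R := T + k%:R * h.
Local Notation x := fool_node.

(** Dividing by the weight at the left end of each cell gives all the bumps comparable weighted
    heights; to the right of T >= 0 this end carries the largest weight of the cell. *)
Definition fool_fun (t : R) : R :=
  \sum_(k <- G) (A / w (x k) * bump (h^-1 * t + - (h^-1 * x k))).

Lemma fool_nodeS k : x k.+1 = x k + h.
Proof. by rewrite /fool_node -natr1; ring. Qed.

Lemma le_fool_node j k : (j <= k)%N -> x j <= x k.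
Proof. by move=> jk; rewrite lerD2l ler_wpM2r ?(ltW h_gt0)// ler_nat. Qed.

Lemma fool_node_ge0 k : 0 <= x k.
Proof. by rewrite addr_ge0// mulr_ge0// ltW. Qed.

Lemma smooth_fool_fun : smooth fool_fun.
Proof.
apply: smooth_sum => k; apply: smoothM; first exact: smooth_cst.
by apply: smooth_affine; exact: smooth_bump.
Qed.

Lemma derive1n_fool_fun i t : derive1n i fool_fun t =
  \sum_(k <- G) (A / w (x k) * (h^-1 ^+ i * derive1n i bump (h^-1 * t + - (h^-1 * x k)))).
Proof.
have sb k : smooth (fun t => bump (h^-1 * t + - (h^-1 * x k))).
  by apply: smooth_affine; exact: smooth_bump.
rewrite derive1n_sum; last by move=> k; apply: smoothM (sb k); exact: smooth_cst.
apply: eq_bigr => k _; rewrite derive1nZ//; congr (_ * _).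
by rewrite derive1n_affine//; exact: smooth_bump.
Qed.

Lemma fool_outside i k t : t <= x k \/ x k + h <= t ->
  derive1n i bump (h^-1 * t + - (h^-1 * x k)) = 0.
Proof.
move=> tk; apply: bump0; rewrite -mulrBr mulrC; case: tk => tk; [left|right].
  by rewrite pmulr_lle0 ?invr_gt0// subr_le0.
by rewrite ler_pdivlMr// mul1r lerBrDl.
Qed.

Lemma derive1n_fool_fun_cell i k t : x k <= t <= x k.+1 ->
  derive1n i fool_fun t = (k \in G)%:R *
    (A / w (x k) * (h^-1 ^+ i * derive1n i bump (h^-1 * t + - (h^-1 * x k)))).
Proof.
move=> /andP[kt tk]; rewrite derive1n_fool_fun.
have z j : j != k -> A / w (x j) * (h^-1 ^+ i * derive1n i bump (h^-1 * t + - (h^-1 * x j))) = 0.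
  rewrite neq_ltn => /orP[jk|kj]; rewrite fool_outside ?mulr0//.
    by right; rewrite -fool_nodeS; apply: le_trans kt; exact: le_fool_node.
  by left; apply: (le_trans tk); exact: le_fool_node.
have [kG|kG] := boolP (k \in G).
  by rewrite (bigD1_seq k)//= big1 ?addr0 ?mul1r// => j /z.
rewrite mul0r big1_seq// => j /andP[_ jG]; apply: z.
by apply: contraNneq kG => <-.
Qed.

Lemma derive1n_fool_fun_left i t : t <= T -> derive1n i fool_fun t = 0.
Proof.
move=> tT; rewrite derive1n_fool_fun big1// => k _; rewrite fool_outside ?mulr0//.
by left; apply: (le_trans tT); rewrite lerDl mulr_ge0// ltW.
Qed.

Lemma mem_fool_cell t : T <= t -> exists k, x k <= t <= x k.+1.
Proof.
move=> Tt; have t0 : 0 <= (t - T) / h by rewrite divr_ge0 ?subr_ge0// ltW.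
have /andP[k1 k2] := truncn_itv t0.
set k := Num.truncn _ in k1 k2; exists k.
rewrite ler_pdivlMr// in k1; rewrite ltr_pdivrMr// in k2.
by rewrite /fool_node -lerBrDl k1/= -lerBlDl ltW.
Qed.

(** As h <= 1, every derivative up to order r is at most A h^(-r) M in weighted size, on cells of
    total length [size G] times h. The value of A compensates this; its factor 2 pays for the two
    families of cells, and r + 1 for the number of derivatives. *)
Lemma fool_fun_ball M : h <= 1 -> 0 < M ->
  (forall k s, (k <= r)%N -> `|derive1n k bump s| <= M) ->
  A = ((r.+1)%:R * 2 * M)^-1 * (size G)%:R `^ (- inve p) *
      h `^ (r%:R - inve p) -> (0 < size G)%N ->
  sobolev_ball lam a r p fool_fun.
Proof.
move=> h1 M0 HM AE G0.
pose D i := derive1n i fool_fun.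
have cD i : continuous (D i) by apply: smooth_continuous; exact: smooth_fool_fun.
have g0 : 0 < (size G)%:R :> R by rewrite ltr0n.
have /andP[ip0 ip1] := inv_exponent_le1 p_ge1.
have DB i : (i <= r)%N -> (wnorm lam a p (D i) <= (r.+1%:R^-1)%:E)%E.
  move=> ir.
  (* Family 0 consists of the cells to the right of T. Family 1, the intervals [- k, T], exhausts
     the rest of the line, where the function vanishes. *)
  pose l (b k : nat) := if b == 0%N then x k else - k%:R.
  pose rr (b k : nat) := if b == 0%N then x k.+1 else T.
  pose B := A * h^-1 ^+ r * M.
  have hr0 : 0 < h^-1 ^+ r by rewrite exprn_gt0// invr_gt0.
  have B0 : 0 < B by exact: mulr_gt0 (mulr_gt0 A_gt0 hr0) M0.
  pose u (b k : nat) := if b == 0%N then B * (k \in G)%:R else 0.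
  pose K := h `^ inve p * B * (size G)%:R `^ inve p.
  have K0 : 0 <= K by rewrite mulr_ge0 ?powR_ge0// (mulr_ge0 _ (ltW B0))// powR_ge0.
  have -> : r.+1%:R^-1 = 2%:R * K.
    rewrite /K /B AE powRN.
    have -> : h `^ (r%:R - inve p) = h ^+ r / h `^ inve p.
      rewrite gt0_powRD//.
      by rewrite powRN powR_mulrn// ltW.
    have hp : h `^ inve p != 0 by rewrite gt_eqF// powR_gt0.
    have gp : (size G)%:R `^ inve p != 0 :> R by rewrite gt_eqF// powR_gt0.
    have hr : h ^+ r != 0 by rewrite gt_eqF// exprn_gt0.
    have r0 : (r.+1)%:R != 0 :> R by rewrite pnatr_eq0.
    have fid (u1 u2 u3 u4 : R) : u1 != 0 -> u2 != 0 -> u3 != 0 -> u4 != 0 ->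
        u4^-1 = 2 * (u1 * ((u4 * 2 * M)^-1 / u2 * (u3 / u1) * u3^-1 * M) * u2).
      by move=> n1 n2 n3 n4; field; rewrite n1 n2 n3 n4 gt_eqF.
    by rewrite exprVn; exact: fid.
  apply: (@wnorm_le_cells _ lam a p 2 (D i) l rr u) => //.
  - exact: continuous_measurable_fun.
  - move=> b k; rewrite /l /rr; case: ifP => _; first exact: le_fool_node.
    by rewrite (le_trans _ T_ge0)// oppr_le0.
  - by move=> b k; rewrite /u; case: ifP => // _; rewrite mulr_ge0// ltW.
  - move=> t; have [Tt|tT] := leP T t; last first.
      exists 1%N, (Num.truncn `|t|).+1; split => //.
        rewrite /l /rr/= (ltW tT) andbT.
        have := truncnS_gt `|t|; move=> tk.
        by move: (ltW tk); rewrite ler_norml => /andP[].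
      by rewrite /D derive1n_fool_fun_left ?(ltW tT)// mul0r normr0.
    have [k kt] := mem_fool_cell Tt.
    exists 0%N, k; split => //; rewrite /u/= /D (derive1n_fool_fun_cell i kt).
    rewrite mulrAC -mulrA mulrC normrM [X in _ * X]ger0_norm// ler_wpM2r//.
    rewrite normrM (gtr0_norm (weight_gt0 _ _ _)) normrM (gtr0_norm (divr_gt0 A_gt0 (weight_gt0 _ _ _))).
    rewrite normrM normrX normfV (gtr0_norm h_gt0).
    have wt : w t <= w (x k).
      move: kt => /andP[kt _]; apply: le_weight => //.
      by rewrite !ger0_norm ?fool_node_ge0// (le_trans (fool_node_ge0 k)).
    have bM := HM i (h^-1 * t + - (h^-1 * x k)) ir.
    set b := `|_| in bM *; have b0 : 0 <= b by exact: normr_ge0.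
    have hi : h^-1 ^+ i <= h^-1 ^+ r by apply: ler_weXn2l => //; rewrite invf_ge1.
    rewrite /B; have -> : w t * (A / w (x k) * (h^-1 ^+ i * b)) =
      (w t / w (x k)) * (A * h^-1 ^+ i * b) by ring.
    have hb : A * h^-1 ^+ i * b <= A * h^-1 ^+ r * M.
      by apply: ler_pM => //; [apply: mulr_ge0; rewrite ?exprn_ge0 ?invr_ge0 ?(ltW A_gt0) ?(ltW h_gt0)
        |rewrite ler_wpM2l// ltW].
    apply: le_trans hb; rewrite ler_piMl//.
      by rewrite mulr_ge0// mulr_ge0 ?exprn_ge0 ?invr_ge0 ?(ltW A_gt0) ?(ltW h_gt0).
    by rewrite ler_pdivrMr ?weight_gt0// mul1r.
  - move=> [|[|//]] _; last first.
      apply: (@le_lp_bounded _ _ (fun i => 0)) => //.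
        by move=> k; rewrite /u/= mulr0 lexx.
      case: p p_ge1 => [y| |]//= y1 N.
      rewrite big1 ?powR_ge0// => j _; rewrite powR0// gt_eqF//.
      by rewrite lee_fin in y1; lra.
    have e k : rr 0%N k - l 0%N k = h by rewrite /rr /l/= fool_nodeS; ring.
    under [X in lp_bounded p X]eq_fun do rewrite e /u/= mulrA.
    apply: lp_boundedZ => //; rewrite ?powR_ge0//.
      by rewrite mulr_ge0 ?powR_ge0// ltW.
    case: p p_ge1 => [y| |]//= y1; last by move=> k; rewrite powRr0; case: (k \in G).
    rewrite lee_fin in y1; have y0 : 0 < y by lra.
    move=> N; rewrite -powRrM mulVf ?gt_eqF// powRr1//.
    have -> : \sum_(k < N) (val k \in G)%:R `^ y = (\sum_(k < N) (val k \in G : nat))%:R.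
      rewrite natr_sum; apply: eq_bigr => k _.
      by case: (_ \in G); rewrite ?powR1// powR0// gt_eqF.
    rewrite ler_nat -(big_mkord xpredT (fun k => (k \in G) : nat)).
    rewrite -big_mkcond/= sum1_count -size_filter.
    apply: uniq_leq_size; first by rewrite filter_uniq// iota_uniq.
    by move=> k; rewrite mem_filter => /andP[].
exists D; last exact: sobolev_norm_le1.
split => //; first exact: (cD 0%N).
move=> k kr; split; first by apply: weak_derivative_smooth; exact: smooth_fool_fun.
split; last by apply: le_lt_trans (DB k kr) _; exact: ltry.
case: p p_ge1 => [y| |]// _.
by apply: measurable_lebesgue; exact: continuous_measurable_fun.
Qed.

Lemma fool_fun_lower (k : nat) t ka : k \in G ->
  x k + 3 / 8 * h <= t <= x k + 3 / 8 * h + h / 4 -> ka * w (x k) <= w t -> 0 <= ka ->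
  A * expR (- 8^-1^-1) ^+ 2 * ka <= `|fool_fun t * w t|.
Proof.
move=> kG /andP[t1 t2] kaw ka0.
have tk : x k <= t <= x k.+1.
  have h0 := h_gt0; rewrite fool_nodeS; apply/andP; split.
    by apply: le_trans t1; rewrite lerDl mulr_ge0// ltW.
  by apply: (le_trans t2); rewrite -addrA lerD2l; lra.
have := derive1n_fool_fun_cell 0 tk; rewrite kG mul1r expr0 mul1r /= => ->.
have bt : expR (- 8^-1^-1) ^+ 2 <= bump (h^-1 * t + - (h^-1 * x k)).
  apply: bump_ge; rewrite -mulrBr [h^-1 * _]mulrC.
  by rewrite ler_pdivlMr// ler_pdivrMr//; have h0 := h_gt0; apply/andP; split; lra.
have e0 : 0 <= expR (- 8^-1^-1 : R) ^+ 2 by rewrite exprn_ge0 ?expR_ge0.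
have wx := weight_gt0 lam a (x k).
rewrite ger0_norm; last first.
  apply: mulr_ge0 (weight_ge0 _ _ _).
  exact: mulr_ge0 (divr_ge0 (ltW A_gt0) (ltW wx)) (le_trans e0 bt).
set b := bump _ in bt *.
have -> : A / w (x k) * b * w t = A * b * (w t / w (x k)) by ring.
apply: ler_pM => //; first by rewrite mulr_ge0// ltW.
  by rewrite ler_wpM2l// ltW.
by rewrite ler_pdivlMr.
Qed.

End Bumps.

Lemma many_empty_cells n k (y : 'I_k -> R) (T h : R) : 0 < h -> (k <= n)%N ->
  exists G : seq nat, [/\ uniq G, size G = n, forall j, j \in G -> (j < 2 * n)%N &
    forall j i, j \in G -> y i <= fool_node T h j \/ fool_node T h j + h <= y i].
Proof.
move=> h0 kn.
pose good j := [forall i, ~~ (fool_node T h j < y i < fool_node T h j + h)].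
pose Gs := [seq j <- iota 0 (2 * n) | good j].
have sz : (n <= size Gs)%N.
  (* A sampling point inside cell j determines j as the integer part of (y - T) / h, so there are at
     most k <= n occupied cells among the 2n. *)
  have bad : (size [seq j <- iota 0 (2 * n) | predC good j] <= k)%N.
    rewrite -[k in leqRHS]size_enum_ord -(size_map (fun i => Num.truncn ((y i - T) / h))).
    apply: uniq_leq_size; first by rewrite filter_uniq// iota_uniq.
    move=> j; rewrite mem_filter => /andP[/=]; rewrite negb_forall => /existsP[i].
    rewrite negbK => /andP[y1 y2] _; apply/mapP; exists i; first by rewrite mem_enum.
    apply/esym/truncn_def; rewrite ler_pdivlMr// ltr_pdivrMr//.
    move: y1 y2; rewrite /fool_node -natr1 => y1 y2.
    by apply/andP; split; lra.
  have := count_predC good (iota 0 (2 * n)).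
  have sGs : size Gs = count good (iota 0 (2 * n)) := size_filter _ _.
  move: bad; rewrite size_filter sGs size_iota.
  move: (count good _) (count _ _) => u v; clear -kn; lia.
exists (take n Gs); split.
- by rewrite take_uniq// filter_uniq// iota_uniq.
- by rewrite size_take; case: ltngtP sz => // ->.
- by move=> j /mem_take; rewrite mem_filter mem_iota add0n => /andP[_ /andP[]].
move=> j i /mem_take; rewrite mem_filter => /andP[/forallP /(_ i)].
by rewrite negb_and -!leNgt => /orP.
Qed.

Lemma width_lower_bound q : (1 <= q)%E -> exists2 c : R, 0 < c &
  forall n S, (0 < n)%N -> sampling_algorithms n S ->
  ((c * n%:R `^ (- rate_exponent lam p q r))%:E <=
    sampling_error lam a q (sobolev_ball lam a r p) S)%E.
Proof.
move=> q1.
have [M M0 HM] := @bump_bounded R r.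
(* The left ends of the cells lie within 2 T of the origin and h <= T, so [weight_ratio] is used
   with radius at most 3 T; since T^(lam - 1) h = 1/2, the weight loses at most exp (- a D0) across
   a cell. *)
pose D0 : R := lam * 3 `^ (lam - 1).
pose c1 : R := (r.+1%:R * 2 * M)^-1.
have c10 : 0 < c1 by rewrite invr_gt0 mulr_gt0// mulr_gt0.
pose ka : R := expR (- (a * D0)).
have ka0 : 0 < ka by exact: expR_gt0.
pose E : R := r%:R - inve p + inve q.
pose e2 : R := expR (- 8^-1^-1) ^+ 2.
have e20 : 0 < e2 by rewrite exprn_gt0// expR_gt0.
exists (4^-1 `^ inve q * (c1 * e2 * ka) * 2^-1 `^ E).
  by rewrite mulr_gt0 ?powR_gt0// mulr_gt0 ?powR_gt0// mulr_gt0// mulr_gt0.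
move=> n S n0 [k [y [phi [kn SE]]]].
have N0 : 0 < n%:R :> R by rewrite ltr0n.
have N1 : 1 <= n%:R :> R by rewrite ler1n.
pose T : R := n%:R `^ lam^-1.
have T0 : 0 < T by rewrite powR_gt0.
have TL : T `^ lam = n%:R by rewrite -powRrM mulVf ?powRr1 ?gt_eqF.
pose h := T / (2 * n%:R).
have h0 : 0 < h by rewrite divr_gt0// mulr_gt0.
have nh : n%:R * h = T / 2 by rewrite /h; field; rewrite gt_eqF.
have Tn : T <= n%:R.
  by rewrite ler1_powR// invf_le1// ltW.
have h1 : h <= 1 by rewrite ler_pdivrMr ?mulr_gt0//; lra.
have [G' [uG' sG' G'n G'y]] := many_empty_cells y T h0 kn.
(* With g bumps, A is of order g^(-1/p) h^(r-1/p) and the q-norm of order g^(1/q-1/p) h^E: one bump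
   is best for p <= q, as many as possible for q < p. *)
pose g := if (p <= q)%E then 1%N else n.
have gn : (g <= n)%N by rewrite /g; case: ifP.
have g0 : (0 < g)%N by rewrite /g; case: ifP.
pose G := take g G'.
have uG : uniq G by exact: take_uniq.
have sG : size G = g by rewrite size_takel// sG'.
pose A := c1 * (size G)%:R `^ (- inve p) * h `^ (r%:R - inve p).
have A0 : 0 < A by rewrite mulr_gt0 ?powR_gt0// mulr_gt0 ?powR_gt0// sG ltr0n.
pose f := fool_fun T h A G.
have fB : sobolev_ball lam a r p f.
  apply: (fool_fun_ball (ltW T0) h0 A0 uG h1 M0 HM) => //; by rewrite sG.
have Sf : S f = (fun=> 0).
  apply/funext => t; rewrite SE big1// => i _.
  rewrite /f /fool_fun big1_seq ?mul0r// => j /andP[_ jG].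
  have /= -> := @fool_outside T h h0 0%N j (y i) (G'y j i (mem_take jG)).
  by rewrite mulr0.
have sf : smooth f by exact: smooth_fool_fun.
have cf : continuous f by exact: (@smooth_continuous _ f 0%N sf).
apply: (@le_trans _ _ (wnorm lam a q f)); last first.
  apply: ereal_sup_ubound; exists f => //.
  by rewrite Sf; congr (wnorm _ _ _ _); apply/funext => t /=; rewrite subr0.
(* Start of the middle quarter of a cell, where [bump_ge] applies. These closed quarters are
   disjoint, as [wnorm_ge_cells] requires; the closed cells are not. *)
pose z (j : nat) := fool_node T h j + 3 / 8 * h.
have zk j t : z j <= t <= z j + h / 4 -> fool_node T h j < t < fool_node T h j.+1.
  move=> /andP[t1 t2]; rewrite fool_nodeS; apply/andP; split.
    by apply: lt_le_trans t1; rewrite ltrDl mulr_gt0.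
  by apply: (le_lt_trans t2); rewrite /z -addrA ltrD2l -[X in _ < X]mul1r -[h / 4]mulrC -mulrDl ltr_pM2r//; lra.
have disj j j' t : z j <= t <= z j + h / 4 -> z j' <= t <= z j' + h / 4 -> j = j'.
  wlog jj : j j' / (j < j')%N.
    move=> W t1 t2; have [jj|jj|//] := ltngtP j j'; first exact: W t1 t2.
    exact/esym/W.
  move=> /zk /andP[_ t1] /zk /andP[t2 _].
  have := le_fool_node T h0 jj; move=> xx.
  by have := lt_trans (lt_le_trans t1 xx) t2; rewrite ltxx.
have lower j t : j \in G -> z j <= t <= z j + h / 4 -> A * e2 * ka <= `|f t * w t|.
  move=> jG tj; apply: (fool_fun_lower h0 A0 uG jG tj _ (ltW ka0)).
  have /andP[t1 t2] := zk j t tj.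
  have x0 := fool_node_ge0 (ltW T0) h0 j.
  have xT : `|fool_node T h j| <= 2 * T.
    rewrite ger0_norm// /fool_node.
    have jn : j%:R <= (2 * n)%:R :> R by rewrite ler_nat ltnW// G'n// (mem_take jG).
    have := ler_wpM2r (ltW h0) jn; rewrite natrM -mulrA nh => jh.
    by lra.
  have tx : `|t| <= `|fool_node T h j| + h.
    by rewrite !ger0_norm -?fool_nodeS ?(ltW t2)// (le_trans x0)// ltW.
  apply: le_trans (weight_ratio (ltW lam_gt1) a_gt0 (ltW h0) xT tx).
  rewrite mulrC ler_wpM2l ?weight_ge0// ler_expR lerN2 ler_pM2l//.
  apply: (@le_trans _ _ (lam * (3 * T) `^ (lam - 1) * h)).
    rewrite ler_wpM2r ?(ltW h0)// ler_wpM2l ?(ltW lam_gt0)//.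
    have hT : h <= T by rewrite ler_pdivrMr ?mulr_gt0// ler_peMr ?(ltW T0)//; lra.
    have T0' := ltW T0; have h0' := ltW h0.
    have TT : 2 * T + h <= 3 * T by rewrite [3 * T](_ : _ = 2 * T + T) ?lerD2l//; ring.
    have T2 : 0 <= 2 * T + h by rewrite addr_ge0// mulr_ge0.
    have lam1' : 0 <= lam - 1 by rewrite subr_ge0 ltW.
    by apply: ge0_ler_powR => //; rewrite ?nnegrE// (le_trans T2).
  rewrite powRM ?(ltW T0)// -!mulrA ler_wpM2l ?(ltW lam_gt0)// -[leRHS]mulr1 ler_wpM2l ?powR_ge0//.
  have -> : T `^ (lam - 1) * h = 2^-1.
    have := mulr_powRB1 (ltW T0) lam_gt0; rewrite TL => TE.
    rewrite /h mulrA [_ * T]mulrC TE; field; rewrite gt_eqF//.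
  by lra.
have inj : {in G &, injective z}.
  move=> j j' _ _ zz; apply: (disj j j' (z j)); last rewrite -zz; rewrite lexx lerDl divr_ge0// ltW//.
have := @wnorm_ge_cells R lam a q f [seq z j | j <- G] (h / 4) (A * e2 * ka) q1.
rewrite size_map map_inj_in_uniq// => H.
apply: le_trans (H _ uG _ _ _ _ _).
- rewrite lee_fin le_eqVlt; apply/orP; left; apply/eqP.
  have gE : (size G)%:R `^ inve q * (size G)%:R `^ (- inve p) =
      n%:R `^ (if (p <= q)%E then 0 else inve q - inve p) :> R.
    rewrite sG /g; case: ifP => _; first by rewrite !powR1 powRr0 mulr1.
    by rewrite -powRD//; apply/implyP => _; rewrite gt_eqF.
  have hE : h `^ inve q * h `^ (r%:R - inve p) =
      2^-1 `^ E * n%:R `^ (- ((1 - lam^-1) * E)).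
    rewrite -gt0_powRD//.
    rewrite [inve q + _]addrC -/E.
    have -> : h = 2^-1 * n%:R `^ (lam^-1 - 1).
      rewrite gt0_powRB//.
      rewrite powRr1 ?ler0n// -/T /h; field; rewrite gt_eqF//.
    by rewrite powRM ?powR_ge0// -powRrM; congr (_ * _ `^ _); ring.
  have cellE : ((size G)%:R * (h / 4)) `^ inve q =
      (size G)%:R `^ inve q * (h `^ inve q * 4^-1 `^ inve q).
    have h40 : 0 <= h / 4 by rewrite divr_ge0// ltW.
    by rewrite powRM//; congr (_ * _); rewrite powRM// ltW.
  rewrite cellE rate_exponentE -/E.
  have -> : n%:R `^ (- ((1 - lam^-1) * E - (if (p <= q)%E then 0 else inve q - inve p))) =
      n%:R `^ (- ((1 - lam^-1) * E)) *
      n%:R `^ (if (p <= q)%E then 0 else inve q - inve p) :> R.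
    rewrite -gt0_powRD//.
    by congr (_ `^ _); ring.
  rewrite -gE [in LHS]mulrA -[X in X * _]mulrA -hE /A; ring.
- by apply: continuous_measurable_fun.
- by rewrite sG.
- by rewrite divr_gt0.
- exact: mulr_gt0 (mulr_gt0 A0 e20) ka0.
- move=> _ _ t /mapP[j jG ->] /mapP[j' j'G ->] t1 t2.
  by rewrite (disj j j' t t1 t2).
- by move=> _ t /mapP[j jG ->]; exact: lower.
Qed.

End FoolingFunction.

(** * Optimality *)

Section GammaPositive.
Context {R : realType}.
Local Notation mu := (@lebesgue_measure R).

(** The real integral would be 0 if the extended one were infinite, so finiteness is the main point.
    It follows from [wnorm_le_cells] with lam = a = q = 1, whose weight is exp (- |t|). *)
Lemma Gamma_gt0 (x : R) : 2^-1 <= x -> 0 < Gamma x.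
Proof.
move=> x2.
pose F (t : R) := t `^ (x - 1) * \1_(`]0, +oo[%classic) t.
have F0 t : 0 <= F t by rewrite mulr_ge0 ?powR_ge0// indicE.
have mF : measurable_fun [set: R] F.
  apply: measurable_funM; first exact: measurable_powR.
  exact: measurable_indic.
have w1 t : 0 < t -> weight 1 1 t = expR (- t).
  by move=> t0; rewrite /weight (gtr0_norm t0) powRr1 ?(ltW t0)// mulN1r.
have FE t : 0 < t -> F t = t `^ (x - 1).
  by move=> t0; rewrite /F indicE mem_set ?mulr1//= in_itv/= t0.
have FN t : t <= 0 -> F t = 0.
  by move=> t0; rewrite /F indicE memNset ?mulr0//= in_itv/= ltNge t0.
(* Near 0, t^(x-1) <= t^(-1/2), and the dyadic cell of length 2^-(i+1) then contributes s^(i+1), a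
   geometric series. *)
pose s : R := 2^-1 `^ 2^-1.
have s0 : 0 < s by rewrite powR_gt0.
have s1 : s < 1.
  by have := @gt0_ltr_powR R 2^-1 _ 2^-1 1; rewrite powR1; apply; rewrite ?nnegrE//; lra.
pose N := (Num.truncn x).+1.
(* The power N + 2 exceeds (x - 1) + 2, so that t^(x-1) exp (- t) <= C1 t^(-2) for t >= 1, which is
   summable over unit cells. *)
have [C1 C10 HC1] := @horner_expN_bounded R ('X^(N.+2)).
have [C2 C20 HC2] := @sum_powR_tail R 2 ltac:(lra).
pose K := (1 - s)^-1 + C1 * C2.
have K0 : 0 <= K by rewrite addr_ge0 ?invr_ge0 ?mulr_ge0 ?(ltW C20)//; lra.
(* Dyadic cells in (0, 1], unit cells beyond 1, and the half-line where F vanishes. *)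
pose l (b i : nat) : R := match b with 0%N => 2^-1 ^+ i.+1 | 1%N => i.+1%:R | _ => - i%:R end.
pose r (b i : nat) : R := match b with 0%N => 2^-1 ^+ i | 1%N => i.+2%:R | _ => 0 end.
pose u (b i : nat) : R := match b with 0%N => (2^-1 ^+ i.+1) `^ (- 2^-1)
  | 1%N => C1 * i.+1%:R `^ (- 2) | _ => 0 end.
have h20 i : 0 < 2^-1 ^+ i :> R by rewrite exprn_gt0.
have H : (wnorm 1 1 1%:E F <= (3%:R * K)%:E)%E.
  apply: (@wnorm_le_cells _ 1 1 1%:E 3 F l r u) => //.
  - case=> [|[|b]] i /=.
    + by rewrite exprS ler_piMl ?(ltW (h20 _))//; lra.
    + by rewrite ler_nat.
    + by rewrite oppr_le0.
  - by case=> [|[|b]] i //=; rewrite ?mulr_ge0 ?powR_ge0.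
  - move=> t; have [t0|t0] := leP t 0.
      exists 2%N, (Num.truncn `|t|).+1; split => //.
        rewrite /l /r/= t0 andbT.
        by have := ltW (truncnS_gt `|t|); rewrite ler_norml => /andP[].
      by rewrite FN// mul0r normr0.
    rewrite FE// w1// ger0_norm ?mulr_ge0 ?powR_ge0 ?expR_ge0//.
    have [t1|t1] := leP t 1.
      have [i ti] : exists i, 2^-1 ^+ i.+1 <= t <= 2^-1 ^+ i.
        have [n tn] : exists n, 2^-1 ^+ n <= t.
          exists (Num.truncn t^-1).+1.
          have h := ltW (truncnS_gt t^-1); set k := (Num.truncn _).+1 in h *.
          rewrite exprVn -[leRHS]invrK lef_pV2 ?posrE ?exprn_gt0 ?invr_gt0//.
          by apply: (le_trans h); rewrite -natrX ler_nat ltnW// ltn_expl.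
        elim: n => [|n IH] in tn *.
          by exists 0%N; rewrite expr0 in tn *; rewrite t1 andbT expr1 (le_trans _ tn)//; lra.
        have [/IH//|tn'] := leP (2^-1 ^+ n) t.
        by exists n; rewrite tn ltW.
      exists 0%N, i; split => //; rewrite /u.
      move: ti => /andP[ti _].
      apply: (@le_trans _ _ (t `^ (- 2^-1))).
        rewrite -[leRHS]mulr1; apply: ler_pM; rewrite ?powR_ge0 ?expR_ge0//.
          by apply: ger_powR; rewrite ?t0//; lra.
        by rewrite expR_le1; lra.
      rewrite !powRN lef_pV2 ?posrE ?powR_gt0//.
      by apply: ge0_ler_powR; rewrite ?nnegrE ?(ltW t0) ?(ltW (h20 _))//.
    have t00 := ltW t0; have t10 := ltW t1.
    have /andP[k1 k2] := truncn_itv t00; set k := Num.truncn t in k1 k2.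
    have k0 : (0 < k)%N.
      by rewrite lt0n; apply: contraTneq k2 => ->; rewrite -leNgt.
    exists 1%N, k.-1; rewrite /l /r/u prednK//; split => //; first by rewrite k1 ltW.
    apply: (@le_trans _ _ (C1 * t `^ (- 2))); last first.
      rewrite ler_wpM2l// !powRN lef_pV2 ?posrE ?powR_gt0 ?ltr0n//.
      by apply: ge0_ler_powR; rewrite ?nnegrE.
    rewrite powRN ler_pdivlMr ?powR_gt0//.
    have := HC1 t t00; rewrite hornerXn (ger0_norm (mulr_ge0 (exprn_ge0 _ t00) (expR_ge0 _))).
    apply: le_trans; rewrite mulrAC ler_wpM2r ?expR_ge0//.
    rewrite -gt0_powRD//.
    rewrite -powR_mulrn//; apply: ler_powR => //.
    have := ltW (truncnS_gt x); rewrite -/N -[N.+2%:R]natr1 -natr1; lra.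
  case=> [|[|[|//]]] _ n /=; rewrite ?invr1 powRr1//.
  - apply: (@le_trans _ _ (1 - s)^-1); last by rewrite lerDl mulr_ge0// ltW.
    apply: (@le_trans _ _ (\sum_(i < n) s ^+ i)).
      apply: ler_sum => i _; have p0 := ltW (h20 i.+1).
      have -> : 2^-1 ^+ i - 2^-1 ^+ i.+1 = 2^-1 ^+ i.+1 :> R by rewrite exprS; field.
      rewrite [X in X `^ 1]mulrC powRr1 ?mulr_ge0 ?powR_ge0// mulrC.
      rewrite -powRD; last first.
        by apply/implyP => _; rewrite gt_eqF.
      rewrite -(@powR_mulrn _ 2^-1 i.+1)// -powRrM (_ : i.+1%:R * _ = 2^-1 * i.+1%:R); last by field.
      rewrite powRrM -/s powR_mulrn ?(ltW s0)// exprS ler_piMl ?exprn_ge0 ?(ltW s0)//.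
      exact: ltW.
    rewrite -[leRHS]mul1r ler_pdivlMr ?subr_gt0// mulrC.
    have := subrX1 s n; have : 0 <= s ^+ n by rewrite exprn_ge0// ltW.
    by move=> h1 h2; lra.
  - apply: (@le_trans _ _ (C1 * C2)); last by rewrite lerDr invr_ge0; lra.
    have := HC2 0%N n; rewrite powR1 mulr1 => h.
    apply: le_trans (ler_wpM2l C10 h); rewrite mulr_sumr; apply: ler_sum => i _.
    rewrite (_ : i.+2%:R - i.+1%:R = 1 :> R) ?powR1 ?mul1r.
      by rewrite powRr1 ?mulr_ge0 ?powR_ge0// add0n.
    by rewrite -[i.+2%:R]natr1; ring.
  - by rewrite big1// => i _; rewrite mulr0 powRr1.
pose I := (\int[mu]_(t in `]0%R, +oo[) (t `^ (x - 1) * expR (- t))%:E)%E.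
have IE : I = (\int[mu]_t (F t * weight 1 1 t)%:E)%E.
  rewrite /I integral_mkcond; apply: eq_integral => t _; rewrite patchE.
  have [t0|t0] := ltP 0 t.
    by rewrite mem_set ?FE ?w1//= in_itv/= t0.
  by rewrite memNset ?FN ?mul0r//= in_itv/= ltNge t0.
have mI : measurable_fun [set: R] (fun t => (F t * weight 1 1 t)%:E).
  apply/measurable_EFinP; apply: measurable_funM => //.
  exact: measurable_weight.
have Ifin : (I < +oo)%E.
  move: H; rewrite /wnorm ifT; last first.
    by apply/asboolP; exact: measurable_lebesgue.
  rewrite unlock => H; rewrite IE; apply: le_lt_trans (ltry (3%:R * K)).
  apply: le_trans H; rewrite invr1 poweRe1; last first.
    by apply: integral_ge0 => t _; rewrite poweR_ge0.
  apply: le_of_eq; apply: eq_integral => t _.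
  rewrite poweRe1// abse_EFin ger0_norm// mulr_ge0//.
  by rewrite /weight expR_ge0.
(* On [1, 2] the integrand is at least t^(-1) exp (- t), hence at least exp (- 2) / 2. *)
have I0 : ((expR (- 2) / 2)%:E <= I)%E.
  apply: (@le_trans _ _ (\int[mu]_(t in `[1%R, 2%R]) (expR (- 2) / 2)%:E)%E).
    rewrite integral_cst//= lebesgue_measure_itv/= lte_fin ltr1n/= -EFinD -EFinM lee_fin.
    by rewrite (_ : 2 - 1 = 1) ?mulr1//; ring.
  apply: (@le_trans _ _ (\int[mu]_(t in `[1%R, 2%R]) (F t * weight 1 1 t)%:E)%E); last first.
    rewrite IE; apply: ge0_subset_integral => //.
    by move=> t _; rewrite lee_fin mulr_ge0// /weight expR_ge0.
  apply: ge0_le_integral => //.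
    exact: measurable_funTS.
  move=> t /=; rewrite in_itv/= => /andP[t1 t2].
  have t0 : 0 < t by lra.
  rewrite lee_fin FE// w1// mulrC; apply: ler_pM; rewrite ?expR_ge0 ?invr_ge0//.
    apply: (@le_trans _ _ (t `^ (- 1))); last by apply: ler_powR => //; lra.
    by rewrite powR_inv1 ?(ltW t0)// lef_pV2 ?posrE.
  by rewrite ler_expR lerN2.
rewrite /Gamma /Rintegral; apply: fine_gt0; rewrite Ifin andbT.
by apply: lt_le_trans I0; rewrite lte_fin divr_gt0 ?expR_gt0.
Qed.

Lemma MRS_const_gt0 (lam : R) : 1 < lam -> 0 < MRS_const lam.
Proof.
move=> lam1; rewrite /MRS_const powR_gt0// divr_gt0//.
  by rewrite mulr_gt0 ?powR_gt0// exprn_gt0// Gamma_gt0//; lra.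
by apply: Gamma_gt0; lra.
Qed.

End GammaPositive.

(** * The mesh index and the passage to asymptotic equivalence *)

Section OptimalSampling.
Context {R : realType}.

Lemma mesh_index_le l j0 n : (mesh_index l j0 n <= n)%N.
Proof. by apply/bigmax_leqP => i _; rewrite -ltnS. Qed.

Lemma mesh_index_admissible l j0 n : (0 < mesh_index l j0 n)%N ->
  (2 * (mesh_index l j0 n + l + j0) - 1 <= n)%N.
Proof.
have : (mesh_index l j0 n == 0%N) || (2 * (mesh_index l j0 n + l + j0) - 1 <= n)%N.
  apply: (@big_ind _ (fun v => (v == 0%N) || (2 * (v + l + j0) - 1 <= n)%N)) => //;
    last by move=> i ->; rewrite orbT.
  by move=> u v hu hv; case: (leqP u v).
by case/orP => // /eqP ->.
Qed.

Lemma mesh_index_nodes l j0 n : (0 < l)%N -> (0 < mesh_index l j0 n)%N ->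
  (2 * (mesh_index l j0 n + (l + j0).-1) < n)%N.
Proof. by move=> l0 /mesh_index_admissible; lia. Qed.

(** Otherwise m + 1 would still satisfy the constraint. This bounds n by a multiple of m(n), which
    turns rates in m into rates in n. *)
Lemma mesh_index_max l j0 n : (0 < l)%N -> (n <= 2 * (mesh_index l j0 n + l + j0))%N.
Proof.
move=> l0; rewrite leqNgt; apply/negP => h.
set m := mesh_index l j0 n in h.
have mn : (m.+1 < n.+1)%N by lia.
have : (m.+1 <= m)%N.
  rewrite {2}/m; apply: (@leq_bigmax_cond _ _ (fun i : 'I_n.+1 => val i) (Ordinal mn)).
  by rewrite /=; lia.
by rewrite ltnn.
Qed.

Lemma reproduces_quasi_interp l j0 (c : int -> R) : quasi_interp_mask l j0 c ->
  reproduces (quasi_interp l j0 c) (2 * l).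
Proof. by move=> [_ cP] P sP; apply/funext => x; exact: cP. Qed.

(** Since Q fixes the polynomial, the terms R and R Q cancel, whatever R does to it. *)
Lemma reproduces_spline_interp l j0 (c : int -> R) : quasi_interp_mask l j0 c ->
  reproduces (spline_interp l j0 c) (2 * l).
Proof.
move=> cP P sP; apply/funext => x; rewrite /spline_interp.
by rewrite (reproduces_quasi_interp cP sP) addrAC subrr add0r.
Qed.

Lemma zero_sampling n : @sampling_algorithms R n (fun _ _ => 0).
Proof.
by exists 0%N, (fun=> 0), (fun _ _ => 0); split => // f x; rewrite big_ord0.
Qed.

Variables (lam a rho : R) (p q : \bar R) (r l j0 : nat).
Hypotheses (lam_gt1 : 1 < lam) (a_gt0 : 0 < a) (rho_gt0 : 0 < rho).
Hypotheses (p_ge1 : (1 <= p)%E) (q_ge1 : (1 <= q)%E).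
Hypotheses (r_gt0 : (0 < r)%N) (l_gt0 : (0 < l)%N).
Hypothesis rate_gt0 : 0 < rate_exponent lam p q r.
Local Notation W := (sobolev_ball lam a r p).
Local Notation rate := (rate_exponent lam p q r).
Local Notation mi := (mesh_index l j0).

Lemma sandwich (x : \bar R) (C y : R) : 0 < C -> (x <= (C * y)%:E)%E ->
  ((C^-1)%:E * x <= y%:E)%E.
Proof. by move=> C0; rewrite lee_pdivrMl. Qed.

Lemma truncated_op_optimal A k N C : has_kernel A k N (l + j0).-1 C -> reproduces A r ->
  let S := fun n => truncated_op A lam rho (mi n) in
  let width := sampling_width lam a q W in
  let err := fun n => sampling_error lam a q W (S n) in
  let rt := fun n : nat => (n%:R `^ (- rate))%:E in
  let admissible := [set n | (1 <= mi n)%N] in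
  [/\ forall n, admissible n -> sampling_algorithms n (S n),
      asymp admissible width err,
      asymp admissible err rt &
      asymp [set n | (1 <= n)%N] width rt].
Proof.
move=> HA repA S width err rt admissible.
have rE : r.-1.+1 = r by rewrite prednK.
have rate0 : 0 < rate_exponent lam p q r.-1.+1 by rewrite rE.
have c0 : 0 < rho * MRS_const lam by rewrite mulr_gt0// MRS_const_gt0.
have [c c_gt0 lower] := width_lower_bound r lam_gt1 a_gt0 p_ge1 q_ge1.
have repA' : reproduces A r.-1.+1 by rewrite rE.
have [C1 C10 upper] := truncated_error lam_gt1 a_gt0 p_ge1 q_ge1 rate0 HA repA' c0.
have [C0 C00 zero] := sobolev_ball_wnorm_bounded lam_gt1 a_gt0 p_ge1 q_ge1 rate0.
rewrite rE in upper zero.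
(* For m >= 1, 2 (m + l + j0) <= D m, so n <= D m(n) for every admissible n. *)
pose D : R := (2 * (1 + l + j0))%:R.
have D0 : 0 < D by rewrite ltr0n muln_gt0.
pose C2 := C1 * D `^ rate.
have C20 : 0 < C2 by rewrite mulr_gt0// powR_gt0.
have algS n : admissible n -> sampling_algorithms n (S n).
  rewrite /admissible/= => mn.
  exists (2 * (mi n + (l + j0).-1)).+1,
    (fun j => truncated_node (l + j0).-1 (mesh lam rho (mi n)) (mi n) j),
    (fun j => truncated_weight k (l + j0).-1 (rho * MRS_number lam (mi n))
                (mesh lam rho (mi n)) (mi n) j).
  split; first exact: mesh_index_nodes.
  by move=> f x; exact: truncated_opE HA mn c0.
have rate_mono n m : (0 < m)%N -> (0 < n)%N -> n%:R <= D * m%:R ->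
    m%:R `^ (- rate) <= D `^ rate * n%:R `^ (- rate).
  move=> m0 n0 nm; rewrite !powRN ler_pdivlMr ?powR_gt0 ?ltr0n// mulrC.
  rewrite ler_pdivrMr ?powR_gt0 ?ltr0n//.
  rewrite -powRM ?(ltW D0)//; apply: ge0_ler_powR; rewrite ?nnegrE ?mulr_ge0 ?(ltW D0) ?(ltW rate_gt0)//.
have errC n : admissible n -> (err n <= (C2 * n%:R `^ (- rate))%:E)%E.
  rewrite /admissible/= => mn; apply: ge_ereal_sup => _ [f fW <-].
  apply: (le_trans (upper _ f mn fW)); rewrite lee_fin /C2 -mulrA ler_pM2l//.
  have n0 : (0 < n)%N by exact: leq_trans mn (mesh_index_le l j0 n).
  apply: rate_mono => //; rewrite -natrM ler_nat.
  apply: (leq_trans (mesh_index_max j0 n l_gt0)); rewrite -mulnA leq_pmul2l//.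
  by rewrite !mulnDl mul1n !leq_add ?leq_pmulr.
have widthl n : (1 <= n)%N -> ((c * n%:R `^ (- rate))%:E <= width n)%E.
  by move=> n1; apply: le_ereal_inf_tmp => _ [S' S'n <-]; exact: lower.
have widthe n : admissible n -> (width n <= err n)%E.
  by move=> nA; apply: ereal_inf_lbound; exists (S n) => //; exact: algS.
have adm1 n : admissible n -> (1 <= n)%N.
  by move=> mn; exact: leq_trans mn (mesh_index_le l j0 n).
have lowmul (n : nat) (x : \bar R) : ((c * n%:R `^ (- rate))%:E <= x)%E ->
    ((n%:R `^ (- rate))%:E <= (c^-1)%:E * x)%E.
  by rewrite lee_pdivlMl// -EFinM.
split => //.
- exists 1, (C2 / c); split => //; first by rewrite divr_gt0.
  move=> n nA; rewrite mul1e; split; first exact: widthe.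
  apply: (le_trans (errC n nA)); rewrite (EFinM C2) (EFinM C2) -muleA.
  by apply: lee_wpmul2l; [rewrite lee_fin ltW|apply/lowmul/widthl/adm1].
- exists C2^-1, c^-1; split; rewrite ?invr_gt0// => n nA; split.
    by apply: sandwich => //; exact: errC.
  by apply: lowmul; apply: le_trans (widthe n nA); apply: widthl; exact: adm1.
pose C3 := C2 + C0 * D `^ rate.
have C30 : 0 < C3 by rewrite addr_gt0// mulr_gt0// powR_gt0.
exists C3^-1, c^-1; split; rewrite ?invr_gt0// => n n1; split; last first.
  by apply: lowmul; exact: widthl.
apply: sandwich => //.
have [nA|nA] := leqP 1 (mi n).
  apply: (le_trans (widthe n nA)); apply: (le_trans (errC n nA)).
  by rewrite lee_fin ler_wpM2r ?powR_ge0// lerDl mulr_ge0 ?powR_ge0// ltW.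
(* Here m(n) = 0, so n <= 2 (l + j0) is bounded, the rate is bounded below, and the zero algorithm
   suffices. *)
apply: (@le_trans _ _ (sampling_error lam a q W (fun _ _ => 0))).
  by apply: ereal_inf_lbound; exists (fun _ _ => 0) => //; exact: zero_sampling.
apply: ge_ereal_sup => _ [f fW <-].
have -> : f \- (fun=> 0) = f by apply/funext => t /=; rewrite subr0.
apply: (le_trans (zero f fW)); rewrite lee_fin /C3 mulrDl -[leLHS]add0r.
apply: lerD; first by rewrite mulr_ge0 ?powR_ge0// ltW.
rewrite -mulrA -[leLHS]mulr1 ler_pM2l//.
have := @rate_mono n 1%N isT n1; rewrite powR1; apply.
rewrite mulr1 ler_nat; apply: (leq_trans (mesh_index_max j0 n l_gt0)).
by move: nA; rewrite ltnS leqn0 => /eqP ->; rewrite leq_pmul2l// !add0n !leq_add.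
Qed.

End OptimalSampling.

Theorem theorem3p4 (R : realType) (lam a : R) (p q : \bar R) (r l j0 : nat)
    (c : int -> R) (rho : R) (S : nat -> (R -> R) -> R -> R)
    (lam_gt1 : 1 < lam) (a_gt0 : 0 < a)
    (p_ge1 : (1 <= p)%E) (q_ge1 : (1 <= q)%E)
    (r_gt0 : (0 < r)%N) (l_gt0 : (0 < l)%N) (r_le : (r <= 2 * l)%N)
    (j0_ge : (l - 1 <= j0)%N) (c_mask : quasi_interp_mask l j0 c)
    (rate_gt0 : 0 < rate_exponent lam p q r)
    (hS :
      [/\ 0 < rho, rho < quasi_interp_bound lam a l j0 &
          S = fun n => truncated_op (quasi_interp l j0 c) lam rho (mesh_index l j0 n)]
      \/
      [/\ (1 < l)%N, 0 < rho, rho < spline_interp_bound lam a l j0 &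
          S = fun n => truncated_op (spline_interp l j0 c) lam rho (mesh_index l j0 n)]) :
  let W := sobolev_ball lam a r p in
  let width := sampling_width lam a q W in
  let err := fun n => sampling_error lam a q W (S n) in
  let rate := fun n : nat => (n%:R `^ (- rate_exponent lam p q r))%:E in
  let admissible := [set n | (1 <= mesh_index l j0 n)%N] in
  [/\ forall n, admissible n -> sampling_algorithms n (S n),
      asymp admissible width err,
      asymp admissible err rate &
      asymp [set n | (1 <= n)%N] width rate].
Proof.
case: hS => [[rho0 _ ->]|[_ rho0 _ ->]].
- have [k [C HA]] := has_kernel_quasi_interp l_gt0 j0 c.
  apply: (truncated_op_optimal lam_gt1 a_gt0 rho0 p_ge1 q_ge1 r_gt0 l_gt0 rate_gt0 HA).
  by move=> P sP; apply: (reproduces_quasi_interp c_mask); exact: leq_trans r_le.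
- have [k [N [C HA]]] := has_kernel_spline_interp l_gt0 j0 c.
  apply: (truncated_op_optimal lam_gt1 a_gt0 rho0 p_ge1 q_ge1 r_gt0 l_gt0 rate_gt0 HA).
  by move=> P sP; apply: (reproduces_spline_interp c_mask); exact: leq_trans r_le.
Qed.
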